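(* Let $\lambda:=\mathbb{E}\left[\frac{Y_1}{\xi_1(1-\xi_1)}\right]$ and $\sigma^2:=\mathrm{Var}[\zeta_1]$ with $\sigma\ge 0$. Suppose that $\lambda\neq 0$, $\mathbb{P}[Y_1=0]<1$, $\mathbb{E}[\zeta_1]=0$ and $\sigma^2>0$. Let $c_{\rm crit}:=\sigma 2^{-1/2}$. (i) If there exist constants $c>c_{\rm crit}$ and $n_0\in\mathbb{Z}^+$, $n_0\ge 3$, such that $\lambda\chi(n)\ge c\,n^{-1/2}(\log\log n)^{1/2}$ for all integers $n\ge n_0$, then $\eta_t(\omega)$ is ergodic for $\mathbb{P}$-almost every $\omega$. (ii) If there exist constants $c\le c_{\rm crit}$ and $n_0\in\mathbb{Z}^+$, $n_0\ge 3$, such that $|\lambda|\chi(n)\le c\,n^{-1/2}(\log\log n)^{1/2}$ for all integers $n\ge n_0$, then $\eta_t(\omega)$ is null-recurrent for $\mathbb{P}$-almost every $\omega$. (iii) If there exist constants $c>c_{\rm crit}$ and $n_0\in\mathbb{Z}^+$, $n_0\ge 3$, such that $\lambda\chi(n)\le -c\,n^{-1/2}(\log\log n)^{1/2}$ for all integers $n\ge n_0$, then $\eta_t(\omega)$ is transient for $\mathbb{P}$-almost every $\omega$.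
   Context: $\mathbb{Z}^+=\{0,1,2,\ldots\}$. Let $\chi:[0,\infty)\to[0,\infty)$ be a function with $\lim_{x\to\infty}\chi(x)=0$. Fix $\varepsilon$ with $0<\varepsilon<1/2$. On a probability space $(\Omega,\mathcal{F},\mathbb{P})$, with expectation $\mathbb{E}$ and variance $\mathrm{Var}$, let $(\xi_i,Y_i)$, $i=1,2,\ldots$, be i.i.d. pairs of random variables such that $\mathbb{P}[\varepsilon\le\xi_1\le 1-\varepsilon]=1$ and $Y_1$ takes values in $[-1,1]$; $Y_i$ is allowed to depend on $\xi_i$. Put $\zeta_n:=\log\left(\frac{\xi_n}{1-\xi_n}\right)$. For $n=1,2,\ldots$ let $p_n:=\xi_n+Y_n\chi(n)$ if $\varepsilon/2\le\xi_n+Y_n\chi(n)\le 1-\varepsilon/2$, let $p_n:=\varepsilon/2$ if $\xi_n+Y_n\chi(n)<\varepsilon/2$, let $p_n:=1-\varepsilon/2$ if $\xi_n+Y_n\chi(n)>1-\varepsilon/2$; and let $q_n:=1-p_n$. A realization $\omega$ of $(p_n,q_n)_{n\ge1}$ is called an environment. Given $\omega$, $(\eta_t(\omega);t\in\mathbb{Z}^+)$ is the Markov chain on $\mathbb{Z}^+$, started at some fixed $r\in\mathbb{Z}^+$, which from $n\ge 1$ jumps to $n-1$ with probability $p_n$ and to $n+1$ with probability $q_n$, and from $0$ jumps to $1$ with probability $1/2$ and stays at $0$ with probability $1/2$. ''Ergodic'' means positive recurrent; ''transient'' and ''null-recurrent'' have their usual meaning for an irreducible countable Markov chain. These properties refer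 to the chain for the fixed environment $\omega$ (quenched). *)

(* Defs.v *)
From mathcomp Require Import all_boot all_order all_algebra finmap.
From mathcomp Require Import all_classical all_reals all_analysis.

Set Implicit Arguments.
Unset Strict Implicit.
Unset Printing Implicit Defensive.

Import Order.TTheory GRing.Theory Num.Theory.
Import numFieldNormedType.Exports.

Local Open Scope classical_set_scope.
Local Open Scope ring_scope.

Definition mutually_independent d d' (T : measurableType d)
    (T' : measurableType d') (R : realType) (P : probability T R)
    (I : set nat) (Z : nat -> T -> T') : Prop :=
  forall (J : {fset nat}) (A : nat -> set T'),
    [set` J] `<=` I ->
    (forall i, i \in J -> measurable (A i)) ->
    P (\bigcap_(i in [set` J]) Z i @^-1` A i) =
      (\prod_(i <- J) P (Z i @^-1` A i))%E.

Definition identically_distributed d d' (T : measurableType d)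
    (T' : measurableType d') (R : realType) (P : probability T R)
    (I : set nat) (Z : nat -> T -> T') : Prop :=
  forall i j (A : set T'), I i -> I j -> measurable A ->
    P (Z i @^-1` A) = P (Z j @^-1` A).

Definition iid d d' (T : measurableType d) (T' : measurableType d')
    (R : realType) (P : probability T R) (I : set nat) (Z : nat -> T -> T') :=
  mutually_independent P I Z /\ identically_distributed P I Z.

Definition truncate (R : realType) (eps v : R) : R :=
  if v < eps / 2 then eps / 2
  else if 1 - eps / 2 < v then 1 - eps / 2
  else v.

(* p n is the probability of a step down from n >= 1; p 0 is not used. *)
Definition walk_kernel (R : realType) (p : nat -> R) (i j : nat) : R :=
  match i with
  | 0 => if (j == 0%N) || (j == 1%N) then 1 / 2 else 0
  | n.+1 => if j == n then p n.+1
            else if j == n.+2 then 1 - p n.+1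
            else 0
  end.

(* Under Q, X is a time-homogeneous Markov chain with transition matrix K
   started at r.  The Markov property is written multiplicatively so that
   histories of probability zero need no separate treatment. *)
Definition markov_chain d (S : measurableType d) (R : realType)
    (Q : probability S R) (K : nat -> nat -> R) (r : nat)
    (X : nat -> {mfun S >-> nat}) : Prop :=
  Q [set w | X 0%N w = r] = 1%E /\
  forall (t : nat) (x : nat -> nat),
    Q [set w | forall s, (s <= t.+1)%N -> X s w = x s] =
    (Q [set w | forall s, (s <= t)%N -> X s w = x s] *
      (K (x t) (x t.+1))%:E)%E.

(* The infimum over the empty set is +oo: paths that never return to r. *)
Definition return_time (R : realType) (S : Type) (X : nat -> S -> nat)
    (r : nat) (w : S) : \bar R :=
  ereal_inf [set (t%:R : R)%:E | t in [set t | (0 < t)%N /\ X t w = r]].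

(* Recurrence types of a Markov chain X with law Q started at r, read off the
   starting state: these notions are used for irreducible chains only, where
   the type is common to all states. *)
Section recurrence_types.
Context d (S : measurableType d) (R : realType) (Q : probability S R).
Variables (r : nat) (X : nat -> {mfun S >-> nat}).

Definition recurrent : Prop :=
  Q [set w | (return_time R X r w < +oo)%E] = 1%E.

Definition transient : Prop :=
  (Q [set w | return_time R X r w < +oo] < 1)%E.

Definition ergodic : Prop :=
  recurrent /\ (\int[Q]_w return_time R X r w < +oo)%E.

Definition null_recurrent : Prop :=
  recurrent /\ (\int[Q]_w return_time R X r w = +oo)%E.

End recurrence_types.

(* Only meaningful for n >= 3, where ln (ln n) is positive. *)
Definition lil_rate (R : realType) (n : nat) : R :=
  n%:R `^ (- (1 / 2)) * ln (ln n%:R) `^ (1 / 2).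

(* Main.v *)
Require Import Defs.
From mathcomp Require Import all_boot all_order all_algebra finmap.
From mathcomp Require Import all_classical all_reals all_analysis measurable_realfun.
From mathcomp Require Import ring lra zify.

Set Implicit Arguments.
Unset Strict Implicit.
Unset Printing Implicit Defensive.

Import Order.TTheory GRing.Theory Num.Theory.
Import numFieldNormedType.Exports.

Local Open Scope classical_set_scope.
Local Open Scope ring_scope.

(* Write L_i = ln (p_i / q_i).  The reversible measure of the chain shows that it is transient
   when the exponentials of the partial sums S_n = L_1 + ... + L_n are summable, ergodic when
   their inverses are summable, and null recurrent when neither series converges.

   Expanding the logarithm, L_i = zeta_i + chi(i) Y_i / (xi_i (1 - xi_i)) + O(chi(i)^2), and an
   exponential supermartingale shows that the second term may be replaced by lambda chi(i)
   at the cost of a constant plus a multiple of the sum of the chi(i)^2.  Since the sum of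
   i^(-1/2) (ln ln i)^(1/2) over i <= n is asymptotically 2 (n ln ln n)^(1/2), a drift above the
   critical constant beats the fluctuations of the sums of zeta_i, which the upper half of the
   law of the iterated logarithm bounds by sigma (2 n ln ln n)^(1/2).  This gives (i) and (iii).

   At and below the critical constant one needs a sharper lower half: infinitely often, the
   sum of the zeta_i exceeds sigma (2 n ln ln n)^(1/2) + D (ln n)^2, where the last term absorbs
   the quadratic errors.  By the conditional Borel-Cantelli lemma it is enough to bound below
   the probability of such an excess on each of a sequence of long blocks, up to a
   constant factor.  Lindeberg's replacement method with a smooth step function
   transfers this to symmetric Bernoulli sums, for which binomial coefficients give
   the estimate. *)

(** * Birth and death chains *)

(** At the critical constant the drift sum can cancel the iterated logarithm level exactly, so the
    outcome rests on terms of lower order. There chi(i)^2 is at most of order ln ln i / i, with sums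
    at most of order (ln n)^2. This is far below (n ln ln n)^(1/2), yet a lower half of the law that
    loses a factor 1 - e of the level would already lose too much. Raising the level by D (ln n)^2
    costs only a constant factor in probability.

    The probability in question is about 1 / (ln n (ln ln n)^(1/2)) and tends to 0, so a central
    limit theorem without rate says nothing about it. The replacement error is of order X^3 /
    n^(1/2) at a level of X standard deviations, with X^2 close to 2 ln ln n, and this is much
    smaller than the probability.

    Null recurrence needs partial sums S_n >= 0 and S_n <= 0, each infinitely often. One statement
    serves both, applied once more with the signs of the log odds and of lambda reversed; this is
    why its hypothesis bounds |lambda| chi. *)

Section birth_death_survival.
Context (R : realType) (p : nat -> R) (r : nat) (a : R).
Hypothesis a_gt0 : 0 < a.
Hypothesis p_bnd : forall i, (0 < i)%N -> a <= p i <= 1 - a.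

Definition pdown i : R := if i is 0 then 1 / 2 else p i.
Definition pup i : R := 1 - pdown i.

Definition kill (h : nat -> R) i := if i == r then 0 else h i.

Definition kstep (h : nat -> R) i := pdown i * h i.-1 + pup i * h i.+1.

(** The probability that the chain from [i] is not at [r] at any of the times 1 to [u]. Killing acts
    after the step, so the start may be [r] itself, and [survival u r] is the tail of the return
    time. *)
Fixpoint survival u i : R :=
  if u is v.+1 then kstep (kill (survival v)) i else 1.

(** The increments of the scale function: sums of [gam] are harmonic at all positive states, and
    [1 / (pup k * gam k)] is a reversible measure. *)
Definition gam n : R := \prod_(1 <= i < n.+1) (p i / (1 - p i)).

Lemma p_gt0 i : (0 < i)%N -> 0 < p i.
Proof. by move=> /p_bnd/andP[+ _]; exact: lt_le_trans. Qed.

Lemma p_lt1 i : (0 < i)%N -> p i < 1.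
Proof. by move=> /p_bnd/andP[_ le1]; move: a_gt0 le1; lra. Qed.

Lemma pdown_gt0 i : 0 < pdown i.
Proof. by case: i => [|i] /=; [lra|exact: p_gt0]. Qed.

Lemma pup_gt0 i : 0 < pup i.
Proof. by rewrite /pup; case: i => [|i] /=; [lra|rewrite subr_gt0 p_lt1]. Qed.

Lemma gam_gt0 n : 0 < gam n.
Proof.
rewrite /gam big_nat; elim/big_ind: _ => // [x y|i /andP[i0 _]]; first exact: mulr_gt0.
by rewrite divr_gt0 ?subr_gt0 ?p_gt0 ?p_lt1.
Qed.

Lemma gamS n : pup n.+1 * gam n.+1 = pdown n.+1 * gam n.
Proof.
rewrite /gam [in LHS]big_nat_recr//= -/(gam n) /pup /=.
by field; rewrite subr_eq0 gt_eqF// p_lt1.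
Qed.

Lemma kstep_le h g i : (forall j, h j <= g j) -> kstep h i <= kstep g i.
Proof.
by move=> hg; rewrite lerD// ler_wpM2l// ?hg// ltW// ?pdown_gt0 ?pup_gt0.
Qed.

Lemma kstep_ge0 h i : (forall j, 0 <= h j) -> 0 <= kstep h i.
Proof. by move=> h0; rewrite addr_ge0// mulr_ge0// ltW ?pdown_gt0 ?pup_gt0. Qed.

Lemma kill_ge0 h : (forall j, 0 <= h j) -> forall j, 0 <= kill h j.
Proof. by move=> h0 j; rewrite /kill; case: ifP. Qed.

Lemma kill_le h g : (forall j, j != r -> h j <= g j) ->
  forall j, kill h j <= kill g j.
Proof. by move=> hg j; rewrite /kill; case: eqVneq => // /hg. Qed.

Lemma survival_ge0 u i : 0 <= survival u i.
Proof.
by elim: u i => //= u IH i; apply/kstep_ge0/kill_ge0.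
Qed.

Lemma survival_le1 u i : survival u i <= 1.
Proof.
elim: u i => //= u IH i; have d0 := ltW (pdown_gt0 i); have u0 := ltW (pup_gt0 i).
have kill1 j : kill (survival u) j <= 1 by rewrite /kill; case: ifP.
rewrite (_ : 1 = pdown i * 1 + pup i * 1); last by rewrite /pup; ring.
by rewrite /kstep lerD// ler_wpM2l.
Qed.

Lemma survivalS u i : survival u.+1 i <= survival u i.
Proof.
elim: u i => [|u IH] i; first exact: survival_le1.
by apply: kstep_le; apply: kill_le => j _; exact: IH.
Qed.

(** Comparison with a harmonic function: the normalized sums of [gam] from [r] on vanish up to [r],
    are harmonic beyond it and stay below 1, so induction on time puts them under every
    [survival u]. The first step up from [r] then gives the bound. *)
Lemma survival_lower (M : R) : (forall n, \sum_(0 <= k < n) gam k <= M) ->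
  exists2 e : R, 0 < e & forall u, e <= survival u r.
Proof.
move=> gamM.
have M0 : 0 < M.
  by rewrite (lt_le_trans _ (gamM 1%N))// big_nat1 gam_gt0.
pose h i := (\sum_(r <= k < i) gam k) / M.
have sum_le i : \sum_(r <= k < i) gam k <= M.
  have [ri|ir] := leqP r i; last by rewrite big_geq ?ltW// ltnW.
  apply: le_trans (gamM i); rewrite [leRHS](@big_cat_nat _ _ _ r)//= lerDr.
  by apply: sumr_ge0 => *; rewrite ltW ?gam_gt0.
have h0 i : (i <= r)%N -> h i = 0 by move=> ir; rewrite /h big_geq// mul0r.
have h1 i : h i <= 1 by rewrite /h ler_pdivrMr// mul1r.
have hS i : (r <= i)%N -> h i.+1 = h i + gam i / M.
  by move=> ri; rewrite /h big_nat_recr//= mulrDl.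
have hk j : h j = kill h j.
  by rewrite /kill; case: eqVneq => // ->; rewrite h0.
have hs u i : h i <= survival u i.
  elim: u i => //= u IH i.
  have [ir|ri] := leqP i r.
    by rewrite h0//; apply/kstep_ge0/kill_ge0 => j; exact: survival_ge0.
  apply: (@le_trans _ _ (kstep (kill h) i)); last first.
    by apply: kstep_le; apply: kill_le => j _; exact: IH.
  rewrite /kstep -!hk; case: i ri => // i ri; rewrite (hS i.+1) 1?ltnW// (hS i)//=.
  have := gamS i; have -> : pup i.+1 = 1 - pdown i.+1 by [].
  move=> E; rewrite le_eqVlt; apply/orP; left; apply/eqP.
  have E' : (1 - pdown i.+1) * (gam i.+1 / M) = pdown i.+1 * (gam i / M).
    by rewrite !mulrA E.
  by rewrite -/(pdown i.+1); lra.
exists (pup r * h r.+1).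
  by rewrite mulr_gt0// ?pup_gt0// hS// h0// add0r divr_gt0// gam_gt0.
case=> [|u] /=.
  have := pup_gt0 r; have := pdown_gt0 r; have := h1 r.+1; rewrite /pup => *.
  have : 0 <= h r.+1 by rewrite hS// h0// add0r ltW// divr_gt0// gam_gt0.
  move=> *; nra.
rewrite /kstep ler_wpDl//.
  apply: mulr_ge0; first exact/ltW/pdown_gt0.
  by apply: kill_ge0 => j; exact: survival_ge0.
rewrite ler_wpM2l ?(ltW (pup_gt0 _))// /kill ifN; last by rewrite neq_ltn ltnSn orbT.
by apply: hs.
Qed.

Lemma lim_survivalE i : survival u i @[u --> \oo] --> limn (survival^~ i).
Proof.
apply: nonincreasing_is_cvgn.
  by apply/nonincreasing_seqP => u; exact: survivalS.
by exists 0 => _ [u _ <-]; exact: survival_ge0.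
Qed.

Lemma kstep_cvg (h : nat -> nat -> R) g i :
  (forall j, h u j @[u --> \oo] --> g j) ->
  kstep (kill (h u)) i @[u --> \oo] --> kstep (kill g) i.
Proof.
move=> hg.
have kc j : kill (h u) j @[u --> \oo] --> kill g j.
  by rewrite /kill; case: ifP => // _; exact: cvg_cst.
by apply: cvgD; apply: cvgM => //; exact: cvg_cst.
Qed.

Lemma sum_ge_unbounded (f : nat -> R) m :
  (forall M : R, exists n, M <= \sum_(0 <= k < n) f k) ->
  (forall k, 0 <= f k) ->
  forall M : R, exists2 n, (m <= n)%N & M <= \sum_(m <= k < n) f k.
Proof.
move=> foo f0 M; have [n Mn] := foo (M + \sum_(0 <= k < m) f k).
exists (maxn m n); first exact: leq_maxl.
rewrite -(lerD2r (\sum_(0 <= k < m) f k)) (le_trans Mn)//.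
rewrite [leRHS]addrC -big_cat_nat//= ?leq_maxl//.
by rewrite [leRHS](@big_cat_nat _ _ _ n)//= ?leq_maxr// lerDl sumr_ge0.
Qed.

(** The limit [s] is a bounded solution of the killed equation. Above [r] it is a multiple of the
    partial sums of [gam], and boundedness leaves only the multiple 0. Below [r] the boundary at 0
    forces zero increments, so [s] there equals the killed value 0 at [r]. *)
Lemma survival_cvg0 : (forall M : R, exists n, M <= \sum_(0 <= k < n) gam k) ->
  survival u r @[u --> \oo] --> 0.
Proof.
move=> gamoo; pose s i : R := limn (survival^~ i).
have sE i : s i = kstep (kill s) i.
  have := @lim_survivalE i; rewrite -(cvg_shiftS (survival^~ i)) => h1.
  have h2 := @kstep_cvg survival s i (@lim_survivalE).
  exact: (cvg_unique _ h1 h2).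
have s0 i : 0 <= s i.
  apply: limr_ge; first exact: lim_survivalE.
  by apply: nearW => u; exact: survival_ge0.
have s1 i : s i <= 1.
  apply: limr_le; first exact: lim_survivalE.
  by apply: nearW => u; exact: survival_le1.
have inc (i : nat) : i != r -> (0 < i)%N ->
    pup i * (kill s i.+1 - s i) = pdown i * (s i - kill s i.-1).
  by move=> ir i0; rewrite {1}[s i]sE {1}sE /kstep /pup; ring.
pose t i := kill s (r + i)%N.
have t0 : t 0%N = 0 by rewrite /t /kill addn0 eqxx.
have tE i : (0 < i)%N -> t i = s (r + i)%N.
  by move=> i0; rewrite /t /kill ifN//; lia.
have above i : t i = t 1%N / gam r * \sum_(r <= k < (r + i)%N) gam k.
  suff : t i = t 1%N / gam r * \sum_(r <= k < (r + i)%N) gam k /\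
         t i.+1 - t i = t 1%N / gam r * gam (r + i)%N by case.
  elim: i => [|i [IH1 IH2]].
    rewrite t0 subr0 addn0 big_geq// mulr0 mulfVK//.
    by rewrite gt_eqF// gam_gt0.
  have E : t i.+1 = t 1%N / gam r * \sum_(r <= k < (r + i.+1)%N) gam k.
    rewrite addnS big_nat_recr/= ?leq_addr// mulrDr -IH1 -IH2; ring.
  split => //.
  have := @inc (r + i.+1)%N ltac:(lia) ltac:(lia); rewrite -tE// addnS/= -/(t i).
  rewrite -2!addnS -/(t i.+2) => H.
  apply: (mulfI (lt0r_neq0 (pup_gt0 (r + i.+1)%N))); rewrite addnS.
  by rewrite [RHS]mulrCA gamS mulrCA -IH2; move: H; rewrite !addnS.
have t1 : t 1%N = 0.
  apply/eqP; rewrite eq_le; apply/andP; split; last by rewrite tE.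
  rewrite leNgt; apply/negP => t10.
  have c0 : 0 < t 1%N / gam r by rewrite divr_gt0// gam_gt0.
  have [n rn Mn] := sum_ge_unbounded r gamoo (fun k => ltW (gam_gt0 k))
     (2 / (t 1%N / gam r)).
  have := above (n - r)%N; rewrite subnKC// => H.
  have t1le : t (n - r)%N <= 1 by rewrite /t /kill; case: ifP.
  move: Mn; rewrite ler_pdivrMr// mulrC -H => H2.
  by have := le_trans H2 t1le; lra.
have below j : (j < r)%N -> s j = kill s j.+1.
  elim: j => [|j IH] jr.
    have := sE 0%N; rewrite /kstep /pup /= [kill s 0]/kill ifN ?neq_ltn ?jr//; lra.
  have := inc j.+1; rewrite neq_ltn jr/= => /(_ isT isT).
  have := IH (ltnW jr); rewrite {1 3}/kill !ifN ?neq_ltn ?jr ?(ltnW jr)// => ->.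
  rewrite subrr mulr0 => /eqP; rewrite mulf_eq0 gt_eqF ?pup_gt0//= subr_eq0.
  by move=> /eqP ->.
have : s r = 0.
  rewrite sE /kstep -addn1 -/(t 1%N) t1 mulr0 addr0.
  rewrite [kill _ _](_ : _ = 0) ?mulr0//.
  rewrite {1}/kill; case: eqVneq => // rr; have r0 : (0 < r)%N by lia.
  by rewrite below ?prednK// /kill eqxx.
by move=> <-; exact: lim_survivalE.
Qed.

(* The chain from $i$ needs on average at most $G(i)$ steps to reach $r$, where $G$ solves
   $G = 1 + KG$ off $r$; above $r$ the increments of $G$ are $\gamma_i$ times a tail sum
   of $1/(q\gamma)$, which only has to be positive. *)
Lemma sum_survival_bounded (M : R) :
  (forall n, \sum_(0 <= k < n) (gam k)^-1 <= M) ->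
  exists C : R, forall n, \sum_(0 <= u < n) survival u r <= C.
Proof.
move=> gamM.
(* Since [pup k] is at least [a], this bounds all partial sums of [1 / (pup k * gam k)]; [L] minus a
   partial sum stands in for the tail, without any limit. *)
pose L := M / a.
pose Dl i := gam i * (L - \sum_(0 <= k < i.+1) (pup k * gam k)^-1).
(* The mean time to climb from [i] to [i.+1], by first step analysis; a downward step at [0] stays
   in place. *)
pose Db := fix Db i := (1 + pdown i * (if i is j.+1 then Db j else 0)) / pup i.
pose G i : R := if (r <= i)%N then \sum_(r <= k < i) Dl k
              else \sum_(i <= k < r) Db k.
have a_pup k : a <= pup k.
  by case: k => [|k]; [have /andP[] := p_bnd (ltn0Sn 0) | have /andP[_] := p_bnd (ltn0Sn k)];
     rewrite /pup /=; lra.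
have sumL i : \sum_(0 <= k < i) (pup k * gam k)^-1 <= L.
  rewrite /L ler_pdivlMr//; apply: le_trans (gamM i).
  rewrite mulr_suml ler_sum// => k _.
  rewrite invfM mulrAC ler_piMl ?invr_ge0 ?(ltW (gam_gt0 _))//.
  by rewrite mulrC ler_pdivrMr ?pup_gt0// mul1r.
have Dl0 i : 0 <= Dl i by rewrite mulr_ge0 ?(ltW (gam_gt0 _))// subr_ge0.
have Db0 i : 0 <= Db i.
  elim: i => [|i IH] /=; first by rewrite mulr0 addr0 divr_ge0// ltW// pup_gt0.
  by rewrite divr_ge0 ?(ltW (pup_gt0 _))// addr_ge0// mulr_ge0// ltW// (pdown_gt0 i.+1).
have Gr : G r = 0 by rewrite /G leqnn big_geq.
have G0 i : 0 <= G i by rewrite /G; case: ifP => _; apply: sumr_ge0.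
have kG j : kill G j = G j by rewrite /kill; case: eqVneq => // ->; rewrite Gr.
have DlS i : pup i.+1 * Dl i.+1 = pdown i.+1 * Dl i - 1.
  rewrite /Dl !mulrA -gamS [in LHS]big_nat_recr//= opprD addrA mulrDr mulrN.
  by rewrite mulfV// mulf_neq0 ?lt0r_neq0 ?pup_gt0 ?gam_gt0.
have GE i : i != r -> G i = 1 + kstep G i.
  rewrite neq_ltn => /orP[ir|]; last first.
    case: i => // i; rewrite ltnS => ri.
    rewrite /kstep /= /G (leqW (leqW ri)) (leqW ri) ri.
    rewrite (@big_nat_recr _ _ _ i.+1)/= 1?leqW// (@big_nat_recr _ _ _ i)//=.
    have := DlS i; rewrite -/(pdown i.+1) /pup; lra.
  have Gd j : (j < r)%N -> G j = Db j + G j.+1.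
    rewrite /G => jr; rewrite leqNgt jr/= big_ltn//; case: leqP => // rj.
    by rewrite !big_geq.
  case: i ir => [|i] ir.
    by rewrite (Gd 0%N)// /kstep /= (Gd 0%N)//= mulr0 /pup /=; field.
  rewrite (Gd i.+1)// /kstep (Gd i) 1?ltnW// (Gd i.+1)//=.
  by rewrite -/(pdown i.+1) /pup; field; exact/lt0r_neq0/pup_gt0.
pose m n i : R := \sum_(0 <= u < n) survival u i.
have mS n i : m n.+1 i = 1 + kstep (kill (m n)) i.
  rewrite /m big_nat_recl//=; congr (_ + _).
  rewrite /kstep big_split/= -!mulr_sumr /kill.
  by congr (_ * _ + _ * _); case: ifP => // _; rewrite big1_eq.
have mG n i : i != r -> m n i <= G i.
  elim: n i => [|n IH] i ir; first by rewrite /m big_geq.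
  rewrite mS GE// lerD2l; apply: kstep_le => j; rewrite -kG.
  by apply: kill_le => k kr; exact: IH.
exists (1 + kstep G r) => -[|n]; rewrite -/(m _ r).
  by rewrite /m big_geq// addr_ge0//; exact: kstep_ge0.
rewrite mS lerD2l; apply: kstep_le => j; rewrite -kG.
by apply: kill_le => k kr; exact: mG.
Qed.

(** If the mean return time were finite, the mean hitting times [t] above [r] would be finite and
    solve the equation with source 1. Divided by [gam], their increments drop by at least [1 / gam]
    per step, so the divergence of the inverses makes them at most -1; the divergence of [gam] then
    drives [t] below 0. *)
Lemma sum_survival_unbounded :
  (forall M : R, exists n, M <= \sum_(0 <= k < n) gam k) ->
  (forall M : R, exists n, M <= \sum_(0 <= k < n) (gam k)^-1) ->
  forall C : R, exists n, C <= \sum_(0 <= u < n) survival u r.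
Proof.
move=> gamoo igamoo C; apply/not_existsP => nC.
pose m n i : R := \sum_(0 <= u < n) survival u i.
have mC n : m n r <= C by rewrite ltW// ltNge; apply/negP/nC.
have mS n i : m n.+1 i = 1 + kstep (kill (m n)) i.
  rewrite /m big_nat_recl//=; congr (_ + _).
  rewrite /kstep big_split/= -!mulr_sumr /kill.
  by congr (_ * _ + _ * _); case: ifP => // _; rewrite big1_eq.
have m0 n i : 0 <= m n i by apply: sumr_ge0 => *; exact: survival_ge0.
(* A step up from [i] has positive probability, so finiteness spreads from [r] to every higher
   state. *)
have mup i : (r <= i)%N -> (exists D, forall n, m n i <= D) ->
    exists D, forall n, m n i.+1 <= D.
  move=> ri [D mD]; exists (D / pup i) => n.
  rewrite ler_pdivlMr ?pup_gt0// mulrC; apply: le_trans (mD n.+1); rewrite mS.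
  have -> : m n i.+1 = kill (m n) i.+1 by rewrite /kill ifN//; lia.
  rewrite /kstep addrA lerDr addr_ge0// mulr_ge0 ?(ltW (pdown_gt0 _))//.
  exact: kill_ge0.
have mbnd k : exists D, forall n, m n (r + k)%N <= D.
  elim: k => [|k IH]; first by exists C => n; rewrite addn0.
  by rewrite addnS; apply: mup => //; exact: leq_addr.
pose t k : R := if k is 0 then 0 else limn (fun n => m n (r + k)%N).
have mcvg k : (fun n => m n (r + k)%N) @ \oo --> limn (fun n => m n (r + k)%N).
  apply: nondecreasing_is_cvgn.
    apply/nondecreasing_seqP => n; rewrite /m big_nat_recr//= lerDl.
    exact: survival_ge0.
  by have [D mD] := mbnd k; exists D => _ [n _ <-]; exact: mD.
have t_cvg k : (fun n => kill (m n) (r + k)%N) @ \oo --> t k.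
  case: k => [|k].
    by rewrite /kill addn0 eqxx; exact: cvg_cst.
  rewrite (_ : (fun n => _) = fun n => m n (r + k.+1)%N); first exact: mcvg.
  by apply/funext => n; rewrite /kill ifN//; lia.
have t_ge0 k : 0 <= t k.
  case: k => [//|k]; apply: limr_ge; first exact: mcvg.
  by apply: nearW => n; exact: m0.
have tE k : t k.+1 = 1 + (pdown (r + k.+1)%N * t k + pup (r + k.+1)%N * t k.+2).
  have := @mcvg k.+1; rewrite -(cvg_shiftS (fun n => m n _)) => h1.
  apply: (cvg_unique _ h1) => //.
  rewrite (_ : (fun n => _) = fun n => 1 + (pdown (r + k.+1)%N * kill (m n) (r + k)%N
     + pup (r + k.+1)%N * kill (m n) (r + k.+2)%N)); last first.
    by apply/funext => n /=; rewrite mS /kstep !addnS.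
  apply: cvgD; first exact: cvg_cst.
  by apply: cvgD; apply: cvgM => //; exact: cvg_cst.
have t0 : t 0%N = 0 by [].
clearbody t.
have inc k : (t k.+1 - t k) / gam (r + k)%N <=
    t 1%N / gam r - \sum_(r.+1 <= j < (r + k).+1) (gam j)^-1.
  elim: k => [|k IH]; first by rewrite addn0 t0 subr0 big_geq// subr0.
  rewrite addnS big_nat_recr/= ?ltnS ?leq_addr// opprD addrA.
  have := tE k; have := gamS (r + k); have := pup_gt0 (r + k.+1).
  rewrite addnS => u0 gE tE'.
  have g1 := gam_gt0 (r + k); have g2 := gam_gt0 (r + k).+1.
  have E : (t k.+2 - t k.+1) / gam (r + k).+1 =
     (t k.+1 - t k) / gam (r + k)%N - (gam (r + k).+1)^-1 / pup (r + k).+1.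
    have -> : gam (r + k)%N = pup (r + k).+1 * gam (r + k).+1 / pdown (r + k).+1.
      by rewrite gE mulrAC divff ?mul1r// gt_eqF// pdown_gt0.
    have d0 := pdown_gt0 (r + k).+1.
    have -> : t k = (t k.+1 - 1 - pup (r + k).+1 * t k.+2) / pdown (r + k).+1.
      by rewrite {1}tE' -addrA; field; exact: lt0r_neq0.
    rewrite /pup in u0 *; field.
    by rewrite !lt0r_neq0.
  rewrite E lerB// ler_peMr ?invr_ge0 ?(ltW g2)// -[leLHS]invr1 lef_pV2 ?posrE//.
  by rewrite /pup gerBl ltW// pdown_gt0.
have [n1 rn1 Hn1] := sum_ge_unbounded r.+1 igamoo
  (fun k => ltW (etrans (invr_gt0 _) (gam_gt0 k))) (1 + t 1%N / gam r).
pose k1 := (n1 - r.+1)%N.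
have dec k : (k1 <= k)%N -> t k.+1 - t k <= - gam (r + k)%N.
  move=> kk1; have := inc k; rewrite ler_pdivrMr ?gam_gt0// => /le_trans; apply.
  rewrite -[leRHS]mulN1r ler_wpM2r ?(ltW (gam_gt0 _))//.
  rewrite lerBlDr -[leLHS](addKr 1).
  rewrite lerD2l; apply: le_trans Hn1 _.
  rewrite [leRHS](@big_cat_nat _ _ _ n1)//=; last by lia.
  by rewrite lerDl sumr_ge0// => j _; rewrite invr_ge0 ltW// gam_gt0.
have tle k : t (k1 + k)%N <= t k1 - \sum_(r + k1 <= j < r + k1 + k) gam j.
  elim: k => [|k IH]; first by rewrite !addn0 big_geq// subr0.
  rewrite !addnS big_nat_recr/= ?leq_addr// opprD addrA.
  have := dec (k1 + k)%N (leq_addr _ _); rewrite addnA; lra.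
have [n2 rn2 Hn2] := sum_ge_unbounded (r + k1) gamoo
  (fun k => ltW (gam_gt0 k)) (1 + t k1).
have := tle (n2 - (r + k1))%N; rewrite subnKC//.
by have := t_ge0 (k1 + (n2 - (r + k1)))%N; lra.
Qed.

End birth_death_survival.

(** * Real-valued probabilities *)

Section real_probability.
Context d (T : measurableType d) (R : realType) (P : probability T R).
Implicit Types A B : set T.

Definition pr A : R := fine (P A).

Lemma prE A : measurable A -> P A = (pr A)%:E.
Proof. by move=> mA; rewrite fineK// fin_num_measure. Qed.

Lemma pr_ge0 A : 0 <= pr A.
Proof. exact: fine_ge0. Qed.

Lemma pr_split A B : measurable A -> measurable B ->
  pr A = pr (A `&` B) + pr (A `&` ~` B).
Proof.
move=> mA mB; have mAB := measurableI _ _ mA mB.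
have mAC : measurable (A `&` ~` B) by apply: measurableI => //; exact: measurableC.
apply: EFin_inj; rewrite EFinD -!prE// (measureDI P mA mB) addeC.
by rewrite setDE.
Qed.

Lemma pr0 : pr set0 = 0.
Proof. by rewrite /pr measure0. Qed.

Lemma le_pr A B : measurable A -> measurable B -> A `<=` B -> pr A <= pr B.
Proof.
by move=> mA mB AB; rewrite -lee_fin -!prE// le_measure// inE.
Qed.

Lemma prC A : measurable A -> pr (~` A) = 1 - pr A.
Proof.
move=> mA; have := pr_split measurableT mA.
by rewrite !setTI {1}/pr probability_setT /= => ->; rewrite addrC addKr.
Qed.

End real_probability.

Lemma nneseries_real_pinfty (R : realType) (f : nat -> R) :
  (forall k, 0 <= f k) ->
  (forall C : R, exists n, C <= \sum_(0 <= k < n) f k) ->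
  (\sum_(0 <= k <oo) (f k)%:E = +oo)%E.
Proof.
move=> f0 foo; apply/eqyP => C _; have [n Cn] := foo C.
apply: le_trans (nneseries_lim_ge n _); first by rewrite sumEFin lee_fin.
by move=> k _ _; rewrite lee_fin.
Qed.

(** * Return times and recurrence types of the walk *)

Section walk_return_time.
Context d (S : measurableType d) (R : realType) (Q : probability S R).
Variables (p : nat -> R) (r : nat) (X : nat -> {mfun S >-> nat}) (a : R).
Hypothesis X_chain : markov_chain Q (walk_kernel p) r X.

Let q := pr Q.

Definition hist t (x : nat -> nat) := [set w | forall s, (s <= t)%N -> X s w = x s].

Definition avoids t u := [set w | forall s, (t < s <= t + u)%N -> X s w <> r].

Lemma measurable_chain s (A : set nat) : measurable [set w | A (X s w)].
Proof.
by rewrite -[X in measurable X]setTI; exact: (measurable_funP (X s)).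
Qed.

Lemma measurable_hist t x : measurable (hist t x).
Proof.
rewrite (_ : hist t x = \bigcap_(s in [set s | (s <= t)%N]) [set w | X s w = x s]).
  by apply: bigcap_measurable => [|s _]; [exists 0%N | exact: (measurable_chain s [set x s])].
by apply/seteqP; split => w /= H s; exact: H.
Qed.

Lemma measurable_avoids t u : measurable (avoids t u).
Proof.
case: u => [|u].
  rewrite (_ : avoids t 0 = setT)//; apply/seteqP; split => // w _ s.
  by rewrite addn0 ltnNge => /andP[/negbTE ->].
rewrite (_ : avoids _ _ = \bigcap_(s in [set s | (t < s <= t + u.+1)%N])
    [set w | X s w <> r]).
  apply: bigcap_measurable => [|s _].
    by exists t.+1 => /=; lia.
  exact: (measurable_chain s [set j | j <> r]).
by apply/seteqP; split => w /= H s; exact: H.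
Qed.

(** [markov_chain] speaks of complete histories only, so the induction on [u] extends the history by
    one state. Only [i.-1] and [i.+1], which differ also for [i] = 0, carry mass: their transition
    probabilities add up to 1, which makes the remaining event null. *)
Lemma hist_avoids u t x :
  q (hist t x `&` avoids t u) = q (hist t x) * survival p r u (x t).
Proof.
elim: u t x => [|u IH] t x.
  rewrite mulr1 (_ : avoids t 0 = setT) ?setIT//; apply/seteqP; split => // w _ s.
  by rewrite addn0 ltnNge => /andP[/negbTE ->].
set i := x t; pose y j s := if (s <= t)%N then x s else j.
have yt j : y j t = i by rewrite /y leqnn.
have yt1 j : y j t.+1 = j by rewrite /y ltnn.
have histS j : hist t.+1 (y j) = hist t x `&` [set w | X t.+1 w = j].
  apply/seteqP; split => w /=.
    move=> H; split; last by rewrite H// yt1.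
    by move=> s st; rewrite H ?leqW// /y st.
  move=> [H1 H2] s; rewrite leq_eqVlt => /orP[/eqP->|]; first by rewrite yt1.
  by rewrite ltnS => st; rewrite H1// /y st.
have qS j : q (hist t.+1 (y j)) = q (hist t x) * walk_kernel p i j.
  have [_ /(_ t (y j))] := X_chain; rewrite yt yt1.
  rewrite -/(hist t.+1 (y j)) (_ : [set w | _] = hist t x).
    rewrite (prE _ (measurable_hist _ _)) (prE _ (measurable_hist _ _)) -EFinM.
    exact: EFin_inj.
  by apply/seteqP; split => w /= H s st; rewrite H// /y st.
have kd : walk_kernel p i i.-1 = pdown p i.
  by rewrite /walk_kernel /pdown; case: (i) => [|k] //=; rewrite eqxx.
have ku : walk_kernel p i i.+1 = pup p i.
  rewrite /walk_kernel /pup /pdown; case: (i) => [|k] //=; first by lra.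
  by rewrite eqxx ifN//; lia.
have mB j : measurable [set w | X t.+1 w = j] := measurable_chain t.+1 [set j].
set B := fun j => [set w | X t.+1 w = j] in mB.
have BC : B i.+1 `&` ~` B i.-1 = B i.+1.
  by apply/setIidPl => w; rewrite /B /= => ->; lia.
have splitB E : measurable E -> q E =
    q (E `&` B i.-1) + (q (E `&` B i.+1) + q (E `&` ~` B i.-1 `&` ~` B i.+1)).
  move=> mE.
  have mEB : measurable (E `&` ~` B i.-1).
    by apply: measurableI => //; exact: measurableC (mB _).
  rewrite /q (pr_split Q mE (mB i.-1)) (pr_split Q mEB (mB i.+1)).
  by rewrite -[_ `&` B i.+1]setIA [~` _ `&` B _]setIC BC.
have mH := measurable_hist t x; have mA := measurable_avoids t u.+1.
have rest0 : q (hist t x `&` ~` B i.-1 `&` ~` B i.+1) = 0.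
  have := splitB _ mH; rewrite -!histS !qS kd ku /pup => H.
  by move: H; lra.
rewrite splitB; last exact: measurableI.
have -> : q (hist t x `&` avoids t u.+1 `&` ~` B i.-1 `&` ~` B i.+1) = 0.
  apply/eqP; rewrite eq_le pr_ge0 andbT -rest0; apply: le_pr.
  - by do !apply: measurableI => //; exact: measurableC (mB _).
  - by do !apply: measurableI => //; exact: measurableC (mB _).
  - by move=> w [[[? ?] ?] ?].
have qB j : q (hist t x `&` avoids t u.+1 `&` B j) =
    q (hist t x) * walk_kernel p i j * kill r (survival p r u) j.
  rewrite /kill; case: eqVneq => [->|jr].
    rewrite mulr0 (_ : _ `&` _ = set0); first exact: pr0.
    apply/seteqP; split => // w [[_ H] /= E]; apply: (H t.+1) => //; lia.
  have := IH t.+1 (y j); rewrite yt1 qS => <-.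
  rewrite histS -!setIA; congr (q (_ `&` _)).
  apply/seteqP; split => w /= [H1 H2]; split => //.
    by move=> s; rewrite addSnnS => /andP[/ltnW ts H]; apply: H1; rewrite ts.
  move=> s /andP[]; rewrite leq_eqVlt => /orP[/eqP <- _|ts H].
    by rewrite H1; exact/eqP.
  by apply: H2; rewrite ts addSnnS.
rewrite !qB kd ku addr0 /= /kstep; ring.
Qed.

Lemma prob_no_return u :
  Q [set w | forall s, (0 < s <= u)%N -> X s w <> r] = (survival p r u r)%:E.
Proof.
have [X0 _] := X_chain; have := @hist_avoids u 0 (fun=> r).
have h1 : q (hist 0 (fun=> r)) = 1.
  rewrite /q /pr (_ : hist _ _ = [set w | X 0%N w = r]) ?X0//.
  by apply/seteqP; split => w /= => [->|H [|]].
have mh := measurable_hist 0 (fun=> r); have ma := measurable_avoids 0 u.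
rewrite h1 mul1r => <-.
have -> : [set w | forall s, (0 < s <= u)%N -> X s w <> r] = avoids 0 u.
  by apply/seteqP; split.
rewrite (prE _ ma) /q; congr _%:E; rewrite (pr_split Q ma mh) setIC.
rewrite -[RHS]addr0; congr (_ + _); apply/eqP; rewrite eq_le pr_ge0 andbT.
rewrite (_ : 0 = pr Q (~` hist 0 (fun=> r))); last by rewrite prC// -/q h1 subrr.
apply: le_pr; last by move=> w [].
- by apply: measurableI => //; exact: measurableC.
- exact: measurableC.
Qed.

Lemma return_time_lty w :
  (return_time R X r w < +oo)%E <-> exists2 t, (0 < t)%N & X t w = r.
Proof.
split=> [|[t t0 Xt]].
  rewrite ltNge => /negP H; apply: contrapT => /forall2NP Hn; apply: H.
  by apply: le_ereal_inf_tmp => _ [t [t0 Xt] <-]; have [] := Hn t.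
apply: (@le_lt_trans _ _ (t%:R : R)%:E); last exact: ltry.
by apply: ereal_inf_lbound; exists t.
Qed.

Lemma return_set_measurable :
  measurable [set w | (return_time R X r w < +oo)%E].
Proof.
rewrite (_ : [set w | _] = \bigcup_(t in [set t | (0 < t)%N]) [set w | X t w = r]).
  by apply: bigcup_measurable => t _; exact: (measurable_chain t [set r]).
apply/seteqP; split => w /=.
  by move=> /return_time_lty[t t0 Xt]; exists t.
by move=> [t t0 Xt]; apply/return_time_lty; exists t.
Qed.

Let noret u := [set w | forall s, (0 < s <= u)%N -> X s w <> r].

Let measurable_noret u : measurable (noret u).
Proof.
rewrite (_ : noret u = avoids 0 u); first exact: measurable_avoids.
by apply/seteqP; split.
Qed.

Let no_returnE : ~` [set w | (return_time R X r w < +oo)%E] = \bigcap_u noret u.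
Proof.
apply/seteqP; split => w /=.
  by move=> H u _ s /andP[s0 _] Xs; apply: H; apply/return_time_lty; exists s.
by move=> H /return_time_lty[t t0 Xt]; apply: (H t I t) => //; rewrite t0 leqnn.
Qed.

Lemma prob_never_return :
  survival p r u r @[u --> \oo] --> pr Q (~` [set w | (return_time R X r w < +oo)%E]).
Proof.
have mn : measurable (\bigcap_u noret u).
  by apply: bigcapT_measurable => u; exact: measurable_noret.
rewrite no_returnE (_ : (fun u => _) = fine \o (Q \o noret)); last first.
  by apply/funext => u /=; rewrite prob_no_return.
apply: fine_cvg; rewrite -prE//; apply: nonincreasing_cvg_mu => //.
  by rewrite (le_lt_trans (probability_le1 _ _))// ltry.
move=> i j ij; apply/subsetPset => w H s /andP[s0 sm].
by apply: H; rewrite s0 (leq_trans sm).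
Qed.

(** The return time counts the [u] without a return up to time [u]. This is valid for the value +oo
    too, and turns the mean return time into a series of survival probabilities. *)
Lemma return_timeE w :
  return_time R X r w = (\sum_(0 <= u <oo) (\1_(noret u) w)%:E)%E.
Proof.
have [[t t0 Xt]|H] := pselect (exists2 t, (0 < t)%N & X t w = r); last first.
  rewrite (_ : return_time _ _ _ _ = +oo%E); last first.
    by apply/eqP; rewrite -leye_eq leNgt; apply/negP => /return_time_lty.
  transitivity (\sum_(0 <= u <oo) (1%:E : \bar R))%E; last first.
    apply: eq_eseriesr => u _; rewrite indicE mem_set// => s /andP[s0 _] Xs.
    by apply: H; exists s.
  apply/esym/nneseries_real_pinfty => // C; exists (Num.truncn C).+1.
  by rewrite big_const_nat subn0 iter_addr_0 ltW// truncnS_gt.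
have {t t0 Xt} [t /andP[t1 /eqP Xt1] tmin] := @ex_minnP (fun t => (0 < t)%N && (X t w == r))
  (ex_intro _ t (introT andP (conj t0 (introT eqP Xt)))).
have -> : return_time R X r w = (t%:R)%:E.
  apply/eqP; rewrite eq_le; apply/andP; split.
    by apply: ereal_inf_lbound; exists t.
  apply: le_ereal_inf_tmp => _ [s [s0 Xs] <-].
  by rewrite lee_fin ler_nat tmin// s0; exact/eqP.
rewrite (nneseries_split 0 t); last by move=> k _; rewrite lee_fin.
rewrite add0n eseries0 ?adde0; last first.
  move=> u tu _; rewrite indicE memNset// => /(_ t); apply => //.
  by rewrite t1.
rewrite (eq_big_nat _ _ (F2 := fun=> 1%:E)); last first.
  move=> u /andP[_ ut]; rewrite indicE mem_set// => s /andP[s0 su] Xs.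
  have /tmin : (0 < s)%N && (X s w == r) by rewrite s0; exact/eqP.
  by lia.
by rewrite sumEFin big_const_nat subn0 iter_addr_0.
Qed.

Lemma integral_return_time :
  (\int[Q]_w return_time R X r w = \sum_(0 <= u <oo) (survival p r u r)%:E)%E.
Proof.
under eq_integral do rewrite return_timeE.
rewrite integral_nneseries//; last first.
  by move=> n; apply/measurable_EFinP; exact: measurable_indic.
by apply: eq_eseriesr => n _; rewrite integral_indic// setIT -prob_no_return.
Qed.

Hypothesis a_gt0 : 0 < a.
Hypothesis p_bnd : forall i, (0 < i)%N -> a <= p i <= 1 - a.

Lemma walk_recurrent : survival p r u r @[u --> \oo] --> 0 ->
  recurrent Q r X.
Proof.
move=> s0.
have E : pr Q (~` [set w | (return_time R X r w < +oo)%E]) = 0.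
  exact: (cvg_unique _ prob_never_return s0).
rewrite /recurrent; have mR := return_set_measurable.
by rewrite (prE _ mR); congr _%:E; move: E; rewrite prC//; lra.
Qed.

Lemma walk_transient (M : R) :
  (forall n, \sum_(0 <= k < n) gam p k <= M) -> transient Q r X.
Proof.
move=> /(survival_lower r a_gt0 p_bnd)[e e0 es].
have mR := return_set_measurable.
rewrite /transient (prE _ mR) lte_fin.
have : e <= pr Q (~` [set w | (return_time R X r w < +oo)%E]).
  rewrite -(cvg_lim _ prob_never_return)//; apply: limr_ge.
    exact: cvgP prob_never_return.
  by apply: nearW => u; exact: es.
rewrite prC//; lra.
Qed.

Lemma walk_ergodic (M : R) :
  (forall n, \sum_(0 <= k < n) (gam p k)^-1 <= M) -> ergodic Q r X.
Proof.
move=> igM; have g0 := gam_gt0 a_gt0 p_bnd.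
split.
  apply: walk_recurrent; apply: (@survival_cvg0 _ _ r _ a_gt0 p_bnd) => N.
  (* Each [(gam k)^-1] is at most [M], so [gam k] is at least [1 / M] and its sums diverge: summable
     inverses also give recurrence. *)
  have M0 : 0 < M by rewrite (lt_le_trans _ (igM 1%N))// big_nat1 invr_gt0.
  exists (Num.truncn (N * M)).+1.
  apply: (@le_trans _ _ (\sum_(0 <= k < (Num.truncn (N * M)).+1) M^-1)).
    rewrite big_const_nat subn0 iter_addr_0 -mulr_natr mulrC ler_pdivlMr//.
    by rewrite ltW// truncnS_gt.
  apply: ler_sum => k _; rewrite -[leRHS]invrK lef_pV2 ?posrE ?invr_gt0//.
  apply: le_trans (igM k.+1); rewrite big_nat_recr//= lerDr sumr_ge0// => j _.
  by rewrite invr_ge0 ltW.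
rewrite integral_return_time.
have [C HC] := sum_survival_bounded r a_gt0 p_bnd igM.
apply: (@le_lt_trans _ _ C%:E); last exact: ltry.
have s0 u : (0 <= (survival p r u r)%:E)%E.
  by rewrite lee_fin; exact: survival_ge0 a_gt0 p_bnd _ _.
apply: lime_le; first by apply: is_cvg_nneseries => u _ _; exact: s0.
by apply: nearW => n; rewrite sumEFin lee_fin.
Qed.

Lemma walk_null_recurrent :
  (forall M : R, exists n, M <= \sum_(0 <= k < n) gam p k) ->
  (forall M : R, exists n, M <= \sum_(0 <= k < n) (gam p k)^-1) ->
  null_recurrent Q r X.
Proof.
move=> goo igoo; split.
  by apply/walk_recurrent; exact: @survival_cvg0 _ _ r _ a_gt0 p_bnd goo.
rewrite integral_return_time.
apply: nneseries_real_pinfty => [u|]; first exact: survival_ge0 a_gt0 p_bnd _ _.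
exact: @sum_survival_unbounded _ _ r _ a_gt0 p_bnd goo igoo.
Qed.
End walk_return_time.

(** * Independent increments *)

Section real_expectation.
Context d (T : measurableType d) (R : realType) (P : probability T R).
Implicit Types f g : T -> R.

Definition Ex f : R := \int[P]_w f w.

(** A class of integrable functions closed under all operations applied below, including composition
    with the exponential. *)
Definition bmf f := measurable_fun setT f /\ exists C : R, forall w, `|f w| <= C.

Lemma bmf_integrable f : bmf f -> P.-integrable setT (EFin \o f).
Proof.
move=> [mf [C fC]]; apply: measurable_bounded_integrable => //.
  by rewrite -ge0_fin_numE// fin_num_measure.
exists C; split; rewrite ?num_real// => y Cy w _.
exact: le_trans (fC w) (ltW Cy).
Qed.

Lemma Ex_EFin f : bmf f -> (\int[P]_w (f w)%:E = (Ex f)%:E)%E.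
Proof. by move=> bf; rewrite fineK// integrable_fin_num//; exact: bmf_integrable. Qed.

Lemma bmf_cst c : bmf (cst c).
Proof. by split; [exact: measurable_cst|exists `|c|]. Qed.

Lemma bmfD f g : bmf f -> bmf g -> bmf (fun w => f w + g w).
Proof.
move=> [mf [C fC]] [mg [D gD]]; split; first exact: measurable_funD.
by exists (C + D) => w; rewrite (le_trans (ler_normD _ _))// lerD.
Qed.

Lemma bmfN f : bmf f -> bmf (fun w => - f w).
Proof.
move=> [mf [C fC]]; split; first exact: measurableT_comp.
by exists C => w; rewrite normrN.
Qed.

Lemma bmfB f g : bmf f -> bmf g -> bmf (fun w => f w - g w).
Proof. by move=> bf bg; apply: bmfD => //; exact: bmfN. Qed.

Lemma bmfM f g : bmf f -> bmf g -> bmf (fun w => f w * g w).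
Proof.
move=> [mf [C fC]] [mg [D gD]]; split; first exact: measurable_funM.
by exists (C * D) => w; rewrite normrM ler_pM.
Qed.

Lemma bmfX f n : bmf f -> bmf (fun w => f w ^+ n).
Proof.
move=> bf; elim: n => [|n IH]; first exact: bmf_cst.
by apply: (eq_ind _ bmf (bmfM bf IH)); apply/funext => w; rewrite exprS.
Qed.

Lemma bmf_indic A : measurable A -> bmf (\1_A).
Proof.
move=> mA; split; first exact: measurable_indic.
by exists 1 => w; rewrite indicE; case: (_ \in _); rewrite ?normr1 ?normr0.
Qed.

Lemma ExD f g : bmf f -> bmf g -> Ex (fun w => f w + g w) = Ex f + Ex g.
Proof. by move=> bf bg; rewrite /Ex RintegralD//; exact: bmf_integrable. Qed.

Lemma ExB f g : bmf f -> bmf g -> Ex (fun w => f w - g w) = Ex f - Ex g.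
Proof. by move=> bf bg; rewrite /Ex RintegralB//; exact: bmf_integrable. Qed.

Lemma ExZ c f : bmf f -> Ex (fun w => c * f w) = c * Ex f.
Proof. by move=> bf; rewrite /Ex RintegralZl//; exact: bmf_integrable. Qed.

Lemma Ex_cst c : Ex (cst c) = c.
Proof.
rewrite /Ex Rintegral_cst// (_ : fine _ = 1) ?mulr1//.
by have := probability_setT P => /= ->.
Qed.

Lemma Ex_le f g : bmf f -> bmf g -> (forall w, f w <= g w) -> Ex f <= Ex g.
Proof. by move=> bf bg fg; apply: le_Rintegral => //; exact: bmf_integrable. Qed.

Lemma Ex_ge0 f : (forall w, 0 <= f w) -> 0 <= Ex f.
Proof. by move=> f0; apply: Rintegral_ge0. Qed.

Lemma Ex_indic A : measurable A -> Ex (\1_A) = pr P A.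
Proof. by move=> mA; rewrite /Ex /Rintegral integral_indic// setIT. Qed.

Lemma pr_le_Ex f (b : R) : bmf f -> (forall w, 0 <= f w) -> 0 < b ->
  pr P [set w | b <= f w] <= Ex f / b.
Proof.
move=> bf f0 b0; have mA : measurable [set w | b <= f w].
  rewrite (_ : [set w | _] = f @^-1` `[b, +oo[).
    by rewrite -[X in measurable X]setTI; exact: bf.1.
  by apply/seteqP; split => w /=; rewrite in_itv/= andbT.
rewrite -Ex_indic// ler_pdivlMr// mulrC -ExZ; last exact: bmf_indic.
apply: Ex_le => //; first by apply: bmfM; [exact: bmf_cst|exact: bmf_indic].
move=> w; rewrite indicE; case: (boolP (w \in _)) => [/set_mem//|_].
  by rewrite mulr1.
by rewrite mulr0.
Qed.

End real_expectation.

(** * Independence of the next variable from the past *)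

Section independence.
Context d (T : measurableType d) (R : realType) (P : probability T R).
Context d' (T' : measurableType d') (Z : nat -> T -> T').
Hypothesis mZ : forall i, measurable_fun setT (Z i).
Hypothesis Z_indep : forall n (A : nat -> set T') B,
  (forall i, measurable (A i)) -> measurable B ->
  (P ((\bigcap_(i in `I_n) Z i @^-1` A i) `&` Z n @^-1` B) =
   P (\bigcap_(i in `I_n) Z i @^-1` A i) * P (Z n @^-1` B))%E.
Hypothesis Z_ident : forall n B, measurable B ->
  P (Z n @^-1` B) = P (Z 0%N @^-1` B).

Definition cyl n : set (set T) :=
  [set E | exists2 A : nat -> set T', (forall i, measurable (A i)) &
            E = \bigcap_(i in `I_n) Z i @^-1` A i].

(** A second measurable structure on the points of [T], carried by a type of its own, so that
    measurability with respect to the past is ordinary measurability on [past n]. The generating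
    cylinders are stable under intersection, as Dynkin's lemma requires. *)
Definition past n := g_sigma_algebraType (cyl n).

Lemma measurable_past n (E : set T) :
  measurable (E : set (past n)) -> measurable E.
Proof.
apply: smallest_sub; first exact: sigma_algebra_measurable.
move=> _ [A mA ->]; apply: bigcap_measurableType => i _.
by rewrite -[X in measurable X]setTI; exact: mZ.
Qed.

Lemma past_le m n (E : set T) : (m <= n)%N ->
  measurable (E : set (past m)) -> measurable (E : set (past n)).
Proof.
move=> mn; apply: sub_sigma_algebra2 => _ [A mA ->].
exists (fun i => if (i < m)%N then A i else setT).
  by move=> i; case: ifP.
apply/seteqP; split => w H i /= Hi; last first.
  by have := H i; rewrite /= Hi; apply; exact: leq_trans mn.
by case: ifP => // im; exact: (H i im).
Qed.

Lemma measurable_past_Z n i : (i < n)%N ->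
  measurable_fun (setT : set (past n)) (Z i : past n -> T').
Proof.
move=> ni _ B mB; rewrite setTI; apply: sub_sigma_algebra.
exists (fun j => if j == i then B else setT); first by move=> j; case: ifP.
apply/seteqP; split => w /=; last by move=> /(_ i ni) /=; rewrite eqxx.
by move=> H j jn; case: eqVneq => // ->.
Qed.

Lemma past_indep n (E : set T) B :
  measurable (E : set (past n)) -> measurable B ->
  P (E `&` Z n @^-1` B) = (P E * P (Z 0%N @^-1` B))%E.
Proof.
move=> mE mB; have mZB : measurable (Z n @^-1` B).
  by rewrite -[X in measurable X]setTI; exact: mZ.
rewrite -(Z_ident n mB); move: E mE.
apply: (@dynkin_induction _ (past n) (cyl n)) => //.
- move=> _ _ [A mA ->] [A' mA' ->]; exists (fun i => A i `&` A' i).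
    by move=> i; exact: measurableI.
  apply/seteqP; split => w; first by move=> [H H'] i Hi; split; [exact: H|exact: H'].
  by move=> H; split => i Hi; have [] := H i Hi.
- by rewrite setTI probability_setT mul1e.
- by move=> _ [A mA ->]; exact: Z_indep.
- move=> S /measurable_past mS HS.
  have mSC := measurableC mS.
  have mSZ := @measurableI _ T _ _ mS mZB.
  have mSCZ := @measurableI _ T _ _ mSC mZB.
  move: HS; rewrite (prE P mSZ) (prE P mSCZ) (prE P mZB) (prE P mS) (prE P mSC).
  rewrite -!EFinM => -[H]; congr _%:E.
  have := pr_split P mZB mS; rewrite setIC H setIC prC// => E.
  by lra.
- move=> F /(_ _)/measurable_past mF tF HF.
  rewrite setI_bigcupl measure_bigcup//; last 2 first.
  + by move=> i _; exact: (@measurableI _ T).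
  + exact: trivIset_setIr.
  rewrite measure_bigcup// (prE P mZB) muleC -nneseriesZl//.
  by apply: eq_eseriesr => i _; rewrite muleC -(prE P mZB); exact: HF.
Qed.

(* Fubini: the joint law of the past and of the next step is a product measure. *)
Lemma Ex_past n (W : T -> R) (h : T' -> R) :
  measurable_fun (setT : set (past n)) (W : past n -> R) ->
  (exists C : R, forall w, `|W w| <= C) ->
  measurable_fun setT h -> (exists C : R, forall z, `|h z| <= C) ->
  Ex P (fun w => W w * h (Z n w)) = Ex P W * Ex P (fun w => h (Z 0%N w)).
Proof.
move=> mW [C WC] mh [D hD].
(* The identity is a random element of the coarser space [past n]; paired with [Z n], it has a joint
   law that can be compared with a product measure. *)
have mid : @measurable_fun _ _ T (past n) setT id.
  by move=> _ B mB; rewrite setTI; apply: (@measurable_past n).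
have mpair : @measurable_fun _ _ T (past n * T')%type setT (fun w => (w, Z n w)).
  by apply: measurable_fun_pair; [exact: mid|exact: mZ].
pose X : {mfun T >-> past n} := mfun_Sub (mem_set mid).
pose Y : {mfun T >-> T'} := mfun_Sub (mem_set (mZ 0%N)).
pose V : {mfun T >-> (past n * T')%type} := mfun_Sub (mem_set mpair).
pose m1 := distribution P X; pose m2 := distribution P Y; pose m := distribution P V.
pose f (z : past n * T') := (W z.1 * h z.2)%:E.
have mf : measurable_fun setT f.
  apply/measurable_EFinP/measurable_funM.
    by apply: measurableT_comp.
  by apply: measurableT_comp.
have mE A : measurable A -> (m1 \x m2)%E A = m A.
  apply: product_measure_unique => E B mE mB.
  exact: past_indep mE mB.
have bWh : bmf (fun w => W w * h (Z n w)).
  apply: bmfM; first by split; [|exists C]; first exact: measurableT_comp mW mid.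
  by split; [exact: measurableT_comp|exists D].
have bW : bmf W by split; [exact: measurableT_comp mW mid|exists C].
have bh : bmf (fun w => h (Z 0%N w)) by split; [exact: measurableT_comp|exists D].
have intf : (m1 \x m2)%E.-integrable setT f.
  apply: measurable_bounded_integrable => //.
  - by have := mE setT measurableT => /= ->; rewrite -ge0_fin_numE// fin_num_measure.
  - exact/measurable_EFinP.
  - exists (C * D); split; rewrite ?num_real// => y Cy z _ /=.
    by rewrite (le_trans _ (ltW Cy))// normrM ler_pM.
have E1 : (\int[P]_w (W w * h (Z n w))%:E = \int[m1 \x m2]_z f z)%E.
  rewrite (eq_measure_integral m); last by move=> A mA _; exact: mE.
  rewrite integral_distribution//; exact: (bmf_integrable P bWh).
have E3 : (\int[m2]_z (h z)%:E = (Ex P (fun w => h (Z 0%N w)))%:E)%E.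
  rewrite -Ex_EFin// integral_distribution//; first exact/measurable_EFinP.
  exact: bmf_integrable bh.
have inth : m2.-integrable setT (EFin \o h).
  apply: measurable_bounded_integrable => //.
    by rewrite -ge0_fin_numE// fin_num_measure.
  by exists D; split; rewrite ?num_real// => y Dy z _; exact: le_trans (hD z) (ltW Dy).
have E2 : (\int[m1 \x m2]_z f z = \int[m1]_x (W x * Ex P (fun w => h (Z 0%N w)))%:E)%E.
  rewrite -integral12_prod_meas1//; apply: eq_integral => x _.
  rewrite /fubini_F /f /=; under eq_integral do rewrite EFinM.
  by rewrite integralZl// E3.
have bWc : bmf (fun w => W w * Ex P (fun w => h (Z 0%N w))).
  by apply: bmfM => //; exact: bmf_cst.
rewrite {1}/Ex /Rintegral E1 E2 integral_distribution//; last 2 first.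
- by apply/measurable_EFinP/measurable_funM => //; exact: measurable_cst.
- exact: bmf_integrable bWc.
rewrite [LHS](_ : _ = Ex P (fun w => W w * Ex P (fun w => h (Z 0%N w))))//.
rewrite mulrC -ExZ//; congr (Ex P _); by apply/funext => w; rewrite mulrC.
Qed.

End independence.

Section exponential_bounds.
Context (R : realType).
Implicit Types x b : R.

(** The difference of the two sides vanishes at 0, and on [-b, b] its derivative
    [1 + expR b * t - expR t] has the sign of [t]. *)
Lemma expR_le_quad b x : `|x| <= b -> expR x <= 1 + x + expR b / 2 * x ^+ 2.
Proof.
move=> xb; have b0 : 0 <= b := le_trans (normr_ge0 _) xb.
have eb : 1 <= expR b by rewrite -expR0 ler_expR.
pose f t := 1 + t + expR b / 2 * t ^+ 2 - expR t.
have df (t : R) : is_derive t (1 : R) f (1 + expR b * t - expR t).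
  by rewrite /f; apply: is_derive_eq; rewrite !scaler1 /GRing.scale/=; field.
have f' (t : R) : derive1 f t = 1 + expR b * t - expR t.
  by rewrite derive1E; exact: derive_val.
have fc (t u : R) : {within `[t, u], continuous f}.
  apply: derivable_within_continuous => v _; exact: ex_derive.
have f0 : f 0 = 0 by rewrite /f expR0; ring.
rewrite -subr_ge0 -/(f x) -f0.
have e1 (t : R) : 1 - t <= (expR t)^-1 by rewrite -expRN (le_trans _ (expR_ge1Dx _)).
move: xb; rewrite ler_norml => /andP[bx xb].
have [x0|x0] := leP 0 x.
  apply: (@ger0_derive1_ndecr _ f 0 x) => // t; rewrite in_itv/= => /andP[t0 tx].
  rewrite f'; have et : expR t <= expR b by rewrite ler_expR ltW// (lt_le_trans tx).
  have et0 := expR_gt0 t.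
  have : (1 - t) * expR t <= 1 by rewrite -ler_pdivlMr// mul1r.
  have : expR t * t <= expR b * t by rewrite ler_pM2r.
  by lra.
apply: (@ler0_derive1_nincr _ f x 0) => //; last exact: ltW.
move=> t; rewrite in_itv/= => /andP[tx t0]; rewrite f'.
have := expR_ge1Dx t; have : expR b * t <= 1 * t by rewrite ler_nM2r.
by lra.
Qed.

End exponential_bounds.

Section almost_sure.
Context d (T : measurableType d) (R : realType) (P : probability T R).

Lemma ae_small (Q : T -> Prop) (B : nat -> set T) (e : nat -> R) :
  (forall m, measurable (B m)) -> (forall m, pr P (B m) <= e m) ->
  (forall c, 0 < c -> exists m, e m < c) ->
  (forall m, ~` [set w | Q w] `<=` B m) -> {ae P, forall w, Q w}.
Proof.
move=> mB Be e0 QB; exists (\bigcap_m B m); split.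
- exact: bigcapT_measurable.
- have mI : measurable (\bigcap_m B m) by exact: bigcapT_measurable.
  rewrite prE//; congr _%:E; apply/eqP; rewrite eq_le pr_ge0 andbT leNgt.
  apply/negP => /e0[m]; rewrite ltNge => /negP; apply; apply: le_trans (Be m).
  by apply: le_pr => // w; apply.
- by move=> w Qw m _; exact: (QB m).
Qed.

Lemma borel_cantelli (B : nat -> set T) (C : R) :
  (forall m, measurable (B m)) -> (forall n, \sum_(0 <= m < n) pr P (B m) <= C) ->
  {ae P, forall w, exists m, forall k, (m <= k)%N -> ~ B k w}.
Proof.
move=> mB BC; exists (lim_sup_set B); split.
- by apply: bigcap_measurableType => n _; apply: bigcup_measurable => k _.
- apply: lim_sup_set_cvg0 => //; apply: (@le_lt_trans _ _ C%:E); last exact: ltry.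
  apply: lime_le; first by apply: is_cvg_nneseries.
  apply: nearW => n; rewrite (eq_bigr (fun m => (pr P (B m))%:E)) ?sumEFin ?lee_fin//.
  by move=> m _; exact: prE.
- move=> w /= H m _; apply: contrapT => Hm; apply: H; exists m => k mk Bk.
  by apply: Hm; exists k.
Qed.

End almost_sure.

(** * Exponential supermartingales and their maxima *)

Section maximal_inequality.
Context d (T : measurableType d) (R : realType) (P : probability T R).
Context d' (T' : measurableType d') (Z : nat -> T -> T').
Hypothesis mZ : forall i, measurable_fun setT (Z i).
Hypothesis Z_indep : forall n (A : nat -> set T') B,
  (forall i, measurable (A i)) -> measurable B ->
  (P ((\bigcap_(i in `I_n) Z i @^-1` A i) `&` Z n @^-1` B) =
   P (\bigcap_(i in `I_n) Z i @^-1` A i) * P (Z n @^-1` B))%E.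
Hypothesis Z_ident : forall n B, measurable B ->
  P (Z n @^-1` B) = P (Z 0%N @^-1` B).

Definition adapted n (W : T -> R) := @bmf _ (past Z n) R W.

Lemma adapted_bmf n W : adapted n W -> bmf W.
Proof.
move=> [mW WC]; split=> // _ A mA; rewrite setTI.
apply: (measurable_past mZ (n := n)); rewrite -[X in measurable X]setTI.
exact: mW.
Qed.

Lemma adapted_le m n W : (m <= n)%N -> adapted m W -> adapted n W.
Proof.
move=> mn [mW WC]; split=> // _ A mA; rewrite setTI.
apply: (past_le mn); rewrite -[X in measurable X]setTI.
exact: mW.
Qed.

Lemma adapted_Z n i (h : T' -> R) : bmf h -> (i < n)%N ->
  adapted n (fun w => h (Z i w)).
Proof.
move=> [mh [C hC]] ni; split; last by exists C => w; exact: hC.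
exact: (measurableT_comp mh (@measurable_past_Z _ _ _ _ Z _ _ ni)).
Qed.

Lemma adapted_sum n m k (h : nat -> T' -> R) :
  (forall i, bmf (h i)) -> (k <= n)%N ->
  adapted n (fun w => \sum_(m <= i < k) h i (Z i w)).
Proof.
move=> bh; elim: k => [|k IH] kn.
  rewrite (_ : (fun w => _) = cst 0); first exact: bmf_cst.
  by apply/funext => w; rewrite big_geq.
have [mk|km] := leqP m k; last first.
  rewrite (_ : (fun w => _) = cst 0); first exact: bmf_cst.
  by apply/funext => w; rewrite big_geq.
rewrite (_ : (fun w => _) = fun w => \sum_(m <= i < k) h i (Z i w) + h k (Z k w)).
  by apply: bmfD; [exact/IH/ltnW|exact: adapted_Z].
by apply/funext => w; rewrite big_nat_recr.
Qed.

Lemma Ex_adapted n W h : adapted n W -> bmf h ->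
  Ex P (fun w => W w * h (Z n w)) = Ex P W * Ex P (fun w => h (Z 0%N w)).
Proof. by move=> [? ?] [? ?]; exact: (Ex_past mZ Z_indep Z_ident). Qed.

Lemma bmf_expR d1 (T1 : measurableType d1) (f : T1 -> R) :
  bmf f -> bmf (fun z => expR (f z)).
Proof.
move=> [mf [C fC]]; split; first exact: measurableT_comp.
exists (expR C) => z; rewrite ger0_norm ?expR_ge0// ler_expR.
exact: le_trans (ler_norm _) (fC z).
Qed.

Variable y : nat -> T' -> R.
Hypothesis bmf_y : forall i, bmf (y i).
Hypothesis Ex_y : forall i, Ex P (fun w => expR (y i (Z 0%N w))) <= 1.

Let S k w := \sum_(0 <= i < k) y i (Z i w).

(* The exponential supermartingale of [S], stopped when [S] reaches [b]. *)
Let M (b : R) := fix M k w : R := if k is j.+1 then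
  if expR b <= M j w then M j w else M j w * expR (y j (Z j w)) else 1.

(** A frozen [M] keeps its value of at least [expR b]; otherwise it is the exponential of a sum that
    was below [b] at all earlier times. *)
Let M_S b k w : expR b <= M b k w \/
  M b k w = expR (S k w) /\ forall j, (j < k)%N -> S j w < b.
Proof.
elim: k => [|k IH]; first by right; rewrite /S big_geq//= expR0.
rewrite /=; case: ifPn => [|H]; first by left.
right; case: IH => [|[IH1 IH2]]; first by rewrite (negbTE H).
rewrite IH1 -expRD /S [in RHS]big_nat_recr//=; split => // j.
rewrite ltnS leq_eqVlt => /orP[/eqP ->|]; last exact: IH2.
by rewrite -ltr_expR ltNge -IH1.
Qed.

Let M_ge0 b k w : 0 <= M b k w.
Proof. by elim: k => //= k IH; case: ifP => // _; rewrite mulr_ge0// expR_ge0. Qed.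

Lemma measurable_ge d1 (T1 : measurableType d1) (f : T1 -> R) (b : R) :
  measurable_fun setT f -> measurable [set w | b <= f w].
Proof.
move=> mf; rewrite (_ : [set w | _] = f @^-1` `[b, +oo[).
  by rewrite -[X in measurable X]setTI; exact: mf.
by apply/seteqP; split => w /=; rewrite in_itv/= andbT.
Qed.

Let I b k := \1_([set w | expR b <= M b k w]) : T -> R.

Let MS b k w : M b k.+1 w =
  M b k w * I b k w + M b k w * (1 - I b k w) * expR (y k (Z k w)).
Proof.
rewrite /I indicE /=; case: ifPn => H.
  by rewrite mem_set//= subrr mulr1 mulr0 mul0r addr0.
by rewrite memNset/= ?subr0 ?mulr0 ?mulr1 ?add0r//; exact/negP.
Qed.

Let adapted_M b k : adapted k (M b k).
Proof.
elim: k => [|k IH]; first exact: bmf_cst.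
have aI : adapted k.+1 (I b k).
  by apply: (adapted_le (leqnSn k)); apply: bmf_indic; apply: measurable_ge; exact: IH.1.
have aM := adapted_le (leqnSn k) IH.
rewrite /adapted (_ : M b k.+1 = fun w => M b k w * I b k w +
    M b k w * (1 - I b k w) * expR (y k (Z k w))).
  apply: bmfD; first exact: bmfM.
  apply: bmfM; last by apply: bmf_expR; exact: adapted_Z.
  by apply: bmfM => //; apply: bmfB => //; exact: bmf_cst.
by apply/funext => w; exact: MS.
Qed.

Let Ex_M b k : Ex P (M b k) <= 1.
Proof.
elim: k => [|k IH]; first by rewrite (Ex_cst P 1).
have aI : adapted k (I b k).
  by apply: bmf_indic; apply: measurable_ge; exact: (adapted_M b k).1.
have aMI : adapted k (fun w => M b k w * I b k w) := bmfM (adapted_M b k) aI.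
have aMC : adapted k (fun w => M b k w * (1 - I b k w)).
  by apply: (bmfM (adapted_M b k)); apply: (bmfB _ aI); exact: bmf_cst.
apply: le_trans IH.
rewrite (_ : M b k.+1 = fun w => M b k w * I b k w +
    M b k w * (1 - I b k w) * expR (y k (Z k w))); last by apply/funext => w; exact: MS.
have aE : bmf (fun w => expR (y k (Z k w))).
  apply: bmf_expR; apply: (@adapted_bmf k.+1); exact: adapted_Z.
rewrite ExD; last 2 first.
- exact: adapted_bmf aMI.
- by apply: bmfM => //; exact: adapted_bmf aMC.
rewrite (Ex_adapted aMC (bmf_expR (bmf_y k))).
apply: (@le_trans _ _ (Ex P (fun w => M b k w * I b k w) +
   Ex P (fun w => M b k w * (1 - I b k w)))).
  rewrite lerD2l ler_piMr// Ex_ge0// => w; rewrite mulr_ge0//.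
  by rewrite /I indicE; case: (_ \in _); rewrite ?subrr ?subr0.
have bMI := adapted_bmf aMI; have bMC := adapted_bmf aMC.
rewrite -ExD//; apply: Ex_le => [||w]; first exact: bmfD.
  exact: adapted_bmf (adapted_M b k).
by rewrite -mulrDr addrC subrK mulr1.
Qed.

Lemma measurable_partial_sum_ge (b : R) k : measurable [set w | b <= S k w].
Proof.
by apply: measurable_ge; apply: (adapted_bmf (adapted_sum (n := k) _ _ _)).1.
Qed.

(** Markov's inequality for the stopped supermartingale, which at time [n] is at least [expR b]
    whenever a sum has reached [b] by then. The bound does not depend on [n] and passes to the
    increasing union. *)
Lemma ville (b : R) :
  measurable [set w | exists k, b <= S k w] /\
  pr P [set w | exists k, b <= S k w] <= expR (- b).
Proof.
pose B n := [set w | exists2 k, (k <= n)%N & b <= S k w].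
have mB n : measurable (B n).
  rewrite (_ : B n = \bigcup_(k in [set k | (k <= n)%N]) [set w | b <= S k w]).
    by apply: bigcup_measurable => k _; exact: measurable_partial_sum_ge.
  by apply/seteqP; split => w /= [k kn Sk]; exists k.
have BE : [set w | exists k, b <= S k w] = \bigcup_n B n.
  by apply/seteqP; split => w /= [k]; [move=> ?; exists k => //; exists k|move=> _ [j _ ?]; exists j].
have mU : measurable (\bigcup_n B n) by exact: bigcupT_measurable.
have PB n : pr P (B n) <= expR (- b).
  have aM := adapted_bmf (adapted_M b n).
  rewrite expRN -div1r; apply: le_trans (le_trans (pr_le_Ex P aM (M_ge0 b n) (expR_gt0 b)) _).
    apply: le_pr => //; first by apply: measurable_ge; exact: aM.1.
    move=> w [k kn bS] /=; have [//|[E H]] := M_S b n w.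
    move: kn; rewrite leq_eqVlt => /orP[/eqP kn|/H]; last by rewrite ltNge bS.
    by rewrite E ler_expR -kn.
  by rewrite ler_pM2r ?Ex_M// invr_gt0 expR_gt0.
rewrite BE; split => //; rewrite -lee_fin -prE//.
have cvgB : P \o B @ \oo --> P (\bigcup_n B n).
  apply: nondecreasing_cvg_mu => // i j ij; apply/subsetPset => w [k ki ?].
  by exists k => //; exact: leq_trans ij.
rewrite -(cvg_lim _ cvgB)//; apply: lime_le; first exact: cvgP cvgB.
by apply: nearW => n /=; rewrite prE// lee_fin.
Qed.

Lemma sum_ae_bounded :
  {ae P, forall w, exists C : R, forall k, \sum_(0 <= i < k) y i (Z i w) <= C}.
Proof.
pose e m : R := expR (- m%:R).
apply: (@ae_small _ _ _ _ _ (fun m => [set w | exists k, m%:R <= S k w]) e).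
- by move=> m; exact: (ville m%:R).1.
- by move=> m; exact: (ville m%:R).2.
- move=> c c0; have /cvgrPdist_lt/(_ _ c0)[m _ /(_ m (leqnn _))] := @cvgn_expR R.
  by rewrite sub0r normrN ger0_norm ?expR_ge0//; exists m.
- move=> m w /= H; apply: contrapT => Hm; apply: H; exists m%:R => k.
  by rewrite leNgt; apply/negP => /ltW H; apply: Hm; exists k.
Qed.

End maximal_inequality.

(** * The law of the iterated logarithm *)

Section asymptotics.
Context (R : realType).

Lemma near_ln (C : R) : \forall n \near \oo, C <= ln n%:R.
Proof.
near=> n; have n0 : expR C <= n%:R by near: n; exact: nbhs_infty_ger.
by rewrite -ler_expR lnK// posrE (lt_le_trans (expR_gt0 C)).
Unshelve. all: by end_near. Qed.

Lemma near_ln_gt0 : \forall n \near \oo, 0 < ln n%:R :> R.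
Proof. by apply: filterS (near_ln 1) => n; exact: lt_le_trans. Qed.

Lemma near_lnln (C : R) : \forall n \near \oo, C <= ln (ln n%:R).
Proof.
near=> n; have n0 : expR C <= ln n%:R by near: n; exact: near_ln.
by rewrite -ler_expR lnK// posrE (lt_le_trans (expR_gt0 C)).
Unshelve. all: by end_near. Qed.

Lemma ln_nat_ge0 n : 0 <= ln n%:R :> R.
Proof. by case: n => [|n]; [rewrite ln0|rewrite ln_ge0// ler1n]. Qed.

Lemma ln_succ_sub_ge n : (0 < n)%N -> n.+1%:R^-1 <= ln n.+1%:R - ln n%:R :> R.
Proof.
move=> n0; have n0' : 0 < n%:R :> R by rewrite ltr0n.
rewrite -lerN2 opprB -ln_div ?posrE//.
have := @le_ln1Dx R (- n.+1%:R^-1).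
rewrite (_ : 1 - _ = n%:R / n.+1%:R); last first.
  by rewrite -natr1; field; lra.
by apply; rewrite ltrN2 invf_lt1// ltr1n.
Qed.

(** The terms of the series of j^(-1-e) are dominated by the differences of j^(-e) / e, which
    telescope. *)
Lemma sum_expR_ln_le (e : R) n : 0 < e ->
  \sum_(0 <= j < n) expR (- ((1 + e) * ln j.+2%:R)) <= e^-1.
Proof.
move=> e0; pose f j : R := expR (- (e * ln j.+1%:R)).
have fS j : expR (- ((1 + e) * ln j.+2%:R)) <= e^-1 * (f j - f j.+1).
  have fE : f j = f j.+1 * expR (e * (ln j.+2%:R - ln j.+1%:R)).
    by rewrite /f -expRD; congr expR; ring.
  rewrite mulrDl mul1r opprD expRD expRN lnK ?posrE// -/(f j.+1) mulrC.
  rewrite fE -{3}[f j.+1]mulr1 -mulrBr mulrCA ler_pM2l ?expR_gt0//.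
  rewrite mulrC ler_pdivlMr//.
  apply: (@le_trans _ _ (e * (ln j.+2%:R - ln j.+1%:R))).
    by rewrite mulrC ler_pM2l// ln_succ_sub_ge.
  by rewrite lerBrDl expR_ge1Dx.
apply: (le_trans (ler_sum_nat (fun j _ => fS j))).
rewrite -mulr_sumr -[leRHS]mulr1 ler_pM2l ?invr_gt0//.
rewrite (eq_bigr (fun j => - (f j.+1 - f j))); last by move=> j _; rewrite opprB.
rewrite sumrN telescope_sumr// opprB /f ln1 mulr0 oppr0 expR0.
by rewrite gerBl expR_ge0.
Qed.

End asymptotics.

(** Here [A] stands for a^(2k), [L] for ln k and [l] for ln ln n. Compensator and level add up to at
    most 2 a L n / A; the surplus powers of [a] pay for the ratios n / A and L / l. *)
Lemma lil_arith (R : realType) (a sigma A n L l th S : R) :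
  1 < a -> 0 < sigma -> 0 < A -> th ^+ 2 * sigma ^+ 2 = 2 * L / A ->
  0 < th -> 0 < L -> 0 < n -> A <= n -> n <= a ^+ 2 * A -> L <= a ^+ 2 * l ->
  th * S - n * (a * L / A) < a * L -> S <= a ^+ 3 * sigma * Num.sqrt (2 * n * l).
Proof.
move=> a1 sigma0 A0 th2 th0 L0 n0 An nA Ll HS; have a0 : 0 < a by lra.
have l0 : 0 <= l by rewrite -(pmulr_rge0 _ (_ : 0 < a ^+ 2)) ?exprn_gt0// (le_trans (ltW L0)).
have r1 : 1 <= n / A by rewrite ler_pdivlMr// mul1r.
have r2 : n / A <= a ^+ 2 by rewrite ler_pdivrMr.
have n0' := ltW n0; have s0' := ltW sigma0.
have A0' := ltW A0; have a0' := ltW a0; have L0' := ltW L0.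
rewrite -(ler_pM2l th0); apply: (@le_trans _ _ (2 * a * L * (n / A))).
  have : a * L * 1 <= a * L * (n / A) by rewrite ler_pM2l// mulr_gt0.
  move: HS; rewrite (_ : n * (a * L / A) = a * L * (n / A)); last by ring.
  by lra.
have X0 : 0 <= a ^+ 3 * sigma * Num.sqrt (2 * n * l).
  by rewrite mulr_ge0// mulr_ge0 ?exprn_ge0// ltW.
rewrite -ler_sqr ?nnegrE ?mulr_ge0 ?invr_ge0 ?(ltW th0)//.
rewrite [leRHS](_ : _ = th ^+ 2 * sigma ^+ 2 * a ^+ 6 * Num.sqrt (2 * n * l) ^+ 2); last by ring.
rewrite th2 sqr_sqrtr ?mulr_ge0//.
rewrite [leLHS](_ : _ = 4 * a ^+ 2 * L * (n / A) * (L * (n / A))); last by ring.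
rewrite [leRHS](_ : _ = 4 * a ^+ 2 * L * (n / A) * (a ^+ 2 * l * a ^+ 2)); last by ring.
rewrite ler_pM2l ?mulr_gt0 ?exprn_gt0 ?invr_gt0//.
by rewrite ler_pM// (le_trans ler01).
Qed.

(** * Upper half of the law of the iterated logarithm *)

Section upper_lil.
Context d (T : measurableType d) (R : realType) (P : probability T R).
Context d' (T' : measurableType d') (Z : nat -> T -> T').
Hypothesis mZ : forall i, measurable_fun setT (Z i).
Hypothesis Z_indep : forall n (A : nat -> set T') B,
  (forall i, measurable (A i)) -> measurable B ->
  (P ((\bigcap_(i in `I_n) Z i @^-1` A i) `&` Z n @^-1` B) =
   P (\bigcap_(i in `I_n) Z i @^-1` A i) * P (Z n @^-1` B))%E.
Hypothesis Z_ident : forall n B, measurable B ->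
  P (Z n @^-1` B) = P (Z 0%N @^-1` B).

Lemma bmf_Z i (h : T' -> R) : bmf h -> bmf (fun w => h (Z i w)).
Proof.
by move=> bh; apply: (adapted_bmf mZ (n := i.+1)); exact: adapted_Z.
Qed.

Lemma Ex_expR_quad (u : T' -> R) (b : R) :
  bmf u -> (forall z, `|u z| <= b) -> Ex P (fun w => u (Z 0%N w)) = 0 ->
  Ex P (fun w => expR (u (Z 0%N w))) <=
    expR (expR b / 2 * Ex P (fun w => u (Z 0%N w) ^+ 2)).
Proof.
move=> bu ub u0; have bZ := bmf_Z 0 bu.
apply: le_trans (expR_ge1Dx _).
rewrite -[X in X + _](Ex_cst P 1) -ExZ; last exact: bmfX.
rewrite -[X in X + _]addr0 -u0 -ExD; [|exact: bmf_cst|exact: bZ].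
rewrite -ExD; last 2 first.
- by apply: bmfD => //; exact: bmf_cst.
- by apply: bmfM; [exact: bmf_cst|exact: bmfX].
apply: Ex_le => [||w]; first exact: bmf_expR.
- apply: bmfD; first by apply: bmfD => //; exact: bmf_cst.
  by apply: bmfM; [exact: bmf_cst|exact: bmfX].
- exact: (expR_le_quad (ub (Z 0%N w))).
Qed.

Variables (u : T' -> R) (sigma : R).
Hypothesis bmf_u : bmf u.
Hypothesis Ex_u : Ex P (fun w => u (Z 0%N w)) = 0.
Hypothesis Ex_u2 : Ex P (fun w => u (Z 0%N w) ^+ 2) = sigma ^+ 2.
Hypothesis sigma_gt0 : 0 < sigma.

(** For n near a^(2k) the exponent [th k] is the optimal one, and Ville's inequality controls all n
    at once at the price k^(-a), which is summable. The factor [a] in the compensator absorbs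
    [expR (th k * B)], the excess of the quadratic exponential bound over the Gaussian value. *)
Lemma upper_lil (e : R) : 0 < e ->
  {ae P, forall w, \forall n \near \oo, \sum_(0 <= i < n) u (Z i w) <=
     (1 + e) ^+ 3 * sigma * Num.sqrt (2 * n%:R * ln (ln n%:R))}.
Proof.
have natfact (m i j : nat) : (m + i + 1 <= j)%N ->
  [/\ (0 < j)%N, (m <= j - i)%N & (i <= j)%N].
  by move=> H; split; lia.
move=> e0; set a := 1 + e; have a1 : 1 < a by rewrite ltrDl.
have a0 : 0 < a by lra.
have [B [B0 uB]] : exists B, 0 <= B /\ forall z, `|u z| <= B.
  have [B uB] := bmf_u.2; exists `|B|; split => // z.
  exact: le_trans (uB z) (ler_norm _).
pose th k := Num.sqrt (2 * ln k%:R) / (sigma * a ^+ k).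
have th_ge0 k : 0 <= th k by rewrite divr_ge0// mulr_ge0 ?ltW// exprn_gt0.
have th2 k : th k ^+ 2 * sigma ^+ 2 = 2 * ln k%:R / a ^+ (2 * k).
  rewrite /th exprMn sqr_sqrtr ?mulr_ge0 ?ln_nat_ge0// exprVn exprMn -exprM mulnC.
  by field; rewrite !lt0r_neq0 ?exprn_gt0.
have th_small : \forall k \near \oo, expR (th k * B) <= a.
  have la : 0 < ln a by exact: ln_gt0.
  pose c := ln a / (B + 1); have c0 : 0 < c by rewrite divr_gt0// ltr_wpDl.
  have cB : c * (B + 1) = ln a by rewrite divfK// gt_eqF// ltr_wpDl.
  clearbody c.
  near=> k.
  (* Bernoulli's inequality, a^k >= k e, is growth enough against the square root of ln k; this
     threshold makes [th k] at most [c]. *)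
  have k0 : 2 / (c * sigma * e) ^+ 2 <= k%:R by near: k; exact: nbhs_infty_ger.
  have ce0 : 0 < (c * sigma * e) ^+ 2 by rewrite exprn_gt0// (mulr_gt0 (mulr_gt0 c0 sigma_gt0) e0).
  have kgt0 : 0 < k%:R :> R by rewrite (lt_le_trans _ k0)// divr_gt0.
  have ak : k%:R * e <= a ^+ k.
    have {k0 kgt0} : 1 + k%:R * e <= a ^+ k; last by lra.
    elim: (k) => [|j IH]; first by rewrite mul0r addr0.
    rewrite exprS -natr1; apply: (@le_trans _ _ (a * (1 + j%:R * e))).
      rewrite -subr_ge0 (_ : _ - _ = j%:R * e * e); last by rewrite /a; ring.
      by rewrite !mulr_ge0 ?(ltW e0).
    by rewrite ler_pM2l.
  have thc : th k <= c.
    rewrite -ler_sqr ?nnegrE ?(ltW c0)// -(ler_pM2r (_ : 0 < sigma ^+ 2)) ?exprn_gt0//.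
    rewrite th2 ler_pdivrMr ?exprn_gt0//.
    apply: (@le_trans _ _ (2 * k%:R)); first by rewrite ler_pM2l// ltW// ln_sublinear.
    move: k0; rewrite ler_pdivrMr// => k0.
    apply: (@le_trans _ _ (k%:R * (c * sigma * e) ^+ 2 * k%:R)); first by rewrite ler_pM2r.
    rewrite (_ : _ * k%:R = c ^+ 2 * sigma ^+ 2 * (k%:R * e) ^+ 2); last by ring.
    rewrite mulnC exprM ler_wpM2l ?mulr_ge0 ?exprn_ge0 ?(ltW c0) ?(ltW sigma_gt0)//.
    by rewrite ler_sqr// nnegrE ?mulr_ge0 ?exprn_ge0 ?(ltW e0) ?(ltW a0).
  rewrite -[leRHS]lnK ?posrE// ler_expR.
  apply: (@le_trans _ _ (c * (B + 1))); last by rewrite cB.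
  by rewrite ler_pM// lerDl.
have [k0 _ Hk0] : \forall k \near \oo, (2 <= k)%N /\ expR (th k * B) <= a.
  by near=> k; split; near: k => //; exact: nbhs_infty_ge.
pose y k z := th k * u z - a * ln k%:R / a ^+ (2 * k).
have bmf_y k : bmf (y k).
  by apply: bmfB; [apply: bmfM => //; exact: bmf_cst|exact: bmf_cst].
have Ex_y k : (k0 <= k)%N -> Ex P (fun w => expR (y k (Z 0%N w))) <= 1.
  move=> /Hk0[k2 kB]; have bZ := bmf_Z 0 bmf_u.
  pose v z := th k * u z.
  have bv : bmf v by apply: bmfM => //; exact: bmf_cst.
  have vB z : `|v z| <= th k * B by rewrite normrM ger0_norm// ler_wpM2l.
  have Ev : Ex P (fun w => v (Z 0%N w)) = 0 by rewrite ExZ// Ex_u mulr0.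
  have := Ex_expR_quad bv vB Ev.
  have -> : Ex P (fun w => v (Z 0%N w) ^+ 2) = 2 * ln k%:R / a ^+ (2 * k).
    rewrite -th2 -Ex_u2 -ExZ; last exact: bmfX.
    by congr (Ex P _); apply/funext => w; rewrite /v exprMn.
  rewrite (_ : (fun w => expR (y k (Z 0%N w))) =
    fun w => expR (- (a * ln k%:R / a ^+ (2 * k))) * expR (v (Z 0%N w))); last first.
    by apply/funext => w; rewrite -expRD addrC.
  rewrite ExZ; last by apply: bmf_expR; exact: (bmf_Z 0 bv).
  move=> H; apply: (le_trans (ler_wpM2l (expR_ge0 _) H)).
  rewrite -expRD -[leRHS]expR0 ler_expR addrC subr_le0.
  rewrite [leLHS](_ : _ = expR (th k * B) * (ln k%:R / a ^+ (2 * k))); last first.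
    by field; rewrite lt0r_neq0// exprn_gt0.
  by rewrite -[leRHS]mulrA ler_wpM2r// divr_ge0 ?ln_nat_ge0// exprn_ge0 ?ltW.
pose E j := [set w | exists n, a * ln (j + k0)%:R <= \sum_(0 <= i < n) y (j + k0)%N (Z i w)].
have VE j := ville mZ Z_indep Z_ident (fun _ => bmf_y (j + k0)%N)
  (fun _ => Ex_y (j + k0)%N (leq_addl _ _)) (a * ln (j + k0)%:R).
have sumE n : \sum_(0 <= j < n) pr P (E j) <= e^-1.
  apply: le_trans (sum_expR_ln_le n e0).
  apply: ler_sum => j _; apply: (le_trans (VE j).2).
  have [k2 _] := Hk0 _ (leqnn k0).
  by rewrite ler_expR lerN2 ler_pM2l// ler_ln ?posrE ?ltr0n ?ler_nat//; lia.
apply: filterS (borel_cantelli (fun j => (VE j).1) sumE) => w [m Hm].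
have la : 0 < ln a by exact: ln_gt0.
near=> n.
have n0 : 0 < n%:R :> R by near: n; exact: nbhs_infty_gtr.
have ln0 : 0 <= ln n%:R / (2 * ln a) by rewrite divr_ge0 ?ln_nat_ge0// mulr_ge0// ltW.
(* The index of the block of [n]: a^(2k) <= n <= a^(2k+2). *)
pose k := Num.truncn (ln n%:R / (2 * ln a)).
have kn : k%:R <= ln n%:R / (2 * ln a) by rewrite truncn_le.
have nk : ln n%:R / (2 * ln a) < k.+1%:R by exact: truncnS_gt.
have mk : (m + k0 + 1 <= k)%N.
  rewrite truncn_ge_nat// ler_pdivlMr ?mulr_gt0//; near: n; exact: near_ln.
have Ak0 : 0 < a ^+ (2 * k) by exact: exprn_gt0.
have An : a ^+ (2 * k) <= n%:R.
  move: kn; rewrite ler_pdivlMr ?mulr_gt0// => kn.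
  rewrite -ler_ln ?posrE// lnXn// -[ln a *+ _]mulr_natl natrM.
  by rewrite [2 * _]mulrC -mulrA.
have nA : n%:R <= a ^+ 2 * a ^+ (2 * k).
  move: nk; rewrite ltr_pdivrMr ?mulr_gt0// => nk.
  rewrite -exprD -ler_ln ?posrE ?exprn_gt0// lnXn// -[ln a *+ _]mulr_natl.
  rewrite natrD natrM; apply: (le_trans (ltW nk)); rewrite -natr1.
  by rewrite le_eqVlt; apply/orP; left; apply/eqP; ring.
have [kpos km k0k] := natfact _ _ _ mk.
have lk : ln k%:R <= a ^+ 2 * ln (ln n%:R).
  have la2 : 0 < 2 * ln a by exact: mulr_gt0.
  have ell : - ln (2 * ln a) / (a ^+ 2 - 1) <= ln (ln n%:R) by near: n; exact: near_lnln.
  have k1 : 0 < k%:R :> R by rewrite ltr0n.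
  apply: (@le_trans _ _ (ln (ln n%:R) - ln (2 * ln a))).
    have lnn0 : 0 < ln n%:R :> R by near: n; exact: (@near_ln_gt0 R).
    by rewrite -ln_div ?posrE// ler_ln ?posrE// divr_gt0.
  move: ell; rewrite ler_pdivrMr; last by rewrite subr_gt0 exprn_egt1.
  by rewrite mulrBr mulr1 [_ * a ^+ 2]mulrC lerBrDr addrC.
have {Hm km} : \sum_(0 <= i < n) y k (Z i w) < a * ln k%:R.
  rewrite ltNge; apply/negP => H; apply: (Hm _ km); exists n.
  by rewrite subnK.
have [k2 _] := Hk0 _ k0k.
rewrite sumrB -mulr_sumr big_const_nat subn0 iter_addr_0 -[_ / _ *+ n]mulr_natl.
have lk0 : 0 < ln k%:R :> R by rewrite ln_gt0// ltr1n.
have thk0 : 0 < th k by rewrite divr_gt0 ?sqrtr_gt0 ?mulr_gt0 ?exprn_gt0.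
exact: (lil_arith a1 sigma_gt0 Ak0 (th2 k) thk0 lk0 n0 An nA lk).
Unshelve. all: by end_near. Qed.

End upper_lil.

(** * Smooth steps with third order expansions *)

Section third_order_expansion.
Context (R : realType).
Implicit Types (g a b : R -> R) (K : R).

Definition locally_bounded_mf g :=
  measurable_fun setT g /\ forall C : R, exists D : R, forall x, `|x| <= C -> `|g x| <= D.

(** The functions [a] and [b] stand for g' and g''/2. Asking only for a uniform cubic remainder
    admits piecewise cubics whose third derivative jumps. *)
Definition taylor3 K g := locally_bounded_mf g /\
  exists a b, [/\ locally_bounded_mf a, locally_bounded_mf b &
    forall x h, `|g (x + h) - g x - a x * h - b x * h ^+ 2| <= K * `|h| ^+ 3].

Lemma lbmf_bmf d (T : measurableType d) g (X : T -> R) :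
  locally_bounded_mf g -> bmf X -> bmf (fun w => g (X w)).
Proof.
move=> [mg gD] [mX [C XC]]; split; first exact: measurableT_comp.
by have [D HD] := gD C; exists D => w; exact: HD.
Qed.

Lemma lbmfD g1 g2 : locally_bounded_mf g1 -> locally_bounded_mf g2 ->
  locally_bounded_mf (fun x => g1 x + g2 x).
Proof.
move=> [m1 b1] [m2 b2]; split; first exact: measurable_funD.
move=> C; have [D1 H1] := b1 C; have [D2 H2] := b2 C; exists (D1 + D2) => x xC.
by rewrite (le_trans (ler_normD _ _))// lerD ?H1 ?H2.
Qed.

Lemma lbmf_affine g (al be ga : R) : locally_bounded_mf g ->
  locally_bounded_mf (fun x => al * g (be * x + ga)).
Proof.
move=> [m b]; split.
  apply: measurable_funM; first exact: measurable_cst.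
  apply: measurableT_comp => //; apply: measurable_funD => //.
move=> C; have [D H] := b (`|be| * C + `|ga|); exists (`|al| * D) => x xC.
rewrite normrM ler_wpM2l// H// (le_trans (ler_normD _ _))// lerD2r normrM.
by rewrite ler_wpM2l.
Qed.

Lemma taylor3_affine K g (al be ga : R) : taylor3 K g ->
  taylor3 (`|al| * `|be| ^+ 3 * K) (fun x => al * g (be * x + ga)).
Proof.
move=> [lg [a [b [la lb H]]]]; split; first exact: lbmf_affine.
exists (fun x => (al * be) * a (be * x + ga)), (fun x => (al * be ^+ 2) * b (be * x + ga)).
split; try exact: lbmf_affine.
move=> x h; have := H (be * x + ga) (be * h).
rewrite (_ : be * x + ga + be * h = be * (x + h) + ga); last by ring.
set X := (X in `|X|) => HX.
rewrite (_ : _ - _ = al * X); last by rewrite /X; ring.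
rewrite normrM -!mulrA ler_wpM2l//; apply: (le_trans HX).
by rewrite le_eqVlt normrM; apply/orP; left; apply/eqP; ring.
Qed.

Lemma taylor3D K1 K2 g1 g2 : taylor3 K1 g1 -> taylor3 K2 g2 ->
  taylor3 (K1 + K2) (fun x => g1 x + g2 x).
Proof.
move=> [l1 [a1 [b1 [la1 lb1 H1]]]] [l2 [a2 [b2 [la2 lb2 H2]]]].
split; first exact: lbmfD.
exists (fun x => a1 x + a2 x), (fun x => b1 x + b2 x); split; try exact: lbmfD.
move=> x h; rewrite [leRHS]mulrDl; apply: le_trans (lerD (H1 x h) (H2 x h)).
apply: le_trans (ler_normD _ _); rewrite le_eqVlt; apply/orP; left; apply/eqP.
by congr `|_|; ring.
Qed.

Definition ppart (x : R) : R := Num.max x 0.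

Lemma lbmf_ppartX n : locally_bounded_mf (fun x => ppart x ^+ n).
Proof.
split.
  apply: measurable_funX; apply: measurable_maxr => //; exact: measurable_cst.
move=> C; exists (`|C| ^+ n) => x xC; rewrite normrX lerXn2r ?nnegrE// /ppart.
have [x0|x0] := leP x 0; first by rewrite normr0.
by apply: (le_trans xC); exact: ler_norm.
Qed.

(** The remainder is h^3 between positive points and 0 between negative ones; across 0 the cubes
    involved have arguments between 0 and |h|. *)
Lemma taylor3_ppart : taylor3 1 (fun x => ppart x ^+ 3).
Proof.
split; first exact: lbmf_ppartX.
exists (fun x => 3 * ppart (1 * x + 0) ^+ 2), (fun x => 3 * ppart (1 * x + 0) ^+ 1).
split.
- exact: (lbmf_affine 3 1 0 (lbmf_ppartX 2)).
- exact: (lbmf_affine 3 1 0 (lbmf_ppartX 1)).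
move=> x h; rewrite mul1r addr0 mul1r expr1 /ppart.
have h3 : `|h| ^+ 3 = `|h ^+ 3| by rewrite normrX.
have [x0|x0] := leP x 0; have [xh|xh] := leP (x + h) 0.
- by rewrite !expr0n/= !mulr0 !mul0r !subr0 normr0 exprn_ge0.
- rewrite !expr0n/= !mulr0 !mul0r !subr0 ger0_norm ?exprn_ge0 ?(ltW xh)//.
  have h0 : x + h <= `|h| by rewrite (le_trans _ (ler_norm h))//; lra.
  by rewrite lerXn2r// nnegrE// ltW.
- rewrite -normrN expr0n/= (_ : - _ = (- h) ^+ 3 - (- (x + h)) ^+ 3); last by ring.
  have hh : - h <= `|h| by rewrite -normrN ler_norm.
  have xh0 : 0 <= - (x + h) by lra.
  have xhh : - (x + h) <= - h by lra.
  rewrite ger0_norm ?subr_ge0; last by rewrite lerXn2r ?nnegrE// (le_trans xh0).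
  rewrite (@le_trans _ _ ((- h) ^+ 3))//; first by rewrite gerBl exprn_ge0.
  by rewrite lerXn2r ?nnegrE// (le_trans xh0).
- by rewrite h3 le_eqVlt; apply/orP; left; apply/eqP; congr `|_|; ring.
Qed.

(* The distribution function of the sum of three uniform variables on [0, 1]: a step
   smooth enough for third order expansions. *)
Definition smoothstep (v : R) : R := (ppart v ^+ 3 - 3 * ppart (v - 1) ^+ 3
  + 3 * ppart (v - 2) ^+ 3 - ppart (v - 3) ^+ 3) / 6.

(** The constant is the sum of the absolute values of the coefficients, (1 + 3 + 3 + 1) / 6. *)
Lemma taylor3_smoothstep : taylor3 (4 / 3) smoothstep.
Proof.
have t := taylor3_ppart.
have := taylor3D (taylor3D (taylor3_affine (1 / 6) 1 0 t) (taylor3_affine (- (1 / 2)) 1 (- 1) t))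
   (taylor3D (taylor3_affine (1 / 2) 1 (- 2) t) (taylor3_affine (- (1 / 6)) 1 (- 3) t)).
rewrite (_ : (fun x => _) = smoothstep); last first.
  by apply/funext => v; rewrite /smoothstep !mul1r addr0; field.
rewrite !normrN !ger0_norm; [|lra..].
by rewrite !expr1n !mulr1 (_ : _ + _ = 4 / 3)//; field.
Qed.

Lemma ppart_neg (x : R) : x <= 0 -> ppart x = 0.
Proof. by move=> x0; rewrite /ppart max_r. Qed.

Lemma ppart_pos (x : R) : 0 <= x -> ppart x = x.
Proof. by move=> x0; rewrite /ppart max_l. Qed.

Lemma smoothstep_bounds (v : R) :
  [/\ v <= 0 -> smoothstep v = 0, 0 <= smoothstep v <= 1 &
      1 <= v -> 1 / 6 <= smoothstep v].
Proof.
have z3 : 0 ^+ 3 = 0 :> R by rewrite expr0n.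
have s0 : v <= 0 -> smoothstep v = 0.
  move=> v0; rewrite /smoothstep !ppart_neg ?z3; [by field|lra..].
suff H : (v <= 0) || (0 <= smoothstep v <= 1) && ((1 <= v) ==> (1 / 6 <= smoothstep v)).
  split=> //.
    by case/orP: H => [/s0 ->|/andP[]//]; rewrite lexx ler01.
  by move=> v1; case/orP: H => [v0|/andP[_ /implyP]]; [lra|exact].
have [//|v0 /=] := leP v 0; rewrite /smoothstep (ppart_pos (ltW v0)).
have [v1|v1] := leP v 1.
  rewrite !(ppart_neg (_ : _ - _ <= 0)) ?z3; [|lra..].
  have v2 : 0 <= v ^+ 3 <= 1 by rewrite exprn_ge0 ?exprn_ile1 ?(ltW v0).
  apply/andP; split; first lra.
  apply/implyP => v1'; have -> : v = 1 by lra.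
  by rewrite expr1n; lra.
set t := v - 1; have t0 : 0 < t by rewrite /t; lra.
rewrite (ppart_pos (ltW t0)) (_ : v = 1 + t); last by rewrite /t; ring.
rewrite (_ : 1 + t - 2 = t - 1) 1?(_ : 1 + t - 3 = t - 2); [|by ring..].
have [t1|t1] := leP t 1.
  rewrite !(ppart_neg (_ : t - _ <= 0)) ?z3; [|lra..].
  have c1 : t ^+ 2 <= t by rewrite expr2 ger_pMl.
  have c2 : 0 <= t ^+ 3 <= t ^+ 2.
    by rewrite exprn_ge0 ?(ltW t0)//= exprS ger_pMl ?exprn_gt0.
  have c3 : 0 <= 1 - 3 * t ^+ 2 + 2 * t ^+ 3.
    rewrite (_ : _ + _ = (1 - t) ^+ 2 * (1 + 2 * t)); last by ring.
    by rewrite mulr_ge0 ?sqr_ge0//; lra.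
  rewrite (_ : (_ - _) / 6 = (1 + 3 * t + 3 * t ^+ 2 - 2 * t ^+ 3) / 6); last by field.
  by apply/andP; split; [|apply/implyP => _]; lra.
set s := t - 1; have s0' : 0 < s by rewrite /s; lra.
rewrite (ppart_pos (ltW s0')) (_ : t = 1 + s); last by rewrite /s; ring.
rewrite (_ : 1 + s - 2 = s - 1); last by ring.
have [s1|s1] := leP s 1.
  rewrite (ppart_neg (_ : s - 1 <= 0)) ?z3; last by lra.
  have c1 : 0 <= (1 - s) ^+ 3 <= 1 by rewrite exprn_ge0 ?exprn_ile1 ?subr_ge0 ?gerBl ?(ltW s0').
  rewrite (_ : (_ - _) / 6 = 1 - (1 - s) ^+ 3 / 6); last by field.
  by apply/andP; split; [|apply/implyP => _]; lra.
rewrite (ppart_pos (_ : 0 <= s - 1)); last by lra.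
rewrite (_ : (_ - _) / 6 = 1); last by field.
by apply/andP; split; [|apply/implyP => _]; lra.
Qed.

End third_order_expansion.

(** * Symmetric Bernoulli sums *)

Section rademacher_average.
Context (R : realType) (sigma : R).
Implicit Types g : R -> R.

(** The transition operator of a step +sigma or -sigma with equal odds. The form [1 * x + sigma] is
    the one that [taylor3_affine] produces. *)
Definition avg g x := 1 / 2 * g (1 * x + sigma) + 1 / 2 * g (1 * x + - sigma).

Lemma taylor3_avg (K : R) g : taylor3 K g -> taylor3 K (avg g).
Proof.
move=> t; have := taylor3D (taylor3_affine (1 / 2) 1 sigma t) (taylor3_affine (1 / 2) 1 (- sigma) t).
rewrite normr1 expr1n mulr1 ger0_norm; last by lra.
rewrite -mulrDl (_ : 1 / 2 + 1 / 2 = 1 :> R); last by lra.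
by rewrite [1 * K]mul1r.
Qed.

Lemma pascal_sum (G : nat -> R) n :
  \sum_(0 <= j < n.+2) 'C(n.+1, j)%:R * G j =
  \sum_(0 <= j < n.+1) 'C(n, j)%:R * G j.+1 + \sum_(0 <= j < n.+1) 'C(n, j)%:R * G j.
Proof.
rewrite big_nat_recl//= bin0 (eq_bigr (fun j => 'C(n, j)%:R * G j.+1 + 'C(n, j.+1)%:R * G j.+1)).
  rewrite big_split/= addrCA; congr (_ + _).
  rewrite [in RHS]big_nat_recl//= bin0; congr (_ + _).
  by rewrite big_nat_recr//= bin_small// mul0r addr0.
by move=> j _; rewrite binS natrD mulrDl addrC.
Qed.

Lemma iter_avgE n g x : iter n avg g x =
  \sum_(0 <= j < n.+1) 'C(n, j)%:R * ((1 / 2) ^+ n * g (x + sigma * (j%:R *+ 2 - n%:R))).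
Proof.
elim: n x => [|n IH] x.
  by rewrite big_nat1 bin0 !mul1r /= mul0rn subr0 mulr0 addr0.
rewrite iterS {1}/avg !IH pascal_sum !mulr_sumr -!big_split/=.
apply: eq_bigr => j _; rewrite exprS -[n.+1%:R]natr1 -[j.+1%:R]natr1 ![_ *+ 2]mulr2n.
set c := _ ^+ n.
rewrite (_ : 1 * x + sigma + _ = x + sigma * (j%:R + 1 + (j%:R + 1) - (n%:R + 1))); last by ring.
rewrite (_ : 1 * x + - sigma + _ = x + sigma * (j%:R + j%:R - (n%:R + 1))); last by ring.
by ring.
Qed.

End rademacher_average.

(** * Lower bounds for binomial probabilities *)

Section binomial_lower_bound.
Context (R : realType).

Let b M j : R := 'C(2 * M, M + j)%:R / 4 ^+ M.

Lemma expR_le_1B (z : R) : 0 <= z <= 1 / 2 -> expR (- (z + 2 * z ^+ 2)) <= 1 - z.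
Proof.
move=> /andP[z0 z1]; have z2 : 0 <= z ^+ 2 by exact: sqr_ge0.
rewrite expRN -[leRHS]invrK lef_pV2 ?posrE ?expR_gt0 ?invr_gt0//; last by lra.
apply: le_trans (expR_ge1Dx _); rewrite invf_ple ?posrE; [|lra..].
rewrite -[leLHS]mul1r ler_pdivrMr; last by lra.
have : 0 <= z ^+ 2 * (1 - 2 * z) by rewrite mulr_ge0//; lra.
rewrite (_ : (1 - z) * _ = 1 + z ^+ 2 * (1 - 2 * z)); last by ring.
lra.
Qed.

(** Equality holds at [M] = 1, and passing from M to M + 1 multiplies the square by
    ((2M+1)/(2M+2))^2, which exceeds M/(M+1). *)
Lemma central_bin M : (0 < M)%N -> (b M 0) ^+ 2 >= (4 * M%:R)^-1.
Proof.
case: M => // M _; elim: M => [|M IH].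
  by rewrite /b addn0 muln1 expr1 bin1 mulr1 (_ : (2%:R / 4) ^+ 2 = 4^-1)//; field.
have E : b M.+2 0 = b M.+1 0 * ((2 * M%:R + 3) / (2 * M%:R + 4)).
  have e1 : (M.+2 * 'C((2 * M.+1).+2, M.+2) = (2 * M.+1).+2 * 'C((2 * M.+1).+1, M.+1))%N.
    by rewrite -mul_bin_diag.
  have e2 : ((2 * M.+1).+1 * 'C(2 * M.+1, M.+1) = M.+2 * 'C((2 * M.+1).+1, M.+1))%N.
    by rewrite mul_bin_down; congr (_ * _)%N; lia.
  have f1 : M.+2%:R * 'C((2 * M.+1).+2, M.+2)%:R = (2 * M.+1).+2%:R * 'C((2 * M.+1).+1, M.+1)%:R :> R.
    by rewrite -!natrM e1.
  have f2 : (2 * M.+1).+1%:R * 'C(2 * M.+1, M.+1)%:R = M.+2%:R * 'C((2 * M.+1).+1, M.+1)%:R :> R.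
    by rewrite -!natrM e2.
  rewrite /b !addn0 (_ : (2 * M.+2 = (2 * M.+1).+2)%N); last by lia.
  have n1 : M.+2%:R = M%:R + 2 :> R by rewrite -natrD addn2.
  have n2 : (2 * M.+1).+2%:R = 2 * M%:R + 4 :> R.
    by rewrite -natrM -natrD; congr _%:R; lia.
  have n3 : (2 * M.+1).+1%:R = 2 * M%:R + 3 :> R.
    by rewrite -natrM -natrD; congr _%:R; lia.
  have M0 : 0 <= M%:R :> R by [].
  move: f1 f2; rewrite n1 n2 n3.
  set c1 := 'C(_.+2, _)%:R; set c2 := 'C(_.+1, _)%:R; set c3 := 'C(_, _)%:R => f1 f2.
  have c2E : c2 = (2 * M%:R + 3) * c3 / (M%:R + 2) by rewrite f2; field; lra.
  have c1E : c1 = (2 * M%:R + 4) * c2 / (M%:R + 2) by rewrite -f1; field; lra.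
  have x0 : 4 ^+ M.+1 != 0 :> R by rewrite expf_neq0.
  rewrite c1E c2E exprS; move: x0; set x := _ ^+ M.+1 => x0.
  by field; rewrite x0/=; lra.
have M0 : 0 <= M%:R :> R by [].
have n1 : M.+2%:R = M%:R + 2 :> R by rewrite -natrD addn2.
rewrite E exprMn; apply: le_trans (ler_wpM2r (sqr_ge0 _) IH).
rewrite n1 -natr1 -subr_ge0.
rewrite (_ : _ - _ = (16 * (M%:R + 1) * (M%:R + 2) ^+ 2)^-1).
  by rewrite invr_ge0 !mulr_ge0 ?exprn_ge0 ?addr_ge0.
by field; lra.
Qed.

Lemma bin_ratio M j : (j < M)%N ->
  b M j.+1 = b M j * ((M%:R - j%:R) / (M%:R + j%:R + 1)).
Proof.
move=> jM.
have e : ((M + j).+1 * 'C(2 * M, (M + j).+1) = (M - j) * 'C(2 * M, M + j))%N.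
  by rewrite mul_bin_left; congr (_ * _)%N; lia.
have f : (M + j).+1%:R * 'C(2 * M, (M + j).+1)%:R = (M - j)%:R * 'C(2 * M, M + j)%:R :> R.
  by rewrite -!natrM e.
clear e.
rewrite /b addnS; move: f; set c1 := 'C(_, _.+1)%:R; set c2 := 'C(_, _)%:R.
rewrite -natr1 natrD natrB ?(ltnW jM)// => f; clearbody c1 c2.
have : 0 <= M%:R :> R by []. have : 0 <= j%:R :> R by [].
move=> j0 M0; have -> : c1 = (M%:R - j%:R) * c2 / (M%:R + j%:R + 1) by rewrite -f; field; lra.
by field; rewrite expf_neq0//=; lra.
Qed.

(** Each ratio of neighbours is at least 1 - z with z = (2j+1)/M, hence at least exp(-z - 2z^2)
    because z <= 1/2. The numbers 2i+1 for i < j add up to j^2, and 8 j^3 dominates the sum of the 2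
    (2i+1)^2. *)
Lemma bin_lower M j : (0 < M)%N -> (4 * j <= M)%N ->
  b M 0 * expR (- (j%:R ^+ 2 / M%:R + 8 * j%:R ^+ 3 / M%:R ^+ 2)) <= b M j.
Proof.
move=> M0; elim: j => [|j IH] jM.
  by rewrite !expr0n/= mulr0 !mul0r addr0 oppr0 expR0 mulr1.
have jM' : (4 * j <= M)%N by lia.
have jltM : (j < M)%N by lia.
have M0' : 0 < M%:R :> R by rewrite ltr0n.
have j0 : 0 <= j%:R :> R by [].
have jMR : 4 * (j%:R + 1) <= M%:R :> R by rewrite natr1 -(natrM R 4) ler_nat.
rewrite bin_ratio//; pose z : R := (2 * j%:R + 1) / M%:R.
have z01 : 0 <= z <= 1 / 2.
  by rewrite divr_ge0 ?addr_ge0 ?mulr_ge0//= ler_pdivrMr//; lra.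
have b0 : 0 <= b M 0 by rewrite divr_ge0// exprn_ge0.
have zr : expR (- (z + 2 * z ^+ 2)) <= (M%:R - j%:R) / (M%:R + j%:R + 1).
  apply: (le_trans (expR_le_1B z01)).
  rewrite (_ : _ / _ = 1 - (2 * j%:R + 1) / (M%:R + j%:R + 1)); last by field; lra.
  rewrite lerD2l lerN2 ler_pM2l; last by lra.
  by rewrite lef_pV2 ?posrE//; lra.
have bj0 : 0 <= b M j by rewrite divr_ge0// exprn_ge0.
apply: le_trans (ler_pM _ (expR_ge0 _) (IH jM') zr); last by rewrite mulr_ge0// expR_ge0.
rewrite -[leRHS]mulrA -expRD ler_wpM2l// ler_expR -opprD lerN2 -natr1.
rewrite -subr_ge0 (_ : _ - _ = (16 * j%:R ^+ 2 + 16 * j%:R + 6) / M%:R ^+ 2).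
  by rewrite divr_ge0 ?exprn_ge0// !addr_ge0// mulr_ge0// exprn_ge0.
by rewrite /z; field; lra.
Qed.

End binomial_lower_bound.

(** * Bernoulli sums above a high level *)

Section gaussian_window.
Context (R : realType).

Lemma window_arith (r X i : R) : 1 <= X -> 500 * X ^+ 3 <= r -> 0 <= i ->
  i <= r * (X + X^-1) / 2 + r / X + 2 ->
  [/\ 4 * i <= r ^+ 2 / 2, 2 * i ^+ 2 / r ^+ 2 <= X ^+ 2 / 2 + 12 &
      32 * i ^+ 3 / r ^+ 4 <= 1].
Proof.
move=> X1 rX i0 ir; have X0 : 0 < X by lra.
have X3 : X <= X ^+ 3 by rewrite exprS ler_peMr ?(ltW X0)// exprn_ege1.
have r0 : 0 < r by lra.
set v := X^-1 in ir *; have v0 : 0 < v by rewrite invr_gt0.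
have vX : v * X = 1 by rewrite mulVf// gt_eqF.
have v1 : v <= 1 by rewrite invf_le1.
have rv : 4 <= r * v by rewrite -/v ler_pdivlMr//; lra.
pose c := X / 2 + 2 * v.
have c0 : 0 < c by rewrite addr_gt0 ?mulr_gt0 ?divr_gt0.
have ic : i <= r * c.
  rewrite /c mulrDr; move: ir; rewrite -/v mulrDr => ir.
  rewrite (_ : r * (2 * v) = 2 * (r * v)); last by ring.
  rewrite mulrA; lra.
have c1 : c <= 5 / 2 * X by rewrite /c; lra.
have c2 : c ^+ 2 <= X ^+ 2 / 4 + 6.
  rewrite (_ : c ^+ 2 = X ^+ 2 / 4 + 2 * (v * X) + 4 * v ^+ 2); last by rewrite /c; field.
  by rewrite vX; have : v ^+ 2 <= 1 by [rewrite exprn_ile1// ltW]; lra.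
have rc0 : 0 <= r * c by rewrite mulr_ge0 ?ltW.
have i2 : i ^+ 2 <= (r * c) ^+ 2 by rewrite ler_sqr ?nnegrE.
have i3 : i ^+ 3 <= (r * c) ^+ 3 by rewrite lerXn2r ?nnegrE.
have c3 : c ^+ 3 <= (5 / 2 * X) ^+ 3 by rewrite lerXn2r ?nnegrE ?(ltW c0)// (le_trans (ltW c0)).
split.
- have rc : r * c <= r * (5 / 2 * X) by rewrite ler_pM2l.
  have : r * (20 * X) <= r * r by rewrite ler_pM2l//; lra.
  by rewrite expr2; lra.
- rewrite ler_pdivrMr ?exprn_gt0//; apply: (@le_trans _ _ (2 * (r * c) ^+ 2)); first lra.
  rewrite exprMn mulrCA mulrC ler_pM2r ?exprn_gt0//; lra.
- rewrite ler_pdivrMr ?exprn_gt0// mul1r; apply: (@le_trans _ _ (32 * (r * c) ^+ 3)); first lra.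
  rewrite [r ^+ 4]exprSr exprMn mulrCA ler_pM2l ?exprn_gt0//.
  apply: le_trans rX; rewrite (_ : 500 * _ = 32 * (5 / 2 * X) ^+ 3); last by field.
  by rewrite ler_pM2l.
Qed.

Variable sigma : R.
Hypothesis sigma_gt0 : 0 < sigma.

(** The step starts [X] standard deviations up, at [sigma * r * X], and rises on the scale
    [sigma * r / X], over which a Gaussian density near that level falls only by a constant
    factor. *)
Definition window M X x := let r := Num.sqrt (2 * M%:R) in
  smoothstep ((x - sigma * r * X) / (sigma * r / X)) : R.

(** Only about r / X binomial terms are kept, on which the window is at least 1/6. The binomial
    probability of each is at least 1 / (2 r) times the exponential, whence the factor 1 / (12
    X). *)
Lemma iter_avg_window_ge M X : 1 <= X -> 500 * X ^+ 3 <= Num.sqrt (2 * M%:R) ->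
  (12 * X)^-1 * expR (- (X ^+ 2 / 2 + 13)) <= iter (2 * M) (avg sigma) (window M X) 0.
Proof.
set r := Num.sqrt _ => X1 rX; have X0 : 0 < X by lra.
have X3 : 0 < X ^+ 3 by exact: exprn_gt0.
have r0 : 0 < r by lra.
have r2 : r ^+ 2 = 2 * M%:R by rewrite sqr_sqrtr ?mulr_ge0.
have M0 : (0 < M)%N.
  have : 0 < r ^+ 2 by rewrite exprn_gt0.
  by rewrite r2 pmulr_rgt0 ?ltr0n.
have MR : 0 < M%:R :> R by rewrite ltr0n.
have f0 x : 0 <= window M X x.
  by rewrite /window; have [_ /andP[]] := smoothstep_bounds ((x - sigma * r * X) / (sigma * r / X)).
(* At index [M + i] the sum is sigma * 2i, and the argument of the smooth step reaches 1 at i = r (X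
   + 1/X) / 2. *)
pose J0 := (Num.truncn (r * (X + X^-1) / 2)).+1.
pose J := (Num.truncn (r / X)).+1.
have J0_gt : r * (X + X^-1) / 2 <= J0%:R by rewrite ltW// truncnS_gt.
have J_gt : r / X <= J%:R by rewrite ltW// truncnS_gt.
have vX0 : 0 < X^-1 by rewrite invr_gt0.
have rX0 : 0 <= r * (X + X^-1) / 2 by rewrite divr_ge0// mulr_ge0 ?addr_ge0 ?ltW.
have rX1 : 0 <= r / X by rewrite divr_ge0 ?ltW.
have J_lt : (J0 + J)%:R <= r * (X + X^-1) / 2 + r / X + 2 :> R.
  have : (Num.truncn (r * (X + X^-1) / 2))%:R <= r * (X + X^-1) / 2 by rewrite truncn_le.
  have : (Num.truncn (r / X))%:R <= r / X by rewrite truncn_le.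
  by rewrite natrD -!natr1; lra.
clearbody J0 J.
have wa i : (i <= J0 + J)%N -> [/\ (4 * i <= M)%N &
    i%:R ^+ 2 / M%:R + 8 * i%:R ^+ 3 / M%:R ^+ 2 <= X ^+ 2 / 2 + 13].
  move=> iJ; have iR : i%:R <= r * (X + X^-1) / 2 + r / X + 2.
    by rewrite (le_trans _ J_lt)// ler_nat.
  have [h1 h2 h3] := window_arith X1 rX (ler0n _ i) iR.
  split; first by rewrite -(ler_nat R) natrM; move: h1; rewrite r2; lra.
  have -> : M%:R = r ^+ 2 / 2 by rewrite r2; lra.
  rewrite (_ : _ + _ = 2 * i%:R ^+ 2 / r ^+ 2 + 32 * i%:R ^+ 3 / r ^+ 4); first lra.
  by field; rewrite gt_eqF.
have JM : (J0 + J <= M)%N by have [+ _] := wa _ (leqnn _); clear; lia.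
rewrite iter_avgE.
rewrite (@big_cat_nat _ _ _ (M + J0))//=; try by clear -JM; lia.
rewrite (@big_cat_nat _ _ _ (M + (J0 + J)) (M + J0))//=; try by clear -JM; lia.
have t0 j : 0 <= 'C(2 * M, j)%:R * ((1 / 2) ^+ (2 * M) *
    window M X (0 + sigma * (j%:R *+ 2 - (2 * M)%:R))).
  by rewrite mulr_ge0// mulr_ge0// exprn_ge0//; lra.
rewrite [leRHS]addrCA ler_wpDr ?addr_ge0 ?sumr_ge0//.
pose e := expR (- (X ^+ 2 / 2 + 13)).
have b0 : (2 * r)^-1 <= 'C(2 * M, M + 0)%:R / 4 ^+ M.
  rewrite -ler_sqr ?nnegrE ?invr_ge0 ?mulr_ge0 ?(ltW r0) ?divr_ge0 ?exprn_ge0//.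
  apply: le_trans (central_bin R M0).
  rewrite exprVn lef_pV2 ?posrE ?exprn_gt0 ?mulr_gt0//.
  by rewrite exprMn r2; lra.
apply: (@le_trans _ _ (\sum_(M + J0 <= j < M + (J0 + J)) ((2 * r)^-1 * e / 6))).
  rewrite big_const_nat iter_addr_0 (_ : M + (J0 + J) - (M + J0) = J)%N; last by clear; lia.
  rewrite -[_ *+ J]mulr_natr -/e; have e0 : 0 < e := expR_gt0 _.
  apply: (@le_trans _ _ ((2 * r)^-1 * e / 6 * (r / X))).
    by rewrite le_eqVlt; apply/orP; left; apply/eqP; field; rewrite !gt_eqF.
  by rewrite ler_wpM2l// !mulr_ge0 ?invr_ge0 ?mulr_ge0 ?(ltW e0) ?(ltW r0).
apply: ler_sum_nat => j /andP[j1 j2]; pose i := (j - M)%N.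
have ji : j = (M + i)%N by rewrite /i; clear -j1; lia.
have iJ0 : (J0 <= i)%N by rewrite /i; clear -j1; lia.
have iJ : (i <= J0 + J)%N by rewrite /i; clear -j1 j2; lia.
have [i4 ie] := wa i iJ.
rewrite ji add0r natrD natrM mulrnDl (_ : _ + _ - _ = i%:R *+ 2); last by rewrite mulr2n; ring.
have w6 : 1 / 6 <= window M X (sigma * (i%:R *+ 2)).
  rewrite /window -/r; have [_ _] := smoothstep_bounds
    ((sigma * (i%:R *+ 2) - sigma * r * X) / (sigma * r / X)); apply.
  rewrite ler_pdivlMr ?divr_gt0 ?mulr_gt0// mul1r lerBrDr.
  have : r * (X + X^-1) / 2 <= i%:R by rewrite (le_trans J0_gt)// ler_nat.
  move=> H; rewrite (_ : _ + _ = sigma * (2 * (r * (X + X^-1) / 2))); last first.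
    by field; rewrite gt_eqF.
  by rewrite ler_pM2l// -[i%:R *+ 2]mulr_natl ler_pM2l.
apply: (@le_trans _ _ ('C(2 * M, M + i)%:R / 4 ^+ M / 6)).
  rewrite ler_pM2r ?invr_gt0//; apply: le_trans (bin_lower R M0 i4).
  by rewrite ler_pM ?invr_ge0 ?mulr_ge0 ?(ltW r0) ?expR_ge0// ler_expR lerN2.
rewrite exprM (_ : (1 / 2) ^+ 2 = 4^-1); last by field.
rewrite exprVn -mulrA ler_wpM2l// ler_wpM2l ?invr_ge0 ?exprn_ge0//.
by move: w6; rewrite mul1r.
Qed.

Lemma taylor3_window M X : 1 <= X -> (0 < M)%N ->
  taylor3 (4 / 3 * (X / (sigma * Num.sqrt (2 * M%:R))) ^+ 3) (window M X).
Proof.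
move=> X1 M0; have X0 : 0 < X by lra.
set r := Num.sqrt _; have r0 : 0 < r by rewrite sqrtr_gt0 mulr_gt0 ?ltr0n.
have := taylor3_affine 1 (X / (sigma * r)) (- (X * X)) (taylor3_smoothstep R).
rewrite normr1 mul1r ger0_norm; last by rewrite divr_ge0 ?mulr_ge0 ?ltW.
rewrite mulrC (_ : (fun x => _) = window M X)//.
apply/funext => x; rewrite /window mul1r -/r; congr smoothstep.
by field; rewrite !gt_eqF.
Qed.

End gaussian_window.

Lemma ler_of_subr (R : realType) (x y x' y' : R) :
  x <= y -> y' - x' = y - x -> x' <= y'.
Proof. by rewrite -[x <= y]subr_ge0 -[x' <= y']subr_ge0 => ? ->. Qed.

(** The total replacement error, r^2 steps times the cubic constant of the window, is of order X^3 /
    r. The assumed size of [r] makes it at most half of the bound in [iter_avg_window_ge]; 32 is 24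
    times 4/3. *)
Lemma lindeberg_error_arith (R : realType) (X sigma b r : R) :
  1 <= X -> 0 < sigma -> 0 <= b ->
  (500 + 32 * expR 13 * (b / sigma ^+ 3)) * X ^+ 4 * expR (X ^+ 2 / 2) <= r ->
  [/\ 500 * X ^+ 3 <= r, 0 < r &
    r ^+ 2 * (4 / 3 * (X / (sigma * r)) ^+ 3 * b) <=
      (24 * X)^-1 * expR (- (X ^+ 2 / 2 + 13))].
Proof.
move=> X1 s0 b0 H; have X0 : 0 < X by lra.
have X3 : 1 <= X ^+ 3 by exact: exprn_ege1.
have X4 : X ^+ 3 <= X ^+ 4 by rewrite (exprS X 3) ler_peMl// ltW// exprn_gt0.
set E := expR (X ^+ 2 / 2) in H; have E1 : 1 <= E.
  by rewrite -expR0 ler_expR divr_ge0 ?exprn_ge0 ?(ltW X0).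
set F := expR 13 in H; have F0 : 0 < F by exact: expR_gt0.
set c := b / sigma ^+ 3 in H; have c0 : 0 <= c by rewrite divr_ge0 ?exprn_ge0 ?(ltW s0).
have X4E : X ^+ 4 <= X ^+ 4 * E by rewrite ler_peMr// ltW// exprn_gt0.
have cX : 0 <= 32 * F * c * (X ^+ 4 * E).
  have F0' := ltW F0; have E0' : 0 <= E by exact: expR_ge0.
  have X0' : 0 <= X ^+ 4 by rewrite exprn_ge0// ltW.
  exact: mulr_ge0 (mulr_ge0 (mulr_ge0 (ler0n R 32) F0') c0) (mulr_ge0 X0' E0').
have H1 : 500 * (X ^+ 4 * E) + 32 * F * c * (X ^+ 4 * E) <= r.
  by apply: le_trans H; rewrite le_eqVlt; apply/orP; left; apply/eqP; ring.
have r0 : 0 < r by lra.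
split => //; first by lra.
rewrite (_ : r ^+ 2 * _ = 4 / 3 * c * X ^+ 3 / r); last first.
  by rewrite /c; field; rewrite !gt_eqF.
have E0 : 0 < E by lra.
rewrite expRN expRD -/E -/F -invfM ler_pdivrMr// [leRHS]mulrC ler_pdivlMr; last first.
  by rewrite !mulr_gt0.
apply: le_trans (_ : 32 * F * c * (X ^+ 4 * E) <= r); last by lra.
by rewrite le_eqVlt; apply/orP; left; apply/eqP; field.
Qed.

(** * Lindeberg's replacement method, conditionally on the past *)

Section lindeberg.
Context d (T : measurableType d) (R : realType) (P : probability T R).
Context d' (T' : measurableType d') (Z : nat -> T -> T').
Hypothesis mZ : forall i, measurable_fun setT (Z i).
Hypothesis Z_indep : forall n (A : nat -> set T') B,
  (forall i, measurable (A i)) -> measurable B ->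
  (P ((\bigcap_(i in `I_n) Z i @^-1` A i) `&` Z n @^-1` B) =
   P (\bigcap_(i in `I_n) Z i @^-1` A i) * P (Z n @^-1` B))%E.
Hypothesis Z_ident : forall n B, measurable B ->
  P (Z n @^-1` B) = P (Z 0%N @^-1` B).
Variables (u : T' -> R) (sigma : R).
Hypothesis bmf_u : bmf u.
Hypothesis Ex_u : Ex P (fun w => u (Z 0%N w)) = 0.
Hypothesis Ex_u2 : Ex P (fun w => u (Z 0%N w) ^+ 2) = sigma ^+ 2.
Hypothesis sigma_gt0 : 0 < sigma.

Let beta := Ex P (fun w => `|u (Z 0%N w)| ^+ 3) + sigma ^+ 3.

Lemma bmf_norm d1 (T1 : measurableType d1) (f : T1 -> R) :
  bmf f -> bmf (fun z => `|f z|).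
Proof.
move=> [mf [C fC]]; split; first exact: measurableT_comp.
by exists C => z; rewrite normr_id.
Qed.

(** The increment and a random sign times sigma share mean and variance, so the expansions agree to
    second order and only the two cubic remainders, collected in [beta], survive. The weight [W]
    makes the estimate conditional on the past. *)
Lemma lindeberg_step t W g (K : R) S :
  adapted Z t W -> (forall w, 0 <= W w) -> adapted Z t S -> taylor3 K g ->
  Ex P (fun w => W w * avg sigma g (S w)) - K * beta * Ex P W <=
  Ex P (fun w => W w * g (S w + u (Z t w))).
Proof.
move=> aW W0 aS tg; have [lavg _] := taylor3_avg sigma tg.
move: tg => [lg [a [b [la lb H]]]].
have bZ : bmf (fun w => u (Z t w)) := bmf_Z mZ t bmf_u.
have K0 : 0 <= K.
  by have := le_trans (normr_ge0 _) (H 0 1); rewrite normr1 expr1n mulr1.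
have aWa : adapted Z t (fun w => W w * a (S w)) := bmfM aW (lbmf_bmf la aS).
have aWb : adapted Z t (fun w => W w * b (S w)) := bmfM aW (lbmf_bmf lb aS).
have aWg : adapted Z t (fun w => W w * g (S w)) := bmfM aW (lbmf_bmf lg aS).
have bW := adapted_bmf mZ aW; have bS := adapted_bmf mZ aS.
have bWg := adapted_bmf mZ aWg; have bWb := adapted_bmf mZ aWb.
have bWa := adapted_bmf mZ aWa.
have bu2 : bmf (fun z => u z ^+ 2) by exact: bmfX.
have bu3 : bmf (fun z => `|u z| ^+ 3) by apply: bmfX; exact: bmf_norm.
have bZ2 : bmf (fun w => u (Z t w) ^+ 2) := bmf_Z mZ t bu2.
have bZ3 : bmf (fun w => `|u (Z t w)| ^+ 3) := bmf_Z mZ t bu3.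
have E1 := Ex_adapted mZ Z_indep Z_ident aWa bmf_u.
have E2 := Ex_adapted mZ Z_indep Z_ident aWb bu2.
have E3 := Ex_adapted mZ Z_indep Z_ident aW bu3.
have bf1 := bmfM bWa bZ; have bf2 := bmfM bWb bZ2; have bf3 := bmfM bW bZ3.
have bf4 : bmf (fun w => K * (W w * `|u (Z t w)| ^+ 3)) by apply: bmfM => //; exact: bmf_cst.
have bf5 : bmf (fun w => sigma ^+ 2 * (W w * b (S w))) by apply: bmfM => //; exact: bmf_cst.
have bf6 : bmf (fun w => K * sigma ^+ 3 * W w) by apply: bmfM => //; exact: bmf_cst.
have lower : Ex P (fun w => W w * g (S w)) + sigma ^+ 2 * Ex P (fun w => W w * b (S w)) -
    K * (Ex P W * Ex P (fun w => `|u (Z 0%N w)| ^+ 3)) <=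
    Ex P (fun w => W w * g (S w + u (Z t w))).
  rewrite -E3 -[X in _ + X - _]mulrC -Ex_u2 -E2 -ExZ// -[X in X + _ - _]addr0.
  rewrite -[X in _ + X + _ - _](mulr0 (Ex P (fun w => W w * a (S w)))) -Ex_u -E1.
  rewrite -ExD// -ExD//; last exact: bmfD.
  rewrite -ExB//; last by apply: bmfD => //; exact: bmfD.
  apply: Ex_le => [||w].
  - by apply: bmfB => //; apply: bmfD => //; exact: bmfD.
  - by apply: bmfM => //; apply: lbmf_bmf lg _; exact: bmfD.
  have := H (S w) (u (Z t w)); rewrite ler_norml => /andP[+ _].
  by move=> /(ler_wpM2l (W0 w))/ler_of_subr; apply; ring.
have upper : Ex P (fun w => W w * avg sigma g (S w)) <=
    Ex P (fun w => W w * g (S w)) + sigma ^+ 2 * Ex P (fun w => W w * b (S w)) +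
    K * sigma ^+ 3 * Ex P W.
  rewrite -!ExZ// -ExD// -ExD//; last exact: bmfD.
  apply: Ex_le => [||w].
  - by apply: bmfM => //; exact: lbmf_bmf lavg _.
  - by apply: bmfD => //; exact: bmfD.
  have := H (S w) sigma; rewrite ler_norml => /andP[_ h1].
  have := H (S w) (- sigma); rewrite ler_norml => /andP[_ h2].
  have := ler_wpM2l (W0 w) (lerD h1 h2).
  rewrite normrN gtr0_norm// /avg ![1 * S w]mul1r => h3.
  have h4 : 0 <= 1 / 2 :> R by lra.
  by apply: (ler_of_subr (ler_wpM2l h4 h3)); field.
rewrite /beta; move: lower upper; set x := Ex P W.
by move=> l1 l2; rewrite mulrDr mulrDl; lra.
Qed.

(** The last increment is replaced first. Averaging keeps [taylor3 K] with the same constant, so the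
    errors add up linearly. *)
Lemma lindeberg_le t W N g (K : R) :
  adapted Z t W -> (forall w, 0 <= W w) -> taylor3 K g ->
  (iter N (avg sigma) g 0 - N%:R * (K * beta)) * Ex P W <=
  Ex P (fun w => W w * g (\sum_(t <= i < t + N) u (Z i w))).
Proof.
move=> aW W0; elim: N g => [|N IH] g tg.
  rewrite mul0r subr0 /= addn0.
  rewrite (_ : (fun w => _) = fun w => g 0 * W w).
    by rewrite ExZ//; exact: adapted_bmf aW.
  by apply/funext => w; rewrite big_geq// mulrC.
have := IH _ (taylor3_avg sigma tg).
have aW' : adapted Z (t + N) W := adapted_le (leq_addr _ _) aW.
have aS : adapted Z (t + N) (fun w => \sum_(t <= i < t + N) u (Z i w)).
  exact: (adapted_sum _ t (fun=> bmf_u)).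
have := lindeberg_step aW' W0 aS tg.
rewrite (_ : (fun w => W w * g (_ + u _)) =
   fun w => W w * g (\sum_(t <= i < t + N.+1) u (Z i w))); last first.
  by apply/funext => w; rewrite addnS big_nat_recr//= leq_addr.
rewrite iterSr -natr1; set A := Ex P _; set B := Ex P _; set C := Ex P W.
by rewrite !mulrBl !mulrDl mul1r; lra.
Qed.

Let Cbeta := 32 * expR 13 * (beta / sigma ^+ 3).

(** The window lies below the indicator of the level, and the replacement error takes at most half
    of the Bernoulli estimate. *)
Lemma increment_lower_bound t W (M : nat) (X : R) :
  adapted Z t W -> (forall w, 0 <= W w) -> 1 <= X ->
  (500 + Cbeta) * X ^+ 4 * expR (X ^+ 2 / 2) <= Num.sqrt (2 * M%:R) ->
  (24 * X)^-1 * expR (- (X ^+ 2 / 2 + 13)) * Ex P W <=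
  Ex P (fun w => W w * \1_([set w | sigma * Num.sqrt (2 * M%:R) * X <=
     \sum_(t <= i < t + 2 * M) u (Z i w)]) w).
Proof.
set r := Num.sqrt _ => aW W0 X1 rX.
have beta0 : 0 <= beta.
  rewrite addr_ge0 ?exprn_ge0 ?(ltW sigma_gt0)//.
  by apply: Ex_ge0 => w; exact: exprn_ge0.
have [rX3 r0 err] := lindeberg_error_arith X1 sigma_gt0 beta0 rX.
have r2 : r ^+ 2 = 2 * M%:R by rewrite sqr_sqrtr ?mulr_ge0.
have M0 : (0 < M)%N.
  have : 0 < r ^+ 2 by rewrite exprn_gt0.
  by rewrite r2 pmulr_rgt0 ?ltr0n.
have tw := taylor3_window sigma_gt0 X1 M0.
have := lindeberg_le (2 * M) aW W0 tw; rewrite -/r natrM -r2.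
move=> H; apply: (@le_trans _ _ (Ex P (fun w => W w * window sigma M X
    (\sum_(t <= i < t + 2 * M) u (Z i w))))).
  apply: le_trans H; rewrite ler_wpM2r ?Ex_ge0//.
  have := iter_avg_window_ge sigma_gt0 X1 rX3 => H0.
  apply: le_trans (lerB H0 err); set e := expR _.
  by rewrite le_eqVlt; apply/orP; left; apply/eqP; field; lra.
have bW := adapted_bmf mZ aW.
have bS : bmf (fun w => \sum_(t <= i < t + 2 * M) u (Z i w)).
  apply: (adapted_bmf mZ (n := (t + 2 * M)%N)).
  exact: (adapted_sum _ t (fun=> bmf_u)).
apply: Ex_le => [||w].
- by apply: bmfM => //; exact: lbmf_bmf tw.1 bS.
- by apply: bmfM => //; apply: bmf_indic; apply: measurable_ge; exact: bS.1.
rewrite ler_wpM2l// /window -/r; set x := \sum_(_ <= i < _) _.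
have [s0 /andP[_ s1] _] := smoothstep_bounds ((x - sigma * r * X) / (sigma * r / X)).
rewrite indicE; case: (boolP (w \in _)) => [//|/negP wS].
rewrite s0// pmulr_lle0; last by rewrite invr_gt0 divr_gt0 ?mulr_gt0//; lra.
by rewrite subr_le0 leNgt; apply/negP => /ltW H'; apply: wS; rewrite inE.
Qed.

End lindeberg.

Lemma block_arith1 (R : realType) (K s q l4 n : R) : 1 <= K -> 1 <= s -> s <= q ->
  1 <= l4 -> l4 <= 4 -> n = K * s * l4 -> 1 <= n /\ n <= 4 * (K * q).
Proof.
move=> K1 s1 sq l1 l4' ->; have Ks : 1 <= K * s by rewrite mulr_ege1.
have KsKq : K * s <= K * q by rewrite ler_pM2l//; lra.
by split; [rewrite mulr_ege1|nra].
Qed.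

(** * Lengths of the blocks *)

Section block_scale.
Context (R : realType).
Implicit Types x C : R.

Lemma expR_ge_pow C x p : 0 <= x -> C * p.+1`!%:R <= x -> C * x ^+ p <= expR x.
Proof.
move=> x0 Cx; apply: le_trans (expR_ge1Dxn p x0).
have f0 : 0 < p.+1`!%:R :> R by rewrite ltr0n fact_gt0.
by rewrite ler_wpDl// ler_pdivlMr// mulrAC exprS ler_wpM2r// exprn_ge0.
Qed.

Lemma near_ln_pow C p : \forall n \near \oo, C * ln n%:R ^+ p <= Num.sqrt n%:R.
Proof.
near=> n; have n0 : 0 < n%:R :> R by near: n; exact: nbhs_infty_gtr.
have h : 2 * (`|C| * 2 ^+ p * p.+1`!%:R) <= ln n%:R by near: n; exact: near_ln.
have x0 : 0 <= ln n%:R / 2 :> R by rewrite divr_ge0// ln_nat_ge0.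
rewrite -(@lnK _ n%:R) ?posrE//; set x := ln n%:R in h x0 *.
have -> : Num.sqrt (expR x) = expR (x / 2).
  rewrite -[RHS]ger0_norm ?expR_ge0// -sqrtr_sqr; congr Num.sqrt.
  by rewrite -expRM_natl; congr expR; field.
rewrite expRK; apply: (@le_trans _ _ (`|C| * 2 ^+ p * (x / 2) ^+ p)).
  rewrite -mulrA -exprMn (_ : 2 * (x / 2) = x); last by field.
  by rewrite ler_wpM2r ?ler_norm// exprn_ge0// ln_nat_ge0.
by apply: expR_ge_pow => //; rewrite ler_pdivlMr// mulrC.
Unshelve. all: by end_near. Qed.

Lemma ln4_ge1 : 1 <= ln 4 :> R.
Proof.
have -> : 4 = 2 * 2 :> R by ring.
have := @ln_succ_sub_ge R 1 isT; rewrite ln1 subr0 => h.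
by rewrite lnM ?posrE//; lra.
Qed.

(* Two requirements fix the blocks. The ratio of consecutive ends must exceed the square
   of [ln (ln n)], so that the past of a block is negligible within it; and [ln n] must be
   of order [k * sqrt (ln k)] only, so that the probabilities of reaching the critical level
   in block [k], of order [1 / (ln n * sqrt (ln (ln n)))], still have a divergent sum. *)
Definition spacing k := Num.truncn (Num.sqrt (ln k%:R) : R).

Definition block_end k := (4 ^ (k * spacing k))%N.

Lemma le_spacing j k : (0 < j)%N -> (j <= k)%N -> (spacing j <= spacing k)%N.
Proof.
move=> j0 jk; apply: le_truncn; rewrite ler_wsqrtr// ler_ln ?posrE ?ltr0n ?ler_nat//.
exact: leq_trans jk.
Qed.

Lemma block_endS k : (0 < k)%N -> (4 ^ spacing k.+1 * block_end k <= block_end k.+1)%N.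
Proof.
move=> k0; rewrite -expnD leq_exp2l// mulSn leq_add2l leq_mul2l.
by rewrite le_spacing// orbT.
Qed.

Lemma ln_block_end k : ln (block_end k)%:R = k%:R * (spacing k)%:R * ln 4 :> R.
Proof. by rewrite /block_end natrX lnXn// -[ln 4 *+ _]mulr_natl natrM. Qed.

Lemma block_end_bounds : \forall k \near \oo,
  let n : R := (block_end k.+1)%:R in let l := ln (ln n) in
  [/\ (k.+1 <= block_end k.+1)%N, 64 * (block_end k)%:R * l ^+ 2 <= n &
      Num.sqrt l * ln n <= 8 * (k.+1%:R * ln k.+1%:R)].
Proof.
near=> k => n l; set L : R := ln k.+1%:R.
have k1 : (1 <= k)%N by near: k; exact: nbhs_infty_ge.
have lnk C : C <= ln k%:R -> C <= L.
  by move=> /le_trans; apply; rewrite ler_ln ?posrE ?ltr0n// ler_nat.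
have L4 : 4 <= L by apply: lnk; near: k; exact: near_ln.
(* The 576 is 64 * 3^2, from [l <= 3 * L]; [expR 1] makes up for the truncation, as s > q - 1; the
   factorial comes from [expR_ge_pow] for the fourth power. The square appears because [L] is the
   square of [q]. *)
have Lc : (576 * expR 1 * 5`!%:R) ^+ 2 <= L by apply: lnk; near: k; exact: near_ln.
have L0 : 0 < L by lra.
pose q := Num.sqrt L; have q2 : q ^+ 2 = L by rewrite sqr_sqrtr ?ltW.
have q0 : 0 <= q by exact: sqrtr_ge0.
have q1 : 1 <= q by rewrite -(@ler_sqr _ 1) ?nnegrE// q2 expr1n; lra.
have qL : q <= L by rewrite -q2 expr2 ler_peMl.
pose s : R := (spacing k.+1)%:R; have sq : s <= q by rewrite /s truncn_le.
have qs : q < s + 1 by rewrite /s natr1; exact: truncnS_gt.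
have s1 : (1 <= spacing k.+1)%N by rewrite truncn_ge_nat.
have s1' : 1 <= s by rewrite ler1n.
have l1 := ln4_ge1; have l4 : ln 4 <= 4 :> R by rewrite ltW// ln_sublinear.
have K1 : 1 <= k.+1%:R :> R by rewrite ler1n.
have lnn : ln n = k.+1%:R * s * ln 4 by exact: ln_block_end.
have [lnn1 lnn4] : 1 <= ln n /\ ln n <= 4 * (k.+1%:R * q).
  exact: block_arith1 K1 s1' sq l1 l4 lnn.
have lL : l <= 3 * L.
  have -> : 3 * L = L + L + L by ring.
  apply: (@le_trans _ _ (ln (4 * (k.+1%:R * q)))).
    rewrite ler_ln ?posrE//; first by rewrite (lt_le_trans _ lnn1).
    by rewrite (lt_le_trans _ lnn4)// (lt_le_trans _ lnn1).
  have q0' : 0 < q by rewrite (lt_le_trans _ q1).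
  rewrite !lnM ?posrE ?mulr_gt0 ?ltr0n// -/L.
  have : ln q < q by exact: ln_sublinear.
  by move: l4 L4 qL; clear; lra.
have l0 : 0 <= l by exact: ln_ge0.
have sl : Num.sqrt l <= 2 * q.
  rewrite -ler_sqr ?nnegrE ?sqrtr_ge0 ?mulr_ge0// sqr_sqrtr// exprMn q2.
  by move: lL L0; clear; lra.
split.
- apply: ltnW; apply: (leq_trans (ltn_expl k.+1 (isT : 1 < 4)%N)).
  by rewrite leq_exp2l// leq_pmulr.
- have := block_endS k1; rewrite -(ler_nat R) natrM natrX => /(le_trans _); apply.
  rewrite mulrAC ler_wpM2r//.
  apply: (@le_trans _ _ (576 * q ^+ 4)).
    have : l ^+ 2 <= (3 * L) ^+ 2 by rewrite ler_sqr ?nnegrE// (le_trans l0).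
    by rewrite (exprM q 2 2) q2 exprMn; clear; lra.
  have h : 576 * expR 1 * q ^+ 4 <= expR q.
    apply: expR_ge_pow; first exact: q0.
    by apply: (le_trans (ler_norm _)); rewrite -sqrtr_sqr; exact: ler_wsqrtr.
  rewrite -(ler_pM2l (expR_gt0 1)) mulrA [expR 1 * _]mulrC (le_trans h)//.
  rewrite -(@lnK _ 4) ?posrE// -expRM_natl -expRD ler_expR -/s.
  by move: qs s1' l1; clear; nra.
- apply: (@le_trans _ _ (2 * q * (4 * (k.+1%:R * q)))).
    by rewrite ler_pM ?sqrtr_ge0// (le_trans _ lnn1).
  by rewrite -q2 le_eqVlt; apply/orP; left; apply/eqP; ring.
Unshelve. all: by end_near. Qed.

End block_scale.

Section lower_lil_arith.
Context (R : realType).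

(** [X] is the level of a block ending at [n] and starting at [n'], in standard deviations of its
    increment, and [dd] is the raise. The corrections to (2 l)^(1/2) are of order l^(-1/2), so that
    X^2 exceeds 2 l by a constant only and exp(-X^2/2) keeps the order exp(-l). *)
Lemma lil_level_arith (sigma n n' l dd X : R) :
  0 < sigma -> 1 <= l -> 0 <= dd -> 0 < n -> 0 <= n' -> 64 * n' * l ^+ 2 <= n ->
  dd * Num.sqrt l <= sigma * Num.sqrt n ->
  X * (sigma * Num.sqrt (n - n')) =
    sigma * Num.sqrt (2 * n * l) + dd + 2 * sigma * Num.sqrt (2 * n' * l) ->
  [/\ n <= 4 * (n - n'), 1 <= X & X ^+ 2 <= 2 * l + 8].
Proof.
move=> s0 l1 d0 n0 n'0 n'l dn XE.
have l0 : 0 < l by lra.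
have n'n : 64 * (n' * l) <= n.
  by apply: le_trans n'l; rewrite -mulrA ler_pM2l// ler_wpM2l// expr2 ler_peMl// ltW.
have n'64 : 64 * n' <= n by apply: le_trans n'n; rewrite ler_pM2l// ler_peMr.
have N4 : n <= 4 * (n - n') by lra.
have N0 : 0 < n - n' by lra.
set r := Num.sqrt (n - n') in XE; have r0 : 0 < r by rewrite sqrtr_gt0.
have r2 : r ^+ 2 = n - n' by rewrite sqr_sqrtr// ltW.
set a := Num.sqrt l in dn; have a0 : 0 < a by rewrite sqrtr_gt0.
have a2 : a ^+ 2 = l by rewrite sqr_sqrtr// ltW.
have a1 : 1 <= a by rewrite -(@ler_sqr _ 1) ?nnegrE ?(ltW a0)// expr1n a2.
set m := Num.sqrt n in dn; have m0 : 0 < m by rewrite sqrtr_gt0.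
have m2 : m ^+ 2 = n by rewrite sqr_sqrtr// ltW.
pose t : R := Num.sqrt 2; have t2 : t ^+ 2 = 2 by rewrite sqr_sqrtr.
have t0 : 0 <= t by exact: sqrtr_ge0.
have t1 : 1 <= t by rewrite -(@ler_sqr _ 1) ?nnegrE// t2 expr1n; lra.
have th : t <= 3 / 2 by rewrite -ler_sqr ?nnegrE// ?t2; lra.
have E1 : Num.sqrt (2 * n * l) = t * m * a by rewrite !sqrtrM ?mulr_ge0 ?(ltW n0).
have E2 : Num.sqrt (2 * n' * l) <= t * m / (8 * a).
  rewrite -ler_sqr ?nnegrE ?sqrtr_ge0 ?divr_ge0 ?mulr_ge0 ?(ltW m0) ?(ltW a0)//.
  rewrite sqr_sqrtr ?mulr_ge0 ?(ltW l0)// exprMn exprVn !exprMn t2 m2 a2.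
  rewrite ler_pdivlMr ?mulr_gt0 ?exprn_gt0//; move: n'l; rewrite expr2 => h.
  rewrite [leLHS](_ : _ = 2 * (64 * n' * (l * l))) ?ler_pM2l//; ring.
have X2 : X * r <= m * (t * a + 7 / 5 / a).
  rewrite -(ler_pM2l s0) mulrCA XE E1.
  have h1 : dd <= sigma * m / a by rewrite ler_pdivlMr.
  have h2 : 2 * sigma * Num.sqrt (2 * n' * l) <= 2 * sigma * (t * m / (8 * a)).
    by rewrite ler_wpM2l ?mulr_ge0 ?(ltW s0).
  have h3 : 2 * sigma * (t * m / (8 * a)) <= 3 / 8 * (sigma * m / a).
    rewrite (_ : 2 * sigma * _ = t / 4 * (sigma * m / a)); last by field; rewrite gt_eqF.
    by rewrite ler_wpM2r ?divr_ge0 ?mulr_ge0 ?(ltW s0) ?(ltW m0) ?(ltW a0)//; lra.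
  rewrite (_ : sigma * (m * _) = sigma * (t * m * a) + 7 / 5 * (sigma * m / a)); last first.
    by field; rewrite gt_eqF.
  have h4 : 0 <= sigma * m / a by rewrite divr_ge0 ?mulr_ge0 ?(ltW s0) ?(ltW m0) ?(ltW a0).
  by move: h1 h2 h3 h4; clear; lra.
have X0 : m * t * a <= X * r.
  rewrite -(ler_pM2l s0) [leRHS]mulrCA XE E1 (_ : sigma * (m * t * a) = sigma * (t * m * a)); last by ring.
  by rewrite -addrA lerDl addr_ge0// !mulr_ge0 ?sqrtr_ge0 ?(ltW s0).
have rm : r <= m by rewrite -ler_sqr ?nnegrE ?(ltW r0) ?(ltW m0)// r2 m2; lra.
split=> //.
  rewrite -(ler_pM2r r0) mul1r; apply: le_trans X0; apply: le_trans rm _.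
  by rewrite -mulrA ler_peMr ?(ltW m0)// mulr_ege1.
have Xr0 : 0 <= X * r by apply: le_trans X0; rewrite !mulr_ge0 ?(ltW m0) ?(ltW a0).
have : (X * r) ^+ 2 <= (m * (t * a + 7 / 5 / a)) ^+ 2.
  by rewrite lerXn2r ?nnegrE// (le_trans Xr0).
rewrite !exprMn r2 m2 => H.
have v1 : a^-1 ^+ 2 <= 1 by rewrite exprVn a2 invf_le1.
have av : a * a^-1 = 1 by rewrite mulfV// gt_eqF.
have sq : (t * a + 7 / 5 / a) ^+ 2 <= 2 * l + 31 / 5.
  rewrite (_ : (t * a + _) ^+ 2 = t ^+ 2 * a ^+ 2 + 14 / 5 * t * (a * a^-1) + 49 / 25 * a^-1 ^+ 2).
    by rewrite t2 a2 av; move: th v1; clear; lra.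
  by field; rewrite gt_eqF.
rewrite -(ler_pM2r N0); apply: (le_trans H).
apply: (@le_trans _ _ (n * (2 * l + 31 / 5))); first by rewrite ler_pM2l.
by move: n'n n'64 n0; clear; lra.
Qed.

(** Here [x] is the logarithm of the block end, and [n] stands for the square root of that end. The
    first conclusion is the size condition of the replacement method. In the second, 96 is 24 * 4,
    from [X <= 4 * Num.sqrt l], and 17 is 4 + 13. *)
Lemma lil_prob_arith (x l X C r n : R) :
  1 <= l -> expR l = x -> 1 <= X -> X ^+ 2 <= 2 * l + 8 -> 0 <= C ->
  C * 100 * expR 4 * 2 * x ^+ 3 <= n -> n <= 2 * r ->
  C * X ^+ 4 * expR (X ^+ 2 / 2) <= r /\
  expR (- 17) / 96 / (Num.sqrt l * x) <= (24 * X)^-1 * expR (- (X ^+ 2 / 2 + 13)).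
Proof.
move=> l1 lx X1 X2 C0 Cn nr; have X0 : 0 < X by lra.
have x0 : 0 < x by rewrite -lx expR_gt0.
have eX : expR (X ^+ 2 / 2) <= expR 4 * x by rewrite -lx -expRD ler_expR; lra.
have lx' : l <= x by rewrite -lx (le_trans _ (expR_ge1Dx l))//; lra.
split.
  have X4 : X ^+ 4 <= 100 * x ^+ 2.
    rewrite (exprM X 2 2); apply: (@le_trans _ _ ((10 * x) ^+ 2)).
      by rewrite lerXn2r ?nnegrE ?mulr_ge0 ?sqr_ge0 ?(ltW x0)//; lra.
    by rewrite exprMn; lra.
  have : C * X ^+ 4 * expR (X ^+ 2 / 2) <= C * (100 * x ^+ 2) * (expR 4 * x).
    by rewrite ler_pM ?expR_ge0 ?mulr_ge0 ?exprn_ge0 ?(ltW X0)// ler_wpM2l.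
  move: Cn; rewrite (_ : C * 100 * expR 4 * 2 * x ^+ 3 =
    2 * (C * (100 * x ^+ 2) * (expR 4 * x))); last by ring.
  by move: nr; clear; lra.
have sl : X <= 4 * Num.sqrt l.
  have l0 : 0 <= l by lra.
  by rewrite -ler_sqr ?nnegrE ?mulr_ge0 ?sqrtr_ge0 ?(ltW X0)// exprMn sqr_sqrtr//; lra.
have sl0 : 0 < Num.sqrt l by rewrite sqrtr_gt0; lra.
rewrite (_ : _ / _ / _ = (24 * (4 * Num.sqrt l))^-1 * (expR (- 17) / x)); last first.
  by field; rewrite !gt_eqF.
apply: ler_pM.
- by rewrite invr_ge0 !mulr_ge0 ?(ltW sl0).
- by rewrite divr_ge0 ?expR_ge0 ?(ltW x0).
- by rewrite lef_pV2 ?posrE ?mulr_gt0// ler_pM2l.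
- by rewrite -lx -expRN -expRD ler_expR; lra.
Qed.

Lemma inv_mul_ln_ge n : (2 <= n)%N ->
  ln (ln n.+1%:R) - ln (ln n%:R) <= (n%:R * ln n%:R)^-1 :> R.
Proof.
move=> n2; have n0 : 0 < n%:R :> R by rewrite ltr0n; lia.
have l0 : 0 < ln n%:R :> R by rewrite ln_gt0// ltr1n.
have l1 : 0 < ln n.+1%:R :> R by rewrite ln_gt0// ltr1n; lia.
have d1 : ln n.+1%:R - ln n%:R <= n%:R^-1 :> R.
  rewrite -ln_div ?posrE// (_ : n.+1%:R / n%:R = 1 + n%:R^-1).
    by apply: le_ln1Dx; rewrite (lt_trans (ltrN10 R))// invr_gt0.
  by rewrite -natr1; field; rewrite gt_eqF.
rewrite -ln_div ?posrE// (_ : _ / _ = 1 + (ln n.+1%:R - ln n%:R) / ln n%:R); last first.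
  by field; rewrite gt_eqF.
apply: (@le_trans _ _ ((ln n.+1%:R - ln n%:R) / ln n%:R)); last first.
  by rewrite invfM ler_pM2r ?invr_gt0.
apply: le_ln1Dx; rewrite (lt_le_trans (ltrN10 R))// divr_ge0 ?(ltW l0)//.
by rewrite subr_ge0 ler_ln ?posrE// ler_nat.
Qed.

(** The terms dominate the increments of c ln ln k, which telescope. *)
Lemma sum_inv_mul_ln_unbounded m (c C : R) : 0 < c -> (2 <= m)%N ->
  exists n, C <= \sum_(m <= k < m + n) c / (k%:R * ln k%:R).
Proof.
move=> c0 m2.
have [n _ Hn] := near_lnln (C / c + ln (ln m%:R)) : \forall n \near \oo, _.
exists n; have {}Hn := Hn (m + n)%N (leq_addl _ _).
have : c * (ln (ln (m + n)%:R) - ln (ln m%:R)) <= \sum_(m <= k < m + n) c / (k%:R * ln k%:R).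
  rewrite -(telescope_sumr (fun k => ln (ln k%:R)) (leq_addr n m)) mulr_sumr.
  apply: ler_sum_nat => k /andP[mk _].
  by rewrite ler_wpM2l ?(ltW c0)// inv_mul_ln_ge// (leq_trans m2).
apply: le_trans; rewrite mulrC -ler_pdivrMr//; move: Hn; lra.
Qed.

End lower_lil_arith.

Lemma quarter_arith (R : realType) (n m p : R) : 0 <= n -> m <= m * p ->
  64 * m * p <= n -> n <= 4 * (n - m).
Proof. by lra. Qed.

(** * Lower half of the law of the iterated logarithm *)

Section lower_lil.
Context d (T : measurableType d) (R : realType) (P : probability T R).
Context d' (T' : measurableType d') (Z : nat -> T -> T').
Hypothesis mZ : forall i, measurable_fun setT (Z i).
Hypothesis Z_indep : forall n (A : nat -> set T') B,
  (forall i, measurable (A i)) -> measurable B ->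
  (P ((\bigcap_(i in `I_n) Z i @^-1` A i) `&` Z n @^-1` B) =
   P (\bigcap_(i in `I_n) Z i @^-1` A i) * P (Z n @^-1` B))%E.
Hypothesis Z_ident : forall n B, measurable B ->
  P (Z n @^-1` B) = P (Z 0%N @^-1` B).

(* A version of the second Borel-Cantelli lemma: [c k] bounds from below the
   conditional probability of [F k] given the past up to time [t k]. *)
Lemma conditional_borel_cantelli (t : nat -> nat) (F : nat -> set T) (c : nat -> R) k0 :
  (forall k, (k0 <= k)%N -> (t k <= t k.+1)%N) ->
  (forall k, (k0 <= k)%N -> adapted Z (t k.+1) (\1_(F k) : T -> R)) ->
  (forall k W, (k0 <= k)%N -> adapted Z (t k) W -> (forall w, 0 <= W w) ->
     c k * Ex P W <= Ex P (fun w => W w * \1_(F k) w)) ->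
  (forall (C : R) m, (k0 <= m)%N -> exists n, C <= \sum_(m <= k < m + n) c k) ->
  {ae P, forall w, forall m, exists2 k, (m <= k)%N & F k w}.
Proof.
move=> tS aF cF cU.
suff H m : (k0 <= m)%N -> {ae P, forall w, exists2 k, (m <= k)%N & F k w}.
  have /ae_foralln H' : forall m, {ae P, forall w, exists2 k, (m + k0 <= k)%N & F k w}.
    by move=> m; apply: H; exact: leq_addl.
  apply: filterS H' => w Hw m; have [k mk Fk] := Hw m; exists k => //.
  exact: leq_trans (leq_addr _ _) mk.
move=> k0m.
(* The indicator that none of the [n] sets from [F m] on occurs; each further set multiplies its
   mean by at most 1 - c. *)
pose N := fix N n w : R := if n is j.+1 then N j w * (1 - \1_(F (m + j)%N) w) else 1.
have N01 n w : 0 <= N n w.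
  elim: n => //= n IH; rewrite mulr_ge0// indicE; case: (_ \in _); rewrite ?subrr ?subr0//.
have aN n : adapted Z (t (m + n)%N) (N n).
  elim: n => [|n IH]; first exact: bmf_cst.
  have kmn : (k0 <= m + n)%N by exact: leq_trans (leq_addr _ _).
  rewrite addnS; apply: bmfM; first exact: adapted_le (tS _ kmn) IH.
  by apply: bmfB; [exact: bmf_cst|exact: aF].
have EN n : Ex P (N n) <= expR (- \sum_(m <= k < m + n) c k).
  elim: n => [|n IH]; first by rewrite addn0 big_geq// oppr0 expR0 (Ex_cst P 1).
  have kmn : (k0 <= m + n)%N by exact: leq_trans (leq_addr _ _).
  have bN := adapted_bmf mZ (aN n).
  have bF := adapted_bmf mZ (aF _ kmn).
  rewrite addnS big_nat_recr/= ?leq_addr// opprD expRD.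
  rewrite (_ : (fun w => _) = fun w => N n w - N n w * \1_(F (m + n)%N) w); last first.
    by apply/funext => w; rewrite mulrBr mulr1.
  rewrite ExB//; last exact: bmfM.
  apply: (@le_trans _ _ ((1 - c (m + n)%N) * Ex P (N n))).
    by rewrite mulrBl mul1r lerD2l lerN2 cF.
  rewrite mulrC; apply: (@le_trans _ _ (Ex P (N n) * expR (- c (m + n)%N))).
    by rewrite ler_wpM2l ?Ex_ge0// expR_ge1Dx.
  by rewrite ler_wpM2r ?expR_ge0.
apply: (@ae_small _ _ _ _ _ (fun n => [set w | 1 <= N n w])
  (fun n => expR (- \sum_(m <= k < m + n) c k))).
- by move=> n; apply: measurable_ge; exact: (adapted_bmf mZ (aN n)).1.
- move=> n; apply: le_trans (EN n).
  have := pr_le_Ex P (adapted_bmf mZ (aN n)) (N01 n) ltr01.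
  by rewrite divr1.
- move=> e e0; have [n Hn] := cU (1 - ln e) m k0m; exists n.
  rewrite -ltr_ln ?posrE ?expR_gt0// expRK; lra.
- move=> n w /= H; suff -> : N n w = 1 by [].
  elim: n => //= n ->; rewrite mul1r indicE memNset ?subr0// => Fw.
  by apply: H; exists (m + n)%N => //; exact: leq_addr.
Qed.

Variables (u : T' -> R) (sigma : R).
Hypothesis bmf_u : bmf u.
Hypothesis Ex_u : Ex P (fun w => u (Z 0%N w)) = 0.
Hypothesis Ex_u2 : Ex P (fun w => u (Z 0%N w) ^+ 2) = sigma ^+ 2.
Hypothesis sigma_gt0 : 0 < sigma.

Let be := Ex P (fun w => `|u (Z 0%N w)| ^+ 3) + sigma ^+ 3.
Let C := 500 + 32 * expR 13 * (be / sigma ^+ 3).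
Let t := block_end R.
Let l k : R := ln (ln (t k.+1)%:R).
(** The last term pays for the sum before the block, which the upper half of the law, applied to
    [- u], eventually bounds from below. *)
Let y D k := sigma * Num.sqrt (2 * (t k.+1)%:R * l k) + D * ln (t k.+1)%:R ^+ 2 +
  2 * sigma * Num.sqrt (2 * (t k)%:R * l k).
Let F D k := [set w | y D k <= \sum_(t k <= i < t k.+1) u (Z i w)].
(** The factor 1/8 comes from the last bound in [block_end_bounds], the rest from
    [lil_prob_arith]. *)
Let c0 : R := expR (- 17) / 96 / 8.

Let C_ge0 : 0 <= C.
Proof.
have be0 : 0 <= be.
  by rewrite addr_ge0 ?exprn_ge0 ?(ltW sigma_gt0)//; apply: Ex_ge0 => w; exact: exprn_ge0.
have h : 0 <= be / sigma ^+ 3 by rewrite divr_ge0 ?exprn_ge0 ?(ltW sigma_gt0).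
exact: addr_ge0 (ler0n R 500) (mulr_ge0 (mulr_ge0 (ler0n R 32) (expR_ge0 13)) h).
Qed.

(** The Bernoulli estimate is made for an even number of steps, so the block lengths must be
    even. *)
Let block_end_even k : (2 <= t k)%N -> exists j, t k = (2 * j)%N.
Proof.
rewrite /t /block_end; case: (k * _)%N => [//|e _].
by exists (2 * 4 ^ e)%N; rewrite expnS mulnA.
Qed.

Let increment_prob D k W : 0 <= D -> (2 <= t k)%N -> (t k <= t k.+1)%N ->
  let n : R := (t k.+1)%:R in
  1 <= l k -> 64 * (t k)%:R * l k ^+ 2 <= n ->
  Num.sqrt (l k) * ln n <= 8 * (k.+1%:R * ln k.+1%:R) ->
  D / sigma * ln n ^+ 3 <= Num.sqrt n ->
  C * 100 * expR 4 * 2 * ln n ^+ 3 <= Num.sqrt n ->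
  adapted Z (t k) W -> (forall w, 0 <= W w) ->
  c0 / (k.+1%:R * ln k.+1%:R) * Ex P W <= Ex P (fun w => W w * \1_(F D k) w).
Proof.
move=> D0 t2 tS n l1 n'l ll Dn Cn aW W0.
have [a ta] := block_end_even t2.
have [b tb] := block_end_even (leq_trans t2 tS).
have ab : (t k.+1 = t k + 2 * (b - a))%N by move: tS; rewrite ta tb; clear; lia.
have n0 : 0 < n by rewrite ltr0n (leq_trans _ tS)// (leq_trans _ t2).
have lnn0 : 0 < ln n by rewrite ln_gt0// ltr1n (leq_trans t2).
have lnn : expR (l k) = ln n by rewrite lnK.
have l0 : 0 <= l k by lra.
have sl : Num.sqrt (l k) <= ln n.
  apply: (@le_trans _ _ (l k)); last by rewrite ltW// ln_sublinear.
  by rewrite -ler_sqr ?nnegrE ?sqrtr_ge0// sqr_sqrtr// expr2 ler_peMr.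
have M2 : 2 * (b - a)%:R = n - (t k)%:R :> R.
  by rewrite -natrM -natrB// ab addKn.
have dn : D * ln n ^+ 2 * Num.sqrt (l k) <= sigma * Num.sqrt n.
  rewrite -ler_pdivrMl//; apply: le_trans Dn.
  rewrite (_ : sigma^-1 * _ = D / sigma * ln n ^+ 2 * Num.sqrt (l k)); last by ring.
  rewrite [ln n ^+ 3]exprSr [leRHS]mulrA ler_wpM2l// mulr_ge0 ?exprn_ge0 ?(ltW lnn0)//.
  by rewrite divr_ge0// ltW.
have dd0 : 0 <= D * ln n ^+ 2 by rewrite mulr_ge0// exprn_ge0// ltW.
set r := Num.sqrt (n - (t k)%:R).
have N4 : n <= 4 * (n - (t k)%:R).
  by apply: quarter_arith n'l; [exact: ltW|rewrite ler_peMr// exprn_ege1].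
have nt0 : 0 < n - (t k)%:R by have := lt_le_trans n0 N4; rewrite pmulr_rgt0.
have r0 : 0 < r by rewrite sqrtr_gt0.
have XE : y D k / (sigma * r) * (sigma * r) = y D k by rewrite divfK// gt_eqF// mulr_gt0.
have [_ X1 X2] := lil_level_arith sigma_gt0 l1 dd0 n0 (ler0n _ _) n'l dn XE.
have nr : Num.sqrt n <= 2 * r.
  rewrite -ler_sqr ?nnegrE ?sqrtr_ge0 ?mulr_ge0 ?(ltW r0)//.
  by rewrite exprMn !sqr_sqrtr ?(ltW n0) ?(ltW nt0)// (_ : 2 ^+ 2 = 4)//; ring.
have [X4 Xp] := lil_prob_arith l1 lnn X1 X2 C_ge0 Cn nr.
have rM : Num.sqrt (2 * (b - a)%:R) = r by rewrite M2.
have := increment_lower_bound mZ Z_indep Z_ident bmf_u Ex_u Ex_u2 sigma_gt0 aW W0 X1.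
move=> /(_ (b - a)%N); rewrite rM => /(_ X4); rewrite -ab.
rewrite [sigma * r * _]mulrC XE -/(F D k); apply: le_trans.
rewrite ler_wpM2r ?Ex_ge0//; apply: le_trans Xp.
rewrite /c0 -mulrA -invfM ler_wpM2l ?divr_ge0 ?expR_ge0//.
have sln : 0 < Num.sqrt (l k) * ln n by rewrite mulr_gt0// sqrtr_gt0 (lt_le_trans ltr01).
by rewrite lef_pV2 ?posrE// (lt_le_trans sln).
Qed.

Let eventually_succ (A : nat -> Prop) :
  (\forall k \near \oo, A k.+1) -> \forall k \near \oo, A k.
Proof. by move=> [n _ H]; exists n.+1 => // -[|k]//= nk; exact: H. Qed.

Let eventually_increment D : 0 <= D ->
  \forall k \near \oo, [/\ (t k <= t k.+1)%N, (k <= t k)%N, (2 <= t k)%N &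
  forall W, adapted Z (t k) W -> (forall w, 0 <= W w) ->
    c0 / (k.+1%:R * ln k.+1%:R) * Ex P W <= Ex P (fun w => W w * \1_(F D k) w)].
Proof.
move=> D0.
have large : \forall n \near \oo, [/\ 1 <= ln (ln n%:R) :> R,
    D / sigma * ln n%:R ^+ 3 <= Num.sqrt n%:R &
    C * 100 * expR 4 * 2 * ln n%:R ^+ 3 <= Num.sqrt n%:R].
  by near=> n; split; near: n; [exact: near_lnln|exact: near_ln_pow|exact: near_ln_pow].
have [m _ Hm] := large.
have tk : \forall k \near \oo, (k <= t k)%N.
  by apply: eventually_succ; apply: filterS (block_end_bounds R) => k [].
near=> k.
have k2 : (2 <= k)%N by near: k; exact: nbhs_infty_ge.
have mk : (m <= k)%N by near: k; exact: nbhs_infty_ge.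
have ktk : (k <= t k)%N by near: k.
have [kt n'l ll] : let n : R := (t k.+1)%:R in let l := ln (ln n) in
  [/\ (k.+1 <= t k.+1)%N, 64 * (t k)%:R * l ^+ 2 <= n &
      Num.sqrt l * ln n <= 8 * (k.+1%:R * ln k.+1%:R)].
  by near: k; exact: block_end_bounds.
have tS : (t k <= t k.+1)%N.
  apply: leq_trans (block_endS R _); last exact: leq_trans k2.
  by rewrite leq_pmull// expn_gt0.
have t2 : (2 <= t k)%N := leq_trans k2 ktk.
have [l1 Dn Cn] := Hm (t k.+1) (leq_trans (leqW mk) kt).
split => // W aW W0; exact: increment_prob.
Unshelve. all: by end_near. Qed.

Lemma lower_lil (D : R) : 0 <= D ->
  {ae P, forall w, forall m, exists2 n, (m <= n)%N &
     sigma * Num.sqrt (2 * n%:R * ln (ln n%:R)) + D * ln n%:R ^+ 2 <=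
     \sum_(0 <= i < n) u (Z i w)}.
Proof.
move=> D0; have c00 : 0 < c0 by rewrite !divr_gt0// expR_gt0.
have [k0 _ Hk0] := eventually_increment D0.
have i_o : {ae P, forall w, forall m, exists2 k, (m <= k)%N & F D k w}.
  apply: (@conditional_borel_cantelli t (F D) (fun k => c0 / (k.+1%:R * ln k.+1%:R)) (maxn 1 k0)).
  - by move=> k; rewrite geq_max => /andP[_ /Hk0[]].
  - move=> k _; apply: bmf_indic; apply: measurable_ge.
    exact: (adapted_sum _ (t k) (fun=> bmf_u) (leqnn _)).1.
  - by move=> k W; rewrite geq_max => /andP[_ /Hk0[_ _ _]]; exact.
  - move=> B m; rewrite geq_max => /andP[m1 _].
    have [n Hn] := @sum_inv_mul_ln_unbounded R m.+1 c0 B c00 m1; exists n.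
    by move: Hn; rewrite addSn big_add1 /= => /le_trans; apply; exact: lexx.
have bNu : bmf (fun z => - u z) by exact: bmfN.
have ENu : Ex P (fun w => - u (Z 0%N w)) = 0.
  rewrite (_ : (fun w => _) = fun w => -1 * u (Z 0%N w)).
    by rewrite (ExZ _ _ (bmf_Z mZ 0 bmf_u)) Ex_u mulr0.
  by apply/funext => w; rewrite mulN1r.
have ENu2 : Ex P (fun w => (- u (Z 0%N w)) ^+ 2) = sigma ^+ 2.
  by rewrite -Ex_u2; congr (Ex P _); apply/funext => w; rewrite sqrrN.
(* Any [e] with (1 + e)^3 <= 2 matches the factor 2 in the last term of [y]; here the cube is
   125/64. *)
have e0 : 0 < 1 / 4 :> R by lra.
have up := upper_lil mZ Z_indep Z_ident bNu ENu ENu2 sigma_gt0 e0.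
apply: filterS2 i_o up => w io [n1 _ Hn1] m.
have [k mk Fk] := io (m + n1 + k0)%N.
have [tS kt t2 _] := Hk0 k (leq_trans (leq_addl _ _) mk).
have mnk : (m + n1 <= k)%N := leq_trans (leq_addr _ _) mk.
exists (t k.+1).
  exact: leq_trans (leq_trans (leq_addr _ _) mnk) (leq_trans kt tS).
have := Hn1 (t k) (leq_trans (leq_trans (leq_addl _ _) mnk) kt).
rewrite sumrN => H1.
rewrite (@big_cat_nat _ _ _ (t k))//=.
have ltk : 0 < ln (t k)%:R :> R by rewrite ln_gt0// ltr1n.
have ltk1 : ln (t k)%:R <= ln (t k.+1)%:R :> R.
  have tk0 : (0 < t k)%N := ltnW t2.
  by rewrite ler_ln ?posrE ?ltr0n ?ler_nat// (leq_trans tk0).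
have H2 : Num.sqrt (2 * (t k)%:R * ln (ln (t k)%:R)) <= Num.sqrt (2 * (t k)%:R * l k).
  rewrite ler_wsqrtr// ler_wpM2l ?mulr_ge0// ler_ln ?posrE//.
  exact: lt_le_trans ltk1.
have H3 : (1 + 1 / 4) ^+ 3 * sigma * Num.sqrt (2 * (t k)%:R * ln (ln (t k)%:R)) <=
    2 * sigma * Num.sqrt (2 * (t k)%:R * l k).
  have c2 : (1 + 1 / 4) ^+ 3 = 125 / 64 :> R by field.
  rewrite c2; apply: ler_pM; [|exact: sqrtr_ge0|rewrite ler_pM2r//; lra|exact: H2].
  by rewrite mulr_ge0// ltW.
have := lerD (le_trans H1 H3) Fk; rewrite /y => H.
have := ler_of_subr H; apply; rewrite /l; ring.
Qed.

End lower_lil.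

(** * Sums of increments with a vanishing drift *)

Section lil_rate_sums.
Context (R : realType).

Lemma lil_rateE n : 0 <= ln (ln n%:R) :> R ->
  lil_rate R n = Num.sqrt (ln (ln n%:R)) / Num.sqrt n%:R.
Proof.
move=> l0; rewrite /lil_rate powRN mulrC.
by rewrite (_ : 1 / 2 = 2^-1) ?powR12_sqrt//; field.
Qed.

Lemma lil_rate_ge0 n : 0 <= lil_rate R n.
Proof. by rewrite mulr_ge0// powR_ge0. Qed.

Lemma sqrt_succ_sub n :
  2 * (Num.sqrt n.+2%:R - Num.sqrt n.+1%:R) <= (Num.sqrt n.+1%:R)^-1 :> R /\
  (Num.sqrt n.+1%:R)^-1 <= 2 * (Num.sqrt n.+1%:R - Num.sqrt n%:R) :> R.
Proof.
set a : R := Num.sqrt n%:R; set b : R := Num.sqrt n.+1%:R; set c : R := Num.sqrt n.+2%:R.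
have a0 : 0 <= a by exact: sqrtr_ge0.
have b0 : 0 < b by rewrite sqrtr_gt0.
have a2 : a ^+ 2 = n%:R by rewrite sqr_sqrtr.
have b2 : b ^+ 2 = n%:R + 1 by rewrite sqr_sqrtr// natr1.
have c2 : c ^+ 2 = n%:R + 2 by rewrite sqr_sqrtr// -addn2 natrD.
have h1 := sqr_ge0 (c - b); have h2 := sqr_ge0 (b - a).
split.
  rewrite -(ler_pM2r b0) mulVf ?gt_eqF//.
  by move: h1; rewrite sqrrB c2 -mulrA mulrBl -expr2 b2; lra.
rewrite -(ler_pM2r b0) mulVf ?gt_eqF//.
by move: h2; rewrite sqrrB a2 -mulrA mulrBl -expr2 b2; lra.
Qed.

Lemma ler_lnln i n : (1 < i)%N -> (i <= n)%N -> ln (ln i%:R) <= ln (ln n%:R) :> R.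
Proof.
move=> i1 ni; have n1 := leq_trans i1 ni.
by rewrite !ler_ln ?posrE ?ln_gt0 ?ltr1n ?ltr0n ?ler_nat// (ltn_trans _ i1, ltn_trans _ n1).
Qed.

Lemma lnln_ge0_from : exists2 i0, (1 < i0)%N & forall i, (i0 <= i)%N -> 1 <= ln (ln i%:R) :> R.
Proof.
have [m _ Hm] := near_lnln (1 : R); exists m.+2 => // i mi; apply: Hm.
by apply: leq_trans mi; rewrite -addn2 leq_addr.
Qed.

Lemma lil_rate_sum_le : exists C : R, forall n, 1 <= ln (ln n%:R) :> R ->
  \sum_(0 <= i < n) lil_rate R i.+1 <= C + 2 * Num.sqrt (n%:R * ln (ln n%:R)).
Proof.
have [i0 i1 Hi0] := lnln_ge0_from.
exists (\sum_(0 <= i < i0) lil_rate R i.+1) => n ln1.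
have [ni|i_n] := leqP n i0.
  rewrite ler_wpDr ?mulr_ge0 ?sqrtr_ge0//.
  rewrite [leRHS](@big_cat_nat _ _ _ n)//= lerDl sumr_ge0// => *; exact: lil_rate_ge0.
rewrite (@big_cat_nat _ _ _ i0)//= 1?ltnW// lerD2l.
have ns0 : 0 <= Num.sqrt (ln (ln n%:R)) :> R by exact: sqrtr_ge0.
apply: (@le_trans _ _ (\sum_(i0 <= i < n) Num.sqrt (ln (ln n%:R)) * 2 *
    (Num.sqrt i.+1%:R - Num.sqrt i%:R))).
  apply: ler_sum_nat => i /andP[i0i ni].
  have l1 : 1 <= ln (ln i.+1%:R) :> R by apply: Hi0; exact: leqW.
  rewrite lil_rateE ?(le_trans ler01)// -mulrA ler_pM ?sqrtr_ge0 ?invr_ge0 ?sqrtr_ge0//.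
    by rewrite ler_wsqrtr// ler_lnln// ltnS (leq_trans _ i0i)// ltnW.
  exact: (sqrt_succ_sub i).2.
rewrite -mulr_sumr telescope_sumr 1?ltnW// [n%:R * _]mulrC sqrtrM ?(le_trans ler01)//.
rewrite [leRHS]mulrA [2 * _]mulrC ler_wpM2l ?mulr_ge0//.
by rewrite gerBl sqrtr_ge0.
Qed.

(** Starting at [m] near the square root of n loses little: ln ln m is at least ln ln n - ln 2, so
    this factor is almost constant on the range kept, while the root of [m] is negligible against
    that of n. *)
Lemma lil_rate_sum_ge (e : R) : 0 < e < 1 -> \forall n \near \oo,
  2 * (1 - e) ^+ 2 * Num.sqrt (n%:R * ln (ln n%:R)) <= \sum_(0 <= i < n) lil_rate R i.+1.
Proof.
move=> /andP[e0 e1].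
near=> n; pose m := (Num.truncn (Num.sqrt n%:R : R)).+1.
have ms : Num.sqrt n%:R <= m%:R :> R by rewrite ltW// truncnS_gt.
have sm : m%:R <= Num.sqrt n%:R + 1 :> R by rewrite /m -natr1 lerD2r truncn_le.
clearbody m.
have n9 : 9 <= n%:R :> R by near: n; exact: nbhs_infty_ger.
have ne : 9 / e ^+ 4 <= n%:R by near: n; exact: nbhs_infty_ger.
set s : R := Num.sqrt n%:R in ms sm *; have s2 : s ^+ 2 = n%:R by rewrite sqr_sqrtr.
have s0 : 0 <= s by exact: sqrtr_ge0.
have s3 : 3 <= s by rewrite -ler_sqr ?nnegrE// s2; lra.
have se : 3 / e ^+ 2 <= s.
  rewrite -ler_sqr ?nnegrE ?divr_ge0 ?exprn_ge0 ?(ltW e0)// s2.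
  by rewrite exprMn exprVn -exprM (_ : 3 ^+ 2 = 9)//; ring.
have m1 : (1 < m)%N by rewrite -(ltr_nat R); lra.
have mn : (m <= n)%N.
  by rewrite -(ler_nat R) -s2 (le_trans sm)// expr2; nra.
have ell : ln 2 / e <= ln (ln n%:R) by near: n; exact: near_lnln.
have ell1 : 1 <= ln (ln n%:R) :> R by near: n; exact: near_lnln.
have ell2 : 1 + ln 2 <= ln (ln n%:R) :> R by near: n; exact: near_lnln.
have lnn0 : 0 < ln n%:R :> R by rewrite ln_gt0// ltr1n (leq_trans m1).
have lm : ln (ln n%:R) - ln 2 <= ln (ln m%:R) :> R.
  have lm0 : 0 < ln m%:R :> R by rewrite ln_gt0// ltr1n.
  rewrite -ln_div ?posrE// ler_ln ?posrE ?divr_gt0// -s2 lnXn; last by lra.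
  rewrite -[ln s *+ 2]mulr_natl mulrAC divff// mul1r ler_ln ?posrE//; last by rewrite ltr0n ltnW.
  by lra.
have le : (1 - e) * ln (ln n%:R) <= ln (ln m%:R).
  by move: ell; rewrite ler_pdivrMr// => ell; lra.
have lm1 : 1 <= ln (ln m%:R) :> R by lra.
rewrite (@big_cat_nat _ _ _ m)//= ler_wpDl ?sumr_ge0//.
  by move=> i _; exact: lil_rate_ge0.
apply: (@le_trans _ _ (\sum_(m <= i < n) Num.sqrt (ln (ln m%:R)) * 2 *
    (Num.sqrt i.+2%:R - Num.sqrt i.+1%:R))); last first.
  apply: ler_sum_nat => i /andP[mi ni].
  have lmi : ln (ln m%:R) <= ln (ln i.+1%:R) :> R by rewrite ler_lnln// leqW.
  rewrite lil_rateE ?(le_trans _ (le_trans lm1 lmi))// -mulrA.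
  rewrite ler_pM ?sqrtr_ge0 ?mulr_ge0//; [|exact: ler_wsqrtr|exact: (sqrt_succ_sub i).1].
  by rewrite subr_ge0 ler_wsqrtr// ler_nat.
rewrite -mulr_sumr (telescope_sumr (fun i => Num.sqrt i.+1%:R))//.
rewrite sqrtrM// -/s.
have h1 : (1 - e) * Num.sqrt (ln (ln n%:R)) <= Num.sqrt (ln (ln m%:R)).
  have l0 : 0 <= ln (ln n%:R) :> R by lra.
  have e0' : 0 <= 1 - e by lra.
  rewrite -ler_sqr ?nnegrE ?mulr_ge0 ?sqrtr_ge0// exprMn !sqr_sqrtr//; last by lra.
  apply: le_trans le; rewrite expr2 -mulrA ler_piMl ?mulr_ge0//; lra.
have h2 : (1 - e) * s <= Num.sqrt n.+1%:R - Num.sqrt m.+1%:R.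
  have h3 : s <= Num.sqrt n.+1%:R by rewrite ler_wsqrtr// ler_nat.
  have h4 : Num.sqrt m.+1%:R <= e * s.
    rewrite -ler_sqr ?nnegrE ?sqrtr_ge0 ?mulr_ge0 ?(ltW e0)// sqr_sqrtr// exprMn.
    move: se; rewrite ler_pdivrMr ?exprn_gt0// -[m.+1%:R]natr1 => se.
    have : 3 * s <= e ^+ 2 * s ^+ 2 by rewrite [s ^+ 2]expr2 mulrA [e ^+ 2 * s]mulrC ler_wpM2r.
    by lra.
  by rewrite mulrBl mul1r; lra.
rewrite [leLHS](_ : _ = ((1 - e) * Num.sqrt (ln (ln n%:R))) * 2 * ((1 - e) * s)); last by ring.
have e0' : 0 <= 1 - e by lra.
by rewrite ler_pM// ?mulr_ge0 ?sqrtr_ge0// ler_pM2r.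
Unshelve. all: by end_near. Qed.

Lemma harmonic_sum_le n : (0 < n)%N ->
  \sum_(0 <= i < n) i.+1%:R^-1 <= 1 + ln n%:R :> R.
Proof.
case: n => // n _; elim: n => [|n IH]; first by rewrite big_nat1 invr1 ln1 addr0.
rewrite big_nat_recr//=; apply: (le_trans (lerD IH (ln_succ_sub_ge R (ltn0Sn n)))).
by lra.
Qed.

End lil_rate_sums.

Lemma drift_constants (R : realType) (c sigma : R) : 0 < sigma ->
  sigma < c * Num.sqrt 2 -> exists e kap : R, [/\ 0 < e < 1, 0 < kap &
    (1 + e) ^+ 3 * sigma * Num.sqrt 2 + kap <= (1 - e) * (2 * (1 - e) ^+ 2 * c)].
Proof.
move=> s0 sc; pose t : R := Num.sqrt 2.
have t0 : 0 < t by rewrite sqrtr_gt0.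
have t2 : t ^+ 2 = 2 by rewrite sqr_sqrtr.
pose s := sigma * t; pose r := 2 * c.
have s_gt0 : 0 < s by exact: mulr_gt0.
have sr : s < r.
  by rewrite /s /r (_ : 2 * c = c * t * t) ?ltr_pM2r// -mulrA -expr2 t2 mulrC.
(* This value gives e (4 s + 3 r) < 8 e (r + s) = r - s, that is (1 + 4 e) s < (1 - 3 e) r, the
   linearized claim. *)
pose e := (r - s) / (8 * (r + s)).
have rs0 : 0 < 8 * (r + s) by rewrite mulr_gt0// addr_gt0// (lt_trans s_gt0).
have e0 : 0 < e by rewrite divr_gt0// subr_gt0.
have eE : e * (8 * (r + s)) = r - s by rewrite divfK// gt_eqF.
clearbody e; have r0 : 0 < r by lra.
have e8 : e <= 1 / 8.
  by rewrite -(ler_pM2r rs0) eE; lra.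
have e2 : e ^+ 2 <= e / 8 by rewrite expr2 ler_wpM2l//; lra.
have e20 : 0 <= e ^+ 2 by exact: sqr_ge0.
have e30 : 0 <= e ^+ 3 by rewrite exprn_ge0// ltW.
have e3 : e ^+ 3 <= e ^+ 2 / 8 by rewrite exprSr ler_wpM2l//; lra.
have H1 : (1 + e) ^+ 3 <= 1 + 4 * e.
  rewrite (_ : (1 + e) ^+ 3 = 1 + 3 * e + 3 * e ^+ 2 + e ^+ 3); last by ring.
  by lra.
have H2 : 1 - 3 * e <= (1 - e) ^+ 3.
  rewrite (_ : (1 - e) ^+ 3 = 1 - 3 * e + 3 * e ^+ 2 - e ^+ 3); last by ring.
  by lra.
have H3 : (1 + 4 * e) * s < (1 - 3 * e) * r.
  have rs : 0 < 5 * r + 4 * s by lra.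
  have : 0 < e * (5 * r + 4 * s) by exact: mulr_gt0.
  rewrite (_ : e * (5 * r + 4 * s) = e * (8 * (r + s)) - 3 * e * r - 4 * e * s); last by ring.
  rewrite eE => H; rewrite mulrDl mulrBl !mul1r.
  by lra.
have H4 : (1 + e) ^+ 3 * s <= (1 + 4 * e) * s by rewrite ler_pM2r.
have H5 : (1 - 3 * e) * r <= (1 - e) ^+ 3 * r by rewrite ler_pM2r.
exists e, ((1 - e) ^+ 3 * r - (1 + e) ^+ 3 * s); split; first by rewrite e0/=; lra.
  by rewrite subr_gt0 (le_lt_trans H4)// (lt_le_trans H3).
by rewrite le_eqVlt; apply/orP; left; apply/eqP; rewrite /r /s -/t; ring.
Qed.

Lemma sum_eventually_le (R : realType) (f g : nat -> R) m :
  (forall i, (m <= i)%N -> f i <= g i) ->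
  exists C : R, forall n, \sum_(0 <= i < n) f i <= \sum_(0 <= i < n) g i + C.
Proof.
move=> fg; exists (\sum_(0 <= i < m) `|f i - g i|) => n.
rewrite -lerBlDl -sumrB.
have [nm|mn] := leqP n m.
  rewrite [leRHS](@big_cat_nat _ _ _ n)//= ler_wpDr ?sumr_ge0//.
  by apply: ler_sum => i _; exact: ler_norm.
rewrite (@big_cat_nat _ _ _ m)//= 1?ltnW// -[leRHS]addr0 lerD//.
  by apply: ler_sum => i _; exact: ler_norm.
by rewrite big_nat sumr_le0// => i /andP[mi _]; rewrite subr_le0 fg.
Qed.

(** [A] is the sum of the centred increments, [x] the drift, [E] the sum of chi^2, [r] that of the
    rates, [s] is (n ln ln n)^(1/2) and [l] is ln n. The terms in [2 * c * s] cancel exactly; one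
    part of the raise meets [K1 * E], and the remaining l^2 covers the constants. *)
Lemma critical_balance (R : realFieldType) (A x y E r s l c K K1 L C C1 C2 C3 : R) :
  A + x - K1 * E - C <= L -> 2 * c * s + (K1 * (2 * K) + 1) * l ^+ 2 <= A ->
  - y <= x -> y <= c * r + C1 -> r <= C3 + 2 * s ->
  E <= K * (l * (2 * l)) + C2 -> 0 <= c -> 0 <= K1 -> 1 <= l ->
  c * C3 + C1 + K1 * C2 + C <= l -> 0 <= L.
Proof.
move=> h1 h2 h3 h4 h5 h6 c0 K10 l1 h7.
have h8 : c * r <= c * (C3 + 2 * s) by exact: ler_wpM2l.
have h9 : K1 * E <= K1 * (K * (l * (2 * l)) + C2) by exact: ler_wpM2l.
have h10 : l <= l ^+ 2 by rewrite expr2 ler_peMr// (le_trans ler01).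
move: h2 h8 h9; rewrite (_ : (K1 * (2 * K) + 1) * l ^+ 2 = K1 * (K * (l * (2 * l))) + l ^+ 2); last by ring.
by rewrite !mulrDr; lra.
Qed.

(** A fraction [e] of the drift [x] pays for the quadratic error [KE]; the remaining fraction
    exceeds the fluctuations [A] by [kap * s], up to constants. *)
Lemma drift_balance (R : realFieldType) (A x KE L r s a b c e kap C C1 C2 : R) :
  - A <= a * s -> b * s <= r -> c * r <= x + C2 -> KE <= e * x + C1 ->
  A + x - KE - C <= L -> 0 < c -> e < 1 -> 0 <= s ->
  a + kap <= (1 - e) * (b * c) -> kap * s - (C1 + C + (1 - e) * C2) <= L.
Proof.
move=> h1 h2 h3 h4 h5 c0 e1 s0 h6.
have h7 : (a + kap) * s <= (1 - e) * (b * c) * s by exact: ler_wpM2r.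
have e0 : 0 <= 1 - e by rewrite subr_ge0 ltW.
have h8 : c * (b * s) <= c * r by rewrite ler_pM2l.
have h9 : (1 - e) * (c * (b * s)) <= (1 - e) * (x + C2).
  by rewrite ler_wpM2l// (le_trans h8).
move: h9; rewrite (_ : (1 - e) * (c * (b * s)) = (1 - e) * (b * c) * s); last by ring.
by lra.
Qed.

(** * Partial sums of fluctuations and drift *)

Section perturbed_walk.
Context d (T : measurableType d) (R : realType) (P : probability T R).
Context d' (T' : measurableType d') (Z : nat -> T -> T').
Hypothesis mZ : forall i, measurable_fun setT (Z i).
Hypothesis Z_indep : forall n (A : nat -> set T') B,
  (forall i, measurable (A i)) -> measurable B ->
  (P ((\bigcap_(i in `I_n) Z i @^-1` A i) `&` Z n @^-1` B) =
   P (\bigcap_(i in `I_n) Z i @^-1` A i) * P (Z n @^-1` B))%E.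
Hypothesis Z_ident : forall n B, measurable B ->
  P (Z n @^-1` B) = P (Z 0%N @^-1` B).
Variables (u v : T' -> R) (sigma lam : R) (chi : nat -> R).
Hypothesis bmf_u : bmf u.
Hypothesis Ex_u : Ex P (fun w => u (Z 0%N w)) = 0.
Hypothesis Ex_u2 : Ex P (fun w => u (Z 0%N w) ^+ 2) = sigma ^+ 2.
Hypothesis sigma_gt0 : 0 < sigma.
Hypothesis bmf_v : bmf v.
Hypothesis Ex_v : Ex P (fun w => v (Z 0%N w)) = lam.
Hypothesis chi_ge0 : forall i, 0 <= chi i.
Hypothesis chi_cvg0 : chi @ \oo --> 0.

(** The terms -th chi (v - lam) with compensator th^2 chi^2 h form an exponential supermartingale.
    Division by th leaves the error th h times the sum of chi^2, so th h must be at most e; th is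
    also small enough for the exponents to be at most 1, whence the [expR 1] in [h]. *)
Lemma weighted_deviation (cb e : R) : (forall i, chi i <= cb) -> 0 < e ->
  {ae P, forall w, exists C : R, forall n,
     - C - e * \sum_(0 <= i < n) chi i ^+ 2 <=
     \sum_(0 <= i < n) chi i * (v (Z i w) - lam)}.
Proof.
move=> chi_cb e0.
have bv' : bmf (fun z => v z - lam) by apply: bmfB => //; exact: bmf_cst.
have [B [B0 vB]] : exists B, 0 < B /\ forall z, `|v z - lam| <= B.
  have [B H] := bv'.2; exists (`|B| + 1); split; first by rewrite ltr_wpDl.
  by move=> z; apply: (le_trans (H z)); rewrite (le_trans (ler_norm _))// lerDl.
have cb0 : 0 <= cb := le_trans (chi_ge0 0) (chi_cb 0%N).
pose h := expR 1 / 2 * B ^+ 2; have h0 : 0 < h.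
  by rewrite mulr_gt0 ?exprn_gt0// divr_gt0// expR_gt0.
have hE : h = expR 1 / 2 * B ^+ 2 by [].
clearbody h; have he0 : 0 < h / e by exact: divr_gt0.
have cbB : 0 <= cb * B by rewrite mulr_ge0// ltW.
pose th := (cb * B + h / e + 1)^-1.
have D0 : 0 < cb * B + h / e + 1.
  by rewrite ltr_wpDl// addr_ge0// ltW.
have th0 : 0 < th by rewrite invr_gt0.
have thD : th * (cb * B + h / e + 1) = 1 by rewrite mulVf// gt_eqF.
clearbody th.
have thcb : th * cb * B <= 1.
  by rewrite -thD -mulrA ler_pM2l// -addrA lerDl addr_ge0// ltW.
have thh : th * h <= e.
  rewrite -[leRHS]mul1r -ler_pdivrMr// -mulrA -thD ler_pM2l// addrAC lerDr.
  by rewrite addr_ge0.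
pose y i z := (- (th * chi i)) * (v z - lam) - th ^+ 2 * chi i ^+ 2 * h.
have by_ i : bmf (y i).
  apply: bmfB; last exact: bmf_cst.
  by apply: bmfM => //; exact: bmf_cst.
have Ey i : Ex P (fun w => expR (y i (Z 0%N w))) <= 1.
  pose x z := (- (th * chi i)) * (v z - lam).
  have bx : bmf x by apply: bmfM => //; exact: bmf_cst.
  have tc0 : 0 <= th * chi i by rewrite mulr_ge0// ltW.
  have tc : th * chi i * B <= 1.
    by apply: le_trans thcb; rewrite ler_pM2r// ler_pM2l.
  have x1 z : `|x z| <= 1.
    by apply: le_trans tc; rewrite /x normrM normrN (ger0_norm tc0) ler_wpM2l.
  have bvZ := bmf_Z mZ 0 bv'.
  have Ev0 : Ex P (fun w => v (Z 0%N w) - lam) = 0.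
    by rewrite ExB ?Ex_v ?(Ex_cst P lam) ?subrr//; [exact: (bmf_Z mZ 0 bmf_v)|exact: bmf_cst].
  have Ex0 : Ex P (fun w => x (Z 0%N w)) = 0 by rewrite ExZ// Ev0 mulr0.
  have Hx := Ex_expR_quad mZ bx x1 Ex0.
  have Ex2 : Ex P (fun w => x (Z 0%N w) ^+ 2) <= th ^+ 2 * chi i ^+ 2 * B ^+ 2.
    rewrite -(Ex_cst P (th ^+ 2 * chi i ^+ 2 * B ^+ 2)).
    apply: Ex_le => [||w]; [|exact: bmf_cst|].
      by apply: bmfX; exact: (bmf_Z mZ 0 bx).
    rewrite /x exprMn sqrrN exprMn ler_wpM2l ?(mulr_ge0 (sqr_ge0 _) (sqr_ge0 _))//.
    by rewrite -real_normK ?num_real// lerXn2r ?nnegrE ?(ltW B0).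
  rewrite (_ : (fun w => expR (y i (Z 0%N w))) =
      fun w => expR (- (th ^+ 2 * chi i ^+ 2 * h)) * expR (x (Z 0%N w))); last first.
    by apply/funext => w; rewrite -expRD addrC.
  rewrite ExZ; last by apply: bmf_expR; exact: (bmf_Z mZ 0 bx).
  apply: (le_trans (ler_wpM2l (expR_ge0 _) Hx)).
  rewrite -expRD -[leRHS]expR0 ler_expR addrC subr_le0.
  rewrite (_ : th ^+ 2 * chi i ^+ 2 * h = expR 1 / 2 * (th ^+ 2 * chi i ^+ 2 * B ^+ 2)); last first.
    by rewrite hE; ring.
  by rewrite ler_pM2l// divr_gt0// expR_gt0.
have := sum_ae_bounded mZ Z_indep Z_ident by_ Ey.
apply: filterS => w [C HC]; exists (C / th) => n; have := HC n.
rewrite sumrB.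
rewrite (eq_bigr (fun i => - th * (chi i * (v (Z i w) - lam)))); last by move=> i _; ring.
rewrite -mulr_sumr -mulr_suml -mulr_sumr.
set A := \sum_(0 <= i < n) _ * _; set S := \sum_(0 <= i < n) _ => H.
have S0 : 0 <= S by apply: sumr_ge0 => i _; exact: sqr_ge0.
rewrite -(ler_pM2l th0) mulrBr mulrN mulrCA divff ?gt_eqF// mulr1.
have : th * (th * h) * S <= th * e * S by rewrite ler_wpM2r// ler_pM2l.
move=> H2; rewrite -subr_ge0.
have := addr_ge0 (_ : 0 <= C - (- th * A - th ^+ 2 * S * h))
  (_ : 0 <= th * e * S - th * (th * h) * S).
rewrite !subr_ge0 => /(_ H H2); rewrite -subr_ge0.
by congr (_ <= _); ring.
Qed.

Variables (L : nat -> T -> R) (K0 : R) (i0 : nat).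
Hypothesis K0_ge0 : 0 <= K0.
Hypothesis L_approx : {ae P, forall w, forall i, (i0 <= i)%N ->
  `|L i w - u (Z i w) - v (Z i w) * chi i| <= K0 * chi i ^+ 2}.

Lemma chi_bounded : exists cb, forall i, chi i <= cb.
Proof.
have ccv : cvgn chi by apply/cvg_ex; exists 0.
have /cvg_seq_bounded/pinfty_ex_gt0[cb _ /= Hcb] := ccv.
by exists cb => i; rewrite (le_trans (ler_norm _))// Hcb.
Qed.

Lemma perturbed_sum_ge : {ae P, forall w, exists C : R, forall n,
  \sum_(0 <= i < n) u (Z i w) + lam * \sum_(0 <= i < n) chi i -
     (K0 + 1) * \sum_(0 <= i < n) chi i ^+ 2 - C <= \sum_(0 <= i < n) L i w}.
Proof.
have [cb Hcb] := chi_bounded.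
apply: filterS2 (weighted_deviation Hcb ltr01) L_approx => w [C1 H1] HL.
have [C2 H2] : exists C, forall n, \sum_(0 <= i < n)
    (u (Z i w) + v (Z i w) * chi i - K0 * chi i ^+ 2) <= \sum_(0 <= i < n) L i w + C.
  apply: (@sum_eventually_le _ _ _ i0) => i ii.
  by have := HL i ii; rewrite ler_norml => /andP[+ _]; lra.
exists (C1 + C2) => n; have h2 := H2 n.
have h1 : - C1 - 1 * \sum_(0 <= i < n) chi i ^+ 2 <=
    \sum_(0 <= i < n) v (Z i w) * chi i - lam * \sum_(0 <= i < n) chi i.
  apply: (le_trans (H1 n)); rewrite mulr_sumr -sumrB le_eqVlt; apply/orP; left.
  by apply/eqP; apply: eq_bigr => i _; ring.
move: h2 h1; rewrite sumrB big_split/= -mulr_sumr.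
move: (\sum_(0 <= i < n) u _) (\sum_(0 <= i < n) _ * _) (\sum_(0 <= i < n) chi i).
move: (\sum_(0 <= i < n) _ ^+ 2) (\sum_(0 <= i < n) L i w) => E F A B D h2 h1.
rewrite (_ : A + _ - _ - _ = (A + B - K0 * E - C2) + ((- C1 - 1 * E) - (B - lam * D))); last by ring.
by rewrite -[leRHS]addr0 lerD// ?subr_le0// lerBlDr.
Qed.

Lemma sqr_sum_small_drift (a : R) : 0 < a -> exists C : R, forall n,
  (K0 + 1) * \sum_(0 <= i < n) chi i ^+ 2 <= a * \sum_(0 <= i < n) chi i + C.
Proof.
move=> a0; have K1 : 0 < K0 + 1 by rewrite ltr_wpDl.
have /cvgrPdist_le /(_ _ (divr_gt0 a0 K1))[m _ Hm] := chi_cvg0.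
have [C HC] : exists C, forall n, \sum_(0 <= i < n) (K0 + 1) * chi i ^+ 2 <=
    \sum_(0 <= i < n) a * chi i + C.
  apply: (@sum_eventually_le _ _ _ m) => i mi.
  rewrite expr2 mulrA ler_wpM2r// mulrC -ler_pdivlMr//.
  by have := Hm i mi; rewrite /= sub0r normrN ger0_norm.
by exists C => n; rewrite !mulr_sumr.
Qed.

Lemma sum_ge_sqrt_of_strong_drift (c : R) n0 : sigma < c * Num.sqrt 2 ->
  (forall i, (n0 <= i.+1)%N -> c * lil_rate R i.+1 <= lam * chi i) ->
  {ae P, forall w, \forall n \near \oo,
     Num.sqrt n%:R <= \sum_(0 <= i < n) L i w}.
Proof.
move=> sc drift.
have c0 : 0 < c by rewrite -(pmulr_lgt0 _ (_ : 0 < Num.sqrt 2)) ?sqrtr_gt0// (lt_trans sigma_gt0).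
have lam0 : 0 < lam.
  have [k k1 Hk] := lnln_ge0_from R.
  have kn : (n0 <= (k + n0).+1)%N by rewrite (leq_trans (leq_addl k n0)).
  have := drift _ kn.
  have l0 : 0 < ln (ln (k + n0).+1%:R) :> R.
    by rewrite (lt_le_trans ltr01)// Hk// (leq_trans (leq_addr n0 k)).
  rewrite lil_rateE ?(ltW l0)// => H.
  have : 0 < lam * chi (k + n0)%N.
    by apply: lt_le_trans H; rewrite mulr_gt0// divr_gt0// sqrtr_gt0.
  move=> H0; move: (H0); rewrite pmulr_lgt0// lt0r chi_ge0 andbT.
  by apply: contraTneq H0 => ->; rewrite mulr0 ltxx.
have [e [kap [/andP[e0 e1] kap0 Hek]]] := drift_constants sigma_gt0 sc.
have bNu : bmf (fun z => - u z) by exact: bmfN.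
have ENu : Ex P (fun w => - u (Z 0%N w)) = 0.
  have := ExZ P (-1) (bmf_Z mZ 0 bmf_u); rewrite Ex_u mulr0 => <-.
  by congr (Ex P _); apply/funext => w; rewrite mulN1r.
have ENu2 : Ex P (fun w => (- u (Z 0%N w)) ^+ 2) = sigma ^+ 2.
  by rewrite -Ex_u2; congr (Ex P _); apply/funext => w; rewrite sqrrN.
have up := upper_lil mZ Z_indep Z_ident bNu ENu ENu2 sigma_gt0 e0.
have [C1 H1] := sqr_sum_small_drift (mulr_gt0 e0 lam0).
have [C2 H2] : exists C, forall n, \sum_(0 <= i < n) c * lil_rate R i.+1 <=
    \sum_(0 <= i < n) lam * chi i + C.
  by apply: (@sum_eventually_le _ _ _ n0) => i ii; apply: drift; exact: leqW.
have H3 := @lil_rate_sum_ge R e (introT andP (conj e0 e1)).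
have low := perturbed_sum_ge.
apply: filterS2 up low => w upw [C HC].
near=> n.
(* This makes the surplus kap (n ln ln n)^(1/2) at least twice the root of n: once for the
   conclusion and once to absorb the constants. *)
have l0 : (2 / kap) ^+ 2 <= ln (ln n%:R) by near: n; exact: near_lnln.
have ll0 : 0 <= ln (ln n%:R) := le_trans (sqr_ge0 _) l0.
have := HC n; have := H1 n; have := H2 n.
have : 2 * (1 - e) ^+ 2 * Num.sqrt (n%:R * ln (ln n%:R)) <= \sum_(0 <= i < n) lil_rate R i.+1.
  by near: n.
have : \sum_(0 <= i < n) - u (Z i w) <= (1 + e) ^+ 3 * sigma * Num.sqrt (2 * n%:R * ln (ln n%:R)).
  by near: n.
rewrite -!mulr_sumr sumrN -(mulrA 2) sqrtrM// mulrA -(mulrA e lam) => h1 h2 h3 h4 h5.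
apply: le_trans (drift_balance h1 h2 h3 h4 h5 c0 e1 (sqrtr_ge0 _) Hek).
rewrite lerBrDr sqrtrM//.
have kl : 2 <= kap * Num.sqrt (ln (ln n%:R)).
  rewrite mulrC -ler_pdivrMr// -(ger0_norm (ltW (divr_gt0 (ltr0Sn R 1) kap0))).
  by rewrite -sqrtr_sqr ler_wsqrtr.
have sq : `|C1 + C + (1 - e) * C2| <= Num.sqrt n%:R.
  rewrite -sqrtr_sqr ler_wsqrtr//; near: n; exact: nbhs_infty_ger.
apply: (@le_trans _ _ (Num.sqrt n%:R * 2)); last first.
  by rewrite mulrCA ler_wpM2l// sqrtr_ge0.
rewrite mulr_natr mulr2n lerD2l; apply: le_trans (ler_norm _) sq.
Unshelve. all: by end_near. Qed.
(** The worst case is a drift pulling down with full weight |lam| chi. Its sum is at most 2 c (n ln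
    ln n)^(1/2) up to a constant, which is the unraised level for the sums of [u]. *)
Lemma sum_ge0_infinitely_often : lam != 0 ->
  (exists n0, forall i, (n0 <= i.+1)%N ->
     `|lam| * chi i <= sigma / Num.sqrt 2 * lil_rate R i.+1) ->
  {ae P, forall w, forall m, exists2 n, (m <= n)%N &
     0 <= \sum_(0 <= i < n) L i w}.
Proof.
move=> lam0 [n0 drift]; pose c := sigma / Num.sqrt 2.
have t0 : 0 < Num.sqrt 2 :> R by rewrite sqrtr_gt0.
have c0 : 0 < c by exact: divr_gt0.
have cE : sigma * Num.sqrt 2 = 2 * c.
  apply: (mulIf (lt0r_neq0 t0)); rewrite -(mulrA sigma) -expr2 sqr_sqrtr// -(mulrA 2).
  by rewrite /c divfK ?gt_eqF// mulrC.
have l0 : 0 < `|lam| by rewrite normr_gt0.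
have [C1 H1] : exists C, forall n, \sum_(0 <= i < n) `|lam| * chi i <=
    \sum_(0 <= i < n) c * lil_rate R i.+1 + C.
  by apply: (@sum_eventually_le _ _ _ n0) => i ii; apply: drift; exact: leqW.
have {}drift i : (n0 <= i.+1)%N -> `|lam| * chi i <= c * lil_rate R i.+1 := drift i.
clearbody c; pose K := (c / `|lam|) ^+ 2; have K_ge0 : 0 <= K by exact: sqr_ge0.
have [C2 H2] : exists C, forall n, \sum_(0 <= i < n) chi i ^+ 2 <=
    \sum_(0 <= i < n) K * (ln i.+1%:R / i.+1%:R) + C.
  have [k k1 Hk] := lnln_ge0_from R.
  apply: (@sum_eventually_le _ _ _ (maxn n0 k)) => i.
  rewrite geq_max => /andP[n0i ki].
  have ll1 := Hk i.+1 (leqW ki); have ll0 := le_trans ler01 ll1.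
  have l1 : ln (ln i.+1%:R) <= ln i.+1%:R :> R.
    have lp : 0 < ln i.+1%:R :> R by rewrite ltNge; apply: contraL ll1 => /ln0 ->; rewrite -ltNge ltr01.
    have := le_ln1Dx (_ : -1 < ln i.+1%:R - 1 :> R).
    rewrite (addrC 1) subrK => H; apply: (le_trans (H _)); last by rewrite gerBl.
    by rewrite ltrBrDr addNr.
  have ch : chi i <= c / `|lam| * lil_rate R i.+1.
    by rewrite mulrAC ler_pdivlMr// mulrC drift// leqW.
  apply: (@le_trans _ _ ((c / `|lam| * lil_rate R i.+1) ^+ 2)).
    by rewrite lerXn2r ?nnegrE// (le_trans (chi_ge0 i)).
  rewrite exprMn -/K ler_wpM2l// lil_rateE// expr_div_n !sqr_sqrtr//.
  by rewrite ler_wpM2r.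
have [C3 H3] := lil_rate_sum_le R.
(* The sum of chi^2 is at most 2 K (ln n)^2 up to a constant, by ln ln i <= ln i and the bound 1 +
   ln n for harmonic sums. The extra 1 leaves (ln n)^2 for all constants. *)
have D0 : 0 <= (K0 + 1) * (2 * K) + 1.
  exact: (addr_ge0 (mulr_ge0 (addr_ge0 K0_ge0 ler01) (mulr_ge0 (ler0n _ 2) K_ge0)) ler01).
have low := perturbed_sum_ge.
have lil := lower_lil mZ Z_indep Z_ident bmf_u Ex_u Ex_u2 sigma_gt0 D0.
apply: filterS2 lil low => w lilw [C HC] m.
pose B := c * C3 + C1 + (K0 + 1) * C2 + C.
have [N _ HN] : \forall n \near \oo, [/\ 1 <= ln n%:R :> R, 1 <= ln (ln n%:R) :> R & B <= ln n%:R].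
  by near=> n; split; near: n; exact: near_ln || exact: near_lnln.
have [n] := lilw (maxn (maxn m N) 1); rewrite !geq_max => /andP[/andP[mn Nn] n1] Hn.
exists n => //; have [ln1 lln1 lnB] := HN n Nn.
have H4 : \sum_(0 <= i < n) K * (ln i.+1%:R / i.+1%:R) <= K * (ln n%:R * (2 * ln n%:R)).
  rewrite -mulr_sumr ler_wpM2l//.
  apply: (@le_trans _ _ (ln n%:R * \sum_(0 <= i < n) i.+1%:R^-1)).
    rewrite mulr_sumr; apply: ler_sum_nat => i /andP[_ ni].
    by rewrite ler_wpM2r// ler_ln ?posrE ?ltr0n// ler_nat.
  rewrite ler_wpM2l ?(le_trans ler01)//; apply: (le_trans (harmonic_sum_le _ n1)).
  by rewrite mulr_natl mulr2n lerD2r.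
move: Hn; rewrite -(mulrA 2) sqrtrM// (mulrA sigma) cE => Hn.
have h1 := H1 n; have h2 := le_trans (H2 n) (lerD H4 (lexx C2)).
rewrite -!mulr_sumr in h1.
have h5 : - (`|lam| * \sum_(0 <= i < n) chi i) <= lam * \sum_(0 <= i < n) chi i.
  by rewrite -mulNr ler_wpM2r ?sumr_ge0// lerNl -normrN ler_norm.
exact: critical_balance (HC n) Hn h5 h1 (H3 n lln1) h2 (ltW c0) (addr_ge0 K0_ge0 ler01) ln1 lnB.
Unshelve. all: by end_near. Qed.

End perturbed_walk.

(** * The random environment *)

Section odds.
Context {R : realType}.
Implicit Types x s z eps : R.

Lemma ln1p_taylor2 z : `|z| <= 1 / 2 -> `|ln (1 + z) - z| <= 2 * z ^+ 2.
Proof.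
rewrite ler_norml => /andP[z1 z2].
have z10 : 0 < 1 + z by lra.
have up : ln (1 + z) <= z by apply: le_ln1Dx; lra.
have lo : z / (1 + z) <= ln (1 + z).
  have := @le_ln1Dx R (- (z / (1 + z))).
  have -> : 1 + - (z / (1 + z)) = (1 + z)^-1 by field; rewrite gt_eqF.
  rewrite lnV ?posrE// lerN2; apply.
  by rewrite ltrN2 ltr_pdivrMr// mul1r ltrDr.
have lo2 : z - 2 * z ^+ 2 <= z / (1 + z).
  rewrite ler_pdivlMr// -subr_ge0.
  rewrite (_ : _ - _ = z ^+ 2 * (1 + 2 * z)); last by ring.
  by rewrite mulr_ge0 ?sqr_ge0//; lra.
have := sqr_ge0 z; rewrite ler_norml; lra.
Qed.

(** The change of the log odds is ln(1 + s/x) - ln(1 - s/(1-x)), and each logarithm differs from its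
    linear part by at most 2 s^2 / eps^2. *)
Lemma ln_odds_perturbation eps x s : 0 < eps -> eps <= x -> x <= 1 - eps ->
  `|s| <= eps / 2 ->
  `|ln ((x + s) / (1 - (x + s))) - (ln x - ln (1 - x)) - s / (x * (1 - x))| <=
  4 / eps ^+ 2 * s ^+ 2.
Proof.
move=> e0 ex xe se.
have x0 : 0 < x by lra.
have y0 : 0 < 1 - x by lra.
have bnd t : eps <= t -> `|s / t| <= 1 / 2 /\ (s / t) ^+ 2 <= s ^+ 2 / eps ^+ 2.
  move=> et; have t0 : 0 < t by lra.
  split; last first.
    rewrite expr_div_n; apply: ler_wpM2l; first exact: sqr_ge0.
    by rewrite lef_pV2 ?posrE ?exprn_gt0// lerXn2r// nnegrE ltW.
  by rewrite normrM normfV (gtr0_norm t0) ler_pdivrMr//; apply: (le_trans se); lra.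
have [a1 a2] := bnd x ex.
have ey : eps <= 1 - x by lra.
have [b1 b2] := bnd (1 - x) ey.
have p1 : 0 < 1 + s / x by move: a1; rewrite ler_norml => /andP[]; lra.
have p2 : 0 < 1 + - (s / (1 - x)) by move: b1; rewrite ler_norml => /andP[]; lra.
have -> : ln ((x + s) / (1 - (x + s))) =
    ln x + ln (1 + s / x) - (ln (1 - x) + ln (1 + - (s / (1 - x)))).
  have -> : x + s = x * (1 + s / x) by field; rewrite gt_eqF.
  have -> : 1 - x * (1 + s / x) = (1 - x) * (1 + - (s / (1 - x))).
    by field; rewrite !gt_eqF.
  by rewrite ln_div ?posrE ?mulr_gt0// !lnM ?posrE.
have -> : s / (x * (1 - x)) = s / x + s / (1 - x) by field; rewrite !gt_eqF.
rewrite (_ : 4 / eps ^+ 2 * s ^+ 2 = 4 * (s ^+ 2 / eps ^+ 2)); last by ring.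
have := ln1p_taylor2 a1; rewrite -normrN in b1; have := ln1p_taylor2 b1.
rewrite sqrrN !ler_norml => /andP[c1 c2] /andP[d1 d2].
by apply/andP; split; lra.
Qed.

(** Eventually the root of k exceeds 4 ln k, so the terms are at most k^(-4), hence at most
    (k+2)^(-2). *)
Lemma sum_expR_sqrt_bounded (S : nat -> R) :
  (\forall n \near \oo, Num.sqrt n%:R <= S n) ->
  exists M, forall n, \sum_(0 <= k < n) expR (- S k) <= M.
Proof.
move=> HS.
have [N _ HN] : \forall n \near \oo, Num.sqrt n%:R <= S n /\
    4 * ln n%:R ^+ 1 <= Num.sqrt n%:R :> R.
  by near=> n; split; near: n => //; exact: near_ln_pow.
have [C HC] : exists C, forall n, \sum_(0 <= k < n) expR (- S k) <=
    \sum_(0 <= k < n) expR (- ((1 + 1) * ln k.+2%:R)) + C.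
  apply: (@sum_eventually_le _ _ _ (maxn N 2)) => i; rewrite geq_max => /andP[Ni i2].
  rewrite ler_expR lerN2; have [h1 h2] := HN i Ni.
  apply: le_trans h1; apply: le_trans h2.
  have i0 : 0 < i%:R :> R by rewrite ltr0n (leq_trans _ i2).
  have : ln i.+2%:R <= ln (i%:R ^+ 2) :> R.
    rewrite ler_ln ?posrE ?exprn_gt0// -natrX ler_nat.
    by clear -i2; nia.
  by rewrite lnXn// mulr2n expr1; lra.
exists (1^-1 + C) => n; apply: (le_trans (HC n)); rewrite lerD2r.
exact: sum_expR_ln_le.
Unshelve. all: by end_near. Qed.

Lemma gam_expR (p : nat -> R) n :
  (forall i, (0 < i)%N -> 0 < p i / (1 - p i)) ->
  gam p n = expR (\sum_(0 <= i < n) ln (p i.+1 / (1 - p i.+1))).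
Proof.
move=> p0; rewrite /gam big_add1/= expR_sum.
by apply: eq_bigr => i _; rewrite lnK// posrE p0.
Qed.

End odds.

Section measurability.
Context d (T : measurableType d) (R : realType).

(** The inverse is f times exp(-ln f^2), with both sides 0 where f vanishes; this reduces the claim
    to the exponential and the logarithm. *)
Lemma measurable_invr (f : T -> R) : measurable_fun setT f ->
  measurable_fun setT (fun w => (f w)^-1).
Proof.
move=> mf.
have -> : (fun w => (f w)^-1) = (fun w => f w * expR (- ln (f w ^+ 2))).
  apply/funext => w; have [->|f0] := eqVneq (f w) 0; first by rewrite invr0 mul0r.
  have f2 : 0 < f w ^+ 2 by rewrite lt0r sqr_ge0 andbT expf_neq0.
  by rewrite -lnV ?posrE// lnK ?posrE ?invr_gt0// expr2 invfM mulrA divff// mul1r.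
apply: measurable_funM => //; apply: measurableT_comp; first exact: measurable_expR.
apply: measurableT_comp => //; apply: measurableT_comp; first exact: measurable_ln.
exact: measurable_funX.
Qed.

Definition clip (a b x : R) := Num.max a (Num.min b x).

Lemma clip_bnd (a b x : R) : a <= b -> a <= clip a b x <= b.
Proof. by move=> ab; rewrite le_max lexx ge_max ab ge_min lexx. Qed.

Lemma clip_id (a b x : R) : a <= x -> x <= b -> clip a b x = x.
Proof. by move=> ax xb; rewrite /clip (min_idPr xb) (max_idPr ax). Qed.

Lemma bmf_clip (a b : R) (f : T -> R) : a <= b -> measurable_fun setT f ->
  bmf (fun w => clip a b (f w)).
Proof.
move=> ab mf; split.
  by apply: measurable_maxr => //; exact: measurable_minr.
exists (`|a| + `|b|) => w; have /andP[h1 h2] := clip_bnd (f w) ab.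
rewrite ler_norml; apply/andP; split.
  by rewrite (le_trans _ h1)// lerNl (le_trans _ (_ : `|a| <= _)) ?lerDl// -normrN ler_norm.
by rewrite (le_trans h2)// (le_trans (ler_norm _))// lerDr.
Qed.

Lemma bmf_ln (a : R) (f : T -> R) : 0 < a -> bmf f -> (forall w, a <= f w <= 1) ->
  bmf (fun w => ln (f w)).
Proof.
move=> a0 [mf _] bf; split; first by apply: measurableT_comp => //; exact: measurable_ln.
exists (- ln a) => w; have /andP[h1 h2] := bf w.
have f0 : 0 < f w by exact: lt_le_trans a0 h1.
rewrite ler0_norm ?ln_le0// lerN2 ler_ln ?posrE//.
Qed.

End measurability.

(** * The environment as a sequence of independent increments *)

Section environment_increments.
Context (R : realType) d (T : measurableType d) (P : probability T R).
Variables (xi Y : nat -> {RV P >-> R}).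
Hypothesis xiY_iid : iid P [set i | (0 < i)%N] (fun i w => (xi i w, Y i w)).

(** The environment is indexed from 1, the general results from 0; [chi'] and [L] in the theorem are
    shifted alike. *)
Definition inc (i : nat) (w : T) : R * R := (xi i.+1 w, Y i.+1 w).

Lemma measurable_inc i : measurable_fun setT (inc i).
Proof. by apply: measurable_fun_pair. Qed.

Lemma inc_ident n B : measurable B -> P (inc n @^-1` B) = P (inc 0%N @^-1` B).
Proof. by move=> mB; exact: (xiY_iid.2 n.+1 1%N B isT isT mB). Qed.

(** Mutual independence is used for the indices 1 to n and again with n + 1 added; the two products
    differ by the last factor. *)
Lemma inc_indep n (A : nat -> set (R * R)) B :
  (forall i, measurable (A i)) -> measurable B ->
  (P ((\bigcap_(i in `I_n) inc i @^-1` A i) `&` inc n @^-1` B) =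
   P (\bigcap_(i in `I_n) inc i @^-1` A i) * P (inc n @^-1` B))%E.
Proof.
move=> mA mB.
pose A' k := if k == n.+1 then B else A k.-1.
have mA' k : measurable (A' k) by rewrite /A'; case: ifP.
pose J := [fset k in iota 1 n]%fset.
have inJ k : (k \in J) = (0 < k < n.+1)%N by rewrite in_fset /= mem_iota add1n.
have nJ : n.+1 \notin J by rewrite inJ ltnn andbF.
have JI : [set` J] `<=` [set i | (0 < i)%N] by move=> k /=; rewrite inJ => /andP[].
have J'I : [set` (n.+1 |` J)%fset] `<=` [set i | (0 < i)%N].
  by move=> k /=; rewrite in_fset1U => /orP[/eqP->//|]; rewrite inJ => /andP[].
have E1 : \bigcap_(i in `I_n) inc i @^-1` A i =
    \bigcap_(k in [set` J]) (fun w => (xi k w, Y k w)) @^-1` A' k.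
  apply/seteqP; split => w H k /=.
    rewrite inJ => /andP[k0 kn]; rewrite /A' ltn_eqF//.
    by have := H k.-1; rewrite /inc /= prednK//; apply.
  move=> kn; have := H k.+1; rewrite /= inJ /A' eqSS (ltn_eqF kn) /= ltnS => H'; exact: H'.
have E2 : \bigcap_(k in [set` (n.+1 |` J)%fset]) (fun w => (xi k w, Y k w)) @^-1` A' k =
    (\bigcap_(i in `I_n) inc i @^-1` A i) `&` inc n @^-1` B.
  rewrite E1; apply/seteqP; split => w.
    move=> H; split; last by have := H n.+1; rewrite /A' eqxx; apply; rewrite /= fset1U1.
    by move=> k kJ; apply: H; rewrite /= in_fset1U (_ : k \in J) ?orbT.
  move=> [H1 H2] k /=; rewrite in_fset1U => /orP[/eqP->|]; last exact: H1.
  by rewrite /A' eqxx.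
rewrite -E2 E1 (xiY_iid.1 (n.+1 |` J)%fset A' J'I (fun i _ => mA' i)).
rewrite (xiY_iid.1 J A' JI (fun i _ => mA' i)) big_fsetU1//= muleC.
by rewrite /A' eqxx.
Qed.

Variable eps : R.
Hypothesis eps_gt0 : 0 < eps.
Hypothesis eps_lt : eps < 1 / 2.
Hypothesis xi_bounded : P [set w | eps <= xi 1%N w <= 1 - eps] = 1%E.
Hypothesis Y_bounded : P [set w | -1 <= Y 1%N w <= 1] = 1%E.

Definition in_range (z : R * R) := (eps <= z.1 <= 1 - eps) && (-1 <= z.2 <= 1).

Lemma ae_in_range : {ae P, forall w, forall i, in_range (inc i w)}.
Proof.
have ae1 (f : R * R -> R) (a b : R) : measurable_fun setT f ->
    P [set w | a <= f (inc 0%N w) <= b] = 1%E ->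
    {ae P, forall w, forall i, a <= f (inc i w) <= b}.
  move=> mf H; apply: ae_foralln => i.
  have mB : measurable [set z | a <= f z <= b].
    rewrite -[X in measurable X]setTI (_ : [set z | _] = f @^-1` `[a, b]).
      by apply: mf.
    by apply/seteqP; split => z /=; rewrite in_itv.
  have mBi : measurable (inc i @^-1` [set z | a <= f z <= b]).
    by rewrite -[X in measurable X]setTI; exact: measurable_inc.
  exists (~` (inc i @^-1` [set z | a <= f z <= b])); split => //.
    exact: measurableC.
  apply: etrans (probability_setC P mBi) _.
  by rewrite inc_ident// (_ : P _ = 1%E) ?subee.
have h1 := ae1 fst _ _ measurable_fst xi_bounded.
have h2 := ae1 snd _ _ measurable_snd Y_bounded.
by apply: filterS2 h1 h2 => w H1 H2 i; apply/andP.
Qed.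

(** Clipping turns an almost sure bound into one valid everywhere, so that the functions built from
    it are bounded without exception. *)
Definition xi_clip (z : R * R) : R := clip eps (1 - eps) z.1.

Definition log_odds (z : R * R) : R := ln (xi_clip z) - ln (1 - xi_clip z).

(** The exponential is 1 / (x (1 - x)) at the clipped x, in a form whose boundedness and
    measurability follow from those of the two logarithms. *)
Definition drift_coef (z : R * R) : R :=
  clip (-1) 1 z.2 * expR (- (ln (xi_clip z) + ln (1 - xi_clip z))).

Let eps_le : eps <= 1 - eps.
Proof. by move: eps_lt; lra. Qed.

Let bmf_ln_xi : bmf (fun z => ln (xi_clip z)).
Proof.
apply: (bmf_ln eps_gt0); first by apply: bmf_clip => //; exact: measurable_fst.
by move=> z; have /andP[-> h] := clip_bnd z.1 eps_le; rewrite (le_trans h)// gerBl ltW.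
Qed.

Let bmf_ln_1xi : bmf (fun z => ln (1 - xi_clip z)).
Proof.
apply: (bmf_ln eps_gt0).
  by apply: bmfB; [exact: bmf_cst|apply: bmf_clip => //; exact: measurable_fst].
move=> z; have := clip_bnd z.1 eps_le; rewrite -/(xi_clip z) => /andP[h1 h2].
by apply/andP; split; move: eps_gt0 h1 h2; lra.
Qed.

Lemma bmf_log_odds : bmf log_odds.
Proof. exact: bmfB. Qed.

Lemma bmf_drift_coef : bmf drift_coef.
Proof.
apply: bmfM; first by apply: bmf_clip; [lra|exact: measurable_snd].
by apply: bmf_expR; apply: bmfN; exact: bmfD.
Qed.

Lemma log_oddsE z : in_range z -> log_odds z = ln (z.1 / (1 - z.1)).
Proof.
move=> /andP[/andP[h1 h2] _]; rewrite /log_odds /xi_clip clip_id//.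
by rewrite ln_div// posrE; move: eps_gt0 h1 h2; lra.
Qed.

Lemma drift_coefE z : in_range z -> drift_coef z = z.2 / (z.1 * (1 - z.1)).
Proof.
move=> /andP[/andP[h1 h2] /andP[h3 h4]]; rewrite /drift_coef /xi_clip !clip_id//.
have p1 : 0 < z.1 by exact: lt_le_trans eps_gt0 h1.
have p2 : 0 < 1 - z.1 by move: eps_gt0 h2; lra.
by rewrite -lnM ?posrE// -lnV ?posrE ?mulr_gt0// lnK// posrE invr_gt0 mulr_gt0.
Qed.

Lemma expectation_inc (h : R * R -> R) (f : T -> R) : bmf h -> measurable_fun setT f ->
  (forall w, in_range (inc 0%N w) -> f w = h (inc 0%N w)) ->
  ('E_P[f] = (Ex P (fun w => h (inc 0%N w)))%:E)%E.
Proof.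
move=> bh mf fh; have bZ := bmf_Z measurable_inc 0 bh.
rewrite unlock -Ex_EFin//; apply: ae_eq_integral => //.
- exact/measurable_EFinP.
- by apply/measurable_EFinP; case: bZ.
- by apply: filterS ae_in_range => w /(_ 0%N) /fh /= ->.
Qed.

End environment_increments.

Lemma truncate_bnd (R : realType) (eps x : R) : eps < 1 / 2 -> 0 < eps ->
  eps / 2 <= truncate eps x <= 1 - eps / 2.
Proof.
move=> e1 e0; rewrite /truncate; case: ltP => h1; first by apply/andP; split; lra.
by case: ltP => h2; apply/andP; split; lra.
Qed.

Lemma truncate_id (R : realType) (eps x s : R) : eps <= x -> x <= 1 - eps ->
  `|s| <= eps / 2 -> truncate eps (x + s) = x + s.
Proof.
rewrite ler_norml => h1 h2 /andP[h3 h4]; rewrite /truncate.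
have e1 : eps / 2 <= x + s by lra.
have e2 : x + s <= 1 - eps / 2 by lra.
by rewrite !ltNge e1 e2.
Qed.

Lemma sum_unbounded (R : realType) (g : nat -> R) (M : R) :
  (forall k, 0 <= g k) -> (forall m, exists2 n, (m <= n)%N & 1 <= g n) ->
  exists n, M <= \sum_(0 <= k < n) g k.
Proof.
move=> g0 Hg; have H j : exists n, j%:R <= \sum_(0 <= k < n) g k.
  elim: j => [|j [n Hn]]; first by exists 0%N; rewrite big_geq.
  have [m nm gm] := Hg n; exists m.+1; rewrite big_nat_recr//= -natr1 lerD//.
  rewrite (le_trans Hn)// [leRHS](@big_cat_nat _ _ _ n)//= lerDl.
  by apply: sumr_ge0.
have [n Hn] := H (Num.bound `|M|); exists n; apply: le_trans Hn; apply: (le_trans (ler_norm _)).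
by rewrite ltW// archi_boundP// normr_ge0.
Qed.

Theorem theorem6 (R : realType)
  (chi : R -> R)
  (chi_ge0 : forall x : R, 0 <= x -> 0 <= chi x)
  (chi_cvg0 : chi x @[x --> +oo] --> 0)
  (eps : R) (eps_gt0 : 0 < eps) (eps_lt : eps < 1 / 2)
  (d : measure_display) (T : measurableType d) (P : probability T R)
  (xi Y : nat -> {RV P >-> R})
  (xiY_iid : iid P [set i | (0 < i)%N] (fun i w => (xi i w, Y i w)))
  (xi_bounded : P [set w | eps <= xi 1%N w <= 1 - eps] = 1%E)
  (Y_bounded : P [set w | -1 <= Y 1%N w <= 1] = 1%E)
  (zeta : nat -> T -> R)
  (zetaE : forall n w, zeta n w = ln (xi n w / (1 - xi n w)))
  (p : T -> nat -> R)
  (pE : forall w n, (0 < n)%N ->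
    p w n = truncate eps (xi n w + Y n w * chi n%:R))
  (d' : measure_display) (S : measurableType d')
  (r : nat)
  (Q : T -> probability S R)
  (eta : T -> nat -> {mfun S >-> nat})
  (eta_chain : forall w, markov_chain (Q w) (walk_kernel (p w)) r (eta w))
  (lambda sigma : R)
  (lambdaE : ('E_P[fun w => (Y 1%N w / (xi 1%N w * (1 - xi 1%N w)))%R]
    = lambda%:E)%E)
  (sigma_ge0 : 0 <= sigma)
  (sigmaE : ('V_P[zeta 1%N] = (sigma ^+ 2)%R%:E)%E)
  (lambda_neq0 : lambda != 0)
  (Y_nontrivial : (P [set w | Y 1%N w = 0%R] < 1)%E)
  (zeta_mean0 : ('E_P[zeta 1%N] = 0)%E)
  (sigma2_gt0 : 0 < sigma ^+ 2) :
  let c_crit := sigma * 2 `^ (- (1 / 2)) in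
  [/\ (exists (c : R) (n0 : nat), [/\ c_crit < c, (3 <= n0)%N &
         forall n, (n0 <= n)%N -> c * lil_rate R n <= lambda * chi n%:R]) ->
      {ae P, forall w, ergodic (Q w) r (eta w)},
      (exists (c : R) (n0 : nat), [/\ c <= c_crit, (3 <= n0)%N &
         forall n, (n0 <= n)%N -> `|lambda| * chi n%:R <= c * lil_rate R n]) ->
      {ae P, forall w, null_recurrent (Q w) r (eta w)} &
      (exists (c : R) (n0 : nat), [/\ c_crit < c, (3 <= n0)%N &
         forall n, (n0 <= n)%N -> lambda * chi n%:R <= - c * lil_rate R n]) ->
      {ae P, forall w, transient (Q w) r (eta w)}].
Proof.
move=> c_crit.
have sigma_gt0 : 0 < sigma.
  by rewrite lt0r sigma_ge0 andbT; apply: contraTneq sigma2_gt0 => ->; rewrite expr0n/= ltxx.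
have t0 : 0 < Num.sqrt 2 :> R by rewrite sqrtr_gt0.
have c_critE : c_crit = sigma / Num.sqrt 2.
  by rewrite /c_crit powRN (_ : 1 / 2 = 2^-1) ?powR12_sqrt// mul1r.
have mZ i : measurable_fun setT (inc xi Y i) by exact: measurable_inc.
have Z_indep := inc_indep xiY_iid.
have Z_ident := inc_ident xiY_iid.
pose u := log_odds eps; pose v := drift_coef eps.
have bu : bmf u by exact: bmf_log_odds.
have bv : bmf v by exact: bmf_drift_coef.
have mxi : measurable_fun setT (xi 1%N) by [].
have m1xi : measurable_fun setT (fun w => 1 - xi 1%N w) by exact: measurable_funB.
have mzeta : measurable_fun setT (zeta 1%N).
  rewrite (_ : zeta 1%N = fun w => ln (xi 1%N w / (1 - xi 1%N w))); last exact/funext.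
  apply: measurableT_comp; first exact: measurable_ln.
  by apply: measurable_funM => //; exact: measurable_invr.
have Eu : Ex P (fun w => u (inc xi Y 0 w)) = 0.
  apply: EFin_inj; rewrite -(expectation_inc xiY_iid xi_bounded Y_bounded bu mzeta)//.
  by move=> w iw; rewrite /u log_oddsE.
have Eu2 : Ex P (fun w => u (inc xi Y 0 w) ^+ 2) = sigma ^+ 2.
  apply: EFin_inj; rewrite -sigmaE /variance covariance.unlock zeta_mean0/=; apply/esym.
  apply: (expectation_inc xiY_iid xi_bounded Y_bounded (bmfX 2 bu)).
    by apply: measurable_funM; apply: measurable_funB.
  move=> w iw; transitivity ((zeta 1%N w - 0) ^+ 2) => //.
  by rewrite subr0 zetaE /u log_oddsE.
have Ev : Ex P (fun w => v (inc xi Y 0 w)) = lambda.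
  apply: EFin_inj; rewrite -lambdaE; apply/esym.
  apply: (expectation_inc xiY_iid xi_bounded Y_bounded bv).
    apply: measurable_funM => //; apply: measurable_invr.
    exact: measurable_funM.
  by move=> w iw; rewrite /v drift_coefE.
pose chi' i := chi i.+1%:R.
have chi'_ge0 i : 0 <= chi' i by exact: chi_ge0.
have chi'_cvg0 : chi' @ \oo --> 0.
  have H : (fun n => chi n%:R) @ \oo --> 0 by exact: (cvg_comp _ _ cvgr_idn chi_cvg0).
  by move: H; rewrite -cvg_shiftS.
pose L i w := ln (p w i.+1 / (1 - p w i.+1)).
have a0 : 0 < eps / 2 by exact: divr_gt0.
have p_bnd w i : (0 < i)%N -> eps / 2 <= p w i <= 1 - eps / 2.
  by move=> i0; rewrite pE// truncate_bnd.
have K0_ge0 : 0 <= 4 / eps ^+ 2 by rewrite divr_ge0// sqr_ge0.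
have [i0 L_approx] : exists i0, {ae P, forall w, forall i, (i0 <= i)%N ->
  `|L i w - u (inc xi Y i w) - v (inc xi Y i w) * chi' i| <= 4 / eps ^+ 2 * chi' i ^+ 2}.
  (* From [i0] on, chi is at most eps / 2, so the perturbation cannot leave the truncation interval
     and [truncate] acts as the identity. *)
  have /cvgrPdist_le /(_ _ a0)[i0 _ Hi0] := chi'_cvg0.
  exists i0; apply: filterS (ae_in_range xiY_iid xi_bounded Y_bounded) => w rw i ii.
  have := Hi0 i ii; rewrite /= sub0r normrN ger0_norm// => chi_le.
  have /andP[/andP[h1 h2] /andP[h3 h4]] := rw i.
  have Y1 : `|Y i.+1 w| <= 1 by rewrite ler_norml h3.
  have se : `|Y i.+1 w * chi' i| <= chi' i.
    by rewrite normrM (ger0_norm (chi'_ge0 i)) ler_piMl.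
  rewrite /L pE// truncate_id//; last exact: le_trans se chi_le.
  have x0 : 0 < xi i.+1 w by exact: lt_le_trans eps_gt0 h1.
  have x1 : 0 < 1 - xi i.+1 w by rewrite subr_gt0 (le_lt_trans h2)// gtrBl.
  have E : ln (xi i.+1 w / (1 - xi i.+1 w)) = ln (xi i.+1 w) - ln (1 - xi i.+1 w).
    by rewrite ln_div ?posrE.
  rewrite /u log_oddsE//= E /v drift_coefE//= (mulrAC (Y i.+1 w)).
  apply: (le_trans (ln_odds_perturbation eps_gt0 h1 h2 (le_trans se chi_le))).
  by rewrite ler_wpM2l// -real_normK ?num_real// lerXn2r ?nnegrE.
have gamE w n : gam (p w) n = expR (\sum_(0 <= i < n) L i w).
  rewrite gam_expR// => i i1; have /andP[h1 h2] := p_bnd w i i1.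
  apply: divr_gt0; first exact: lt_le_trans a0 h1.
  by rewrite subr_gt0 (le_lt_trans h2)// gtrBl.
have gamVE w n : (gam (p w) n)^-1 = expR (- \sum_(0 <= i < n) L i w).
  by rewrite gamE expRN.
have bNu : bmf (fun z => - u z) by exact: bmfN.
have bNv : bmf (fun z => - v z) by exact: bmfN.
have ENu : Ex P (fun w => - u (inc xi Y 0 w)) = 0.
  have := ExZ P (-1) (bmf_Z mZ 0 bu); rewrite Eu mulr0 => <-.
  by congr (Ex P _); apply/funext => w; rewrite mulN1r.
have ENu2 : Ex P (fun w => (- u (inc xi Y 0 w)) ^+ 2) = sigma ^+ 2.
  by rewrite -Eu2; congr (Ex P _); apply/funext => w; rewrite sqrrN.
have ENv : Ex P (fun w => - v (inc xi Y 0 w)) = - lambda.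
  have := ExZ P (-1) (bmf_Z mZ 0 bv); rewrite Ev mulN1r => <-.
  by congr (Ex P _); apply/funext => w; rewrite mulN1r.
(* The negated log odds have the same structure with [- u], [- v] and [- lambda]; they serve one
   half of (ii) and all of (iii). *)
have NL_approx : {ae P, forall w, forall i, (i0 <= i)%N ->
  `|- L i w - - u (inc xi Y i w) - - v (inc xi Y i w) * chi' i| <= 4 / eps ^+ 2 * chi' i ^+ 2}.
  apply: filterS L_approx => w H i ii; rewrite -normrN.
  by rewrite (_ : - (- L i w - _ - _) = L i w - u (inc xi Y i w) - v (inc xi Y i w) * chi' i) ?H//; ring.
have crit_lt c : c_crit < c -> sigma < c * Num.sqrt 2.
  by rewrite c_critE ltr_pdivrMr.
split.
- move=> [c [n0 [/crit_lt cc _ Hc]]].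
  have := sum_ge_sqrt_of_strong_drift mZ Z_indep Z_ident bu Eu Eu2 sigma_gt0
    bv Ev chi'_ge0 chi'_cvg0 K0_ge0 L_approx cc (fun i => Hc i.+1).
  apply: filterS => w /sum_expR_sqrt_bounded[M HM].
  apply: (walk_ergodic (eta_chain w) a0 (p_bnd w) (M := M)) => n.
  by rewrite (eq_bigr _ (fun i _ => gamVE w i)).
- move=> [c [n0 [cc _ Hc]]].
  have Hlam : exists n0, forall i, (n0 <= i.+1)%N ->
      `|lambda| * chi' i <= sigma / Num.sqrt 2 * lil_rate R i.+1.
    exists n0 => i ii; apply: (le_trans (Hc _ ii)).
    by rewrite -c_critE ler_wpM2r// lil_rate_ge0.
  have HN : exists n0, forall i, (n0 <= i.+1)%N ->
      `|- lambda| * chi' i <= sigma / Num.sqrt 2 * lil_rate R i.+1 by rewrite normrN.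
  have := sum_ge0_infinitely_often mZ Z_indep Z_ident bu Eu Eu2 sigma_gt0
    bv Ev chi'_ge0 chi'_cvg0 K0_ge0 L_approx lambda_neq0 Hlam.
  have := sum_ge0_infinitely_often mZ Z_indep Z_ident bNu ENu ENu2 sigma_gt0
    bNv ENv chi'_ge0 chi'_cvg0 K0_ge0 NL_approx (_ : - lambda != 0) HN.
  rewrite oppr_eq0 => /(_ lambda_neq0); apply: filterS2 => w H1 H2.
  (* Sums >= 0 infinitely often give infinitely many [gam] >= 1, and sums <= 0 infinitely many
     inverses >= 1, so neither series converges. *)
  apply: (walk_null_recurrent (eta_chain w) a0 (p_bnd w)) => M.
    apply: sum_unbounded => [k|m]; first by rewrite gamE expR_ge0.
    by have [n mn Hn] := H2 m; exists n => //; rewrite gamE -expR0 ler_expR.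
  apply: sum_unbounded => [k|m]; first by rewrite gamVE expR_ge0.
  have [n mn Hn] := H1 m; exists n => //; rewrite gamVE -expR0 ler_expR.
  by rewrite -sumrN.
- move=> [c [n0 [/crit_lt cc _ Hc]]].
  have := sum_ge_sqrt_of_strong_drift mZ Z_indep Z_ident bNu ENu ENu2 sigma_gt0
    bNv ENv chi'_ge0 chi'_cvg0 K0_ge0 NL_approx cc (n0 := n0).
  have Hc' i : (n0 <= i.+1)%N -> c * lil_rate R i.+1 <= - lambda * chi' i.
    by move=> ii; rewrite mulNr lerNr -mulNr; exact: Hc.
  move=> /(_ Hc'); apply: filterS => w /sum_expR_sqrt_bounded[M HM].
  apply: (walk_transient (eta_chain w) a0 (p_bnd w) (M := M)) => n.
  rewrite (eq_bigr _ (fun i _ => gamE w i)); apply: le_trans (HM n).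
  by apply: ler_sum => i _; rewrite sumrN opprK.
Qed.
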